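(* Let $\gamma>0$ and let either $N=3$ and $2<\sigma<\infty$, or $N=4$ and $1<\sigma<\infty$. Assume that $u\in X$ is a nontrivial radial solution to $$\gamma\Delta^2u-\Delta u=|u|^{2\sigma}u,\qquad x\in\mathbb{R}^N.$$ Then there exists $C\in\mathbb{R}\setminus\{0\}$ such that $$\lim_{|x|\to\infty}\frac{u(x)}{|x|^{2-N}}=C.$$
   Context: $X:=\{u\in D^{1,2}(\mathbb{R}^N):\int_{\mathbb{R}^N}|\Delta u|^2dx<\infty\}$, equipped with the norm $\|u\|_X^2:=\int_{\mathbb{R}^N}|\Delta u|^2dx+\int_{\mathbb{R}^N}|\nabla u|^2dx$. Functions are real-valued and solutions are understood in the weak sense; under the assumptions $X$ embeds continuously in $L^{2\sigma+2}(\mathbb{R}^N)$, and solutions are continuous by elliptic regularity. *)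

(* Defs.v *)
From HB Require Import structures.
From mathcomp Require Import all_boot all_order all_algebra.
From mathcomp Require Import all_classical all_reals all_analysis.
Import Order.TTheory GRing.Theory Num.Theory.
Import numFieldNormedType.Exports.

Set Implicit Arguments.
Unset Strict Implicit.
Unset Printing Implicit Defensive.

Local Open Scope classical_set_scope.
Local Open Scope ring_scope.

(* R^N is the type 'rV[R]_N, with the library's topology (that of the sup
   norm).  Its sigma-algebra is the one generated by the coordinates, as the
   library does for tuples; it is the Borel sigma-algebra. *)
Section measurable_rV.
Context {R : realType} {n : nat}.

Definition rV_coord (i : 'I_n) (v : 'rV[R]_n) : R := v ord0 i.

Let rV_set0 : g_sigma_preimage rV_coord set0.
Proof. exact: sigma_algebra0. Qed.

Let rV_setC A : g_sigma_preimage rV_coord A -> g_sigma_preimage rV_coord (~` A).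
Proof. exact: sigma_algebraC. Qed.

Let rV_bigcup (F : _^nat) : (forall i, g_sigma_preimage rV_coord (F i)) ->
  g_sigma_preimage rV_coord (\bigcup_i (F i)).
Proof. exact: sigma_algebra_bigcup. Qed.

HB.instance Definition _ := @isMeasurable.Build default_measure_display
  'rV[R]_n (g_sigma_preimage rV_coord) rV_set0 rV_setC rV_bigcup.

Lemma measurable_rV_coord (i : 'I_n) :
  measurable_fun [set: 'rV[R]_n] (rV_coord i).
Proof.
move=> _ Y mY; rewrite setTI; apply: sub_sigma_algebra => /=.
rewrite -bigcup_seq/=; exists i => /=; first by rewrite mem_index_enum.
by exists Y => //; rewrite setTI.
Qed.

Lemma measurable_fun_rVP d (T : measurableType d) (f : T -> 'rV[R]_n) :
  (forall i, measurable_fun [set: T] (rV_coord i \o f)) ->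
  measurable_fun [set: T] f.
Proof.
move=> mf _ A; rewrite setTI.
have sH : sigma_algebra setT [set B : set 'rV[R]_n | measurable (f @^-1` B)].
  split => [|B /= mB|F /= mF].
  - by rewrite /= preimage_set0; exact: measurable0.
  - by rewrite setTD preimage_setC; exact: measurableC.
  - by rewrite preimage_bigcup; exact: bigcup_measurable.
apply: (smallest_sub sH) => B.
rewrite -bigcup_seq/= => -[i _ [C mC]]; rewrite setTI => <-/=.
by rewrite -[X in measurable X]setTI; exact: (mf i).
Qed.

End measurable_rV.

Section lebesgue_rV.
Context {R : realType}.

Definition rV_cons n (p : measurableTypeR R * 'rV[R]_n) : 'rV[R]_n.+1 :=
  \row_i if unlift ord0 i is Some j then p.2 ord0 j else p.1.

Definition rV_uncons n (v : 'rV[R]_n.+1) : measurableTypeR R * 'rV[R]_n :=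
  (v ord0 ord0, \row_j v ord0 (lift ord0 j)).

Lemma rV_consK n : cancel (@rV_cons n) (@rV_uncons n).
Proof.
move=> [x v]; congr pair; first by rewrite mxE unlift_none.
by apply/rowP => j; rewrite !mxE liftK.
Qed.

Lemma measurable_rV_cons n : measurable_fun [set: _ * _] (@rV_cons n).
Proof.
apply: measurable_fun_rVP => i.
case: (unliftP ord0 i) => [j ->|->].
- rewrite (_ : _ \o _ = rV_coord j \o snd); last first.
    by apply/funext => p; rewrite /rV_coord /= mxE liftK.
  by apply: measurableT_comp => //; exact: measurable_rV_coord.
- rewrite (_ : _ \o _ = fst); first exact: measurable_fst.
  by apply/funext => p; rewrite /rV_coord /= mxE unlift_none.
Qed.

Lemma measurable_rV_uncons n : measurable_fun setT (@rV_uncons n).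
Proof.
apply/measurable_fun_pairP; split.
  exact: (@measurable_rV_coord R n.+1 ord0).
apply: measurable_fun_rVP => j.
rewrite (_ : _ \o _ = rV_coord (lift ord0 j)).
  exact: measurable_rV_coord.
by apply/funext => v; rewrite /rV_coord /= mxE.
Qed.

Section succ.
Context {n : nat} (mu : {sigma_finite_measure set 'rV[R]_n -> \bar R}).

Definition lebesgue_rV_succ : set 'rV[R]_n.+1 -> \bar R :=
  pushforward (lebesgue_measure \x mu)%E (@rV_cons n).

Local Notation preim A := (@rV_cons n @^-1` A).

Let measurable_preim A : measurable A -> measurable (preim A).
Proof. by move=> mA; rewrite -[X in measurable X]setTI; exact: measurable_rV_cons. Qed.

Let lebesgue_rV_succ0 : lebesgue_rV_succ set0 = 0%E.
Proof. by rewrite /lebesgue_rV_succ /pushforward preimage_set0 measure0. Qed.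

Let lebesgue_rV_succ_ge0 A : (0 <= lebesgue_rV_succ A)%E.
Proof. by rewrite /lebesgue_rV_succ /pushforward; apply: measure_ge0. Qed.

Let lebesgue_rV_succ_sigma_additive : semi_sigma_additive lebesgue_rV_succ.
Proof.
move=> F mF tF mUF; rewrite /lebesgue_rV_succ /pushforward preimage_bigcup.
apply: measure_semi_sigma_additive.
- by move=> k; exact: measurable_preim.
- apply/trivIsetP => /= i j _ _ ij; rewrite -preimage_setI.
  by move/trivIsetP : tF => /(_ _ _ _ _ ij) ->//; rewrite preimage_set0.
- by rewrite -preimage_bigcup; exact: measurable_preim.
Qed.

HB.instance Definition _ := isMeasure.Build _ _ _ lebesgue_rV_succ
  lebesgue_rV_succ0 lebesgue_rV_succ_ge0 lebesgue_rV_succ_sigma_additive.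

Let lebesgue_rV_succ_sigma_finite : sigma_finite setT lebesgue_rV_succ.
Proof.
have /sigma_finiteP[F [TF ndF Foo]] := sigma_finiteT (@lebesgue_measure R).
have /sigma_finiteP[G [TG ndG Goo]] := sigma_finiteT mu.
exists (fun k => @rV_uncons n @^-1` (F k `*` G k)).
  rewrite -preimage_bigcup [X in _ @^-1` X](_ : _ = setT) ?preimage_setT//.
  apply/seteqP; split => // -[x v] _.
  have [/= k _ Fkx] : (\bigcup_i F i) x by rewrite -TF.
  have [/= l _ Glv] : (\bigcup_i G i) v by rewrite -TG.
  exists (maxn k l) => //; split => /=.
  - by move: x Fkx; exact/subsetPset/ndF/leq_maxl.
  - by move: v Glv; exact/subsetPset/ndG/leq_maxr.
move=> k; have [mF Fk] := Foo k; have [mG Gk] := Goo k; split.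
  rewrite -[X in measurable X]setTI; apply: measurable_rV_uncons => //.
  exact: measurableX.
rewrite /lebesgue_rV_succ /pushforward -comp_preimage.
rewrite (_ : _ \o _ = id); last by apply/funext => p; exact: rV_consK.
by rewrite preimage_id product_measure1E// lte_mul_pinfty// ge0_fin_numE.
Qed.

HB.instance Definition _ := Measure_isSigmaFinite.Build _ _ _ lebesgue_rV_succ
  lebesgue_rV_succ_sigma_finite.

End succ.

(* Lebesgue measure on the Borel sets of R^n, as the n-fold product of the
   one-dimensional Lebesgue measure. *)
Fixpoint lebesgue_rV (n : nat) : {sigma_finite_measure set 'rV[R]_n -> \bar R} :=
  match n with
  | 0 => \d_(0 : 'rV[R]_0)
  | m.+1 => lebesgue_rV_succ (lebesgue_rV m)
  end.

Lemma lebesgue_rV_box n (a b : 'rV[R]_n) : (forall i, a ord0 i <= b ord0 i) ->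
  lebesgue_rV n [set v : 'rV[R]_n | forall i, a ord0 i <= v ord0 i <= b ord0 i] =
  (\prod_i (b ord0 i - a ord0 i))%:E.
Proof.
elim: n a b => [|n IHn] a b ab.
  by rewrite big_ord0 /= diracE mem_set// => -[].
rewrite big_ord_recl EFinM.
pose tl (v : 'rV[R]_n.+1) : 'rV[R]_n := \row_j v ord0 (lift ord0 j).
pose B := [set v : 'rV[R]_n | forall i, tl a ord0 i <= v ord0 i <= tl b ord0 i].
have -> : (\prod_(i < n) (b ord0 (lift ord0 i) - a ord0 (lift ord0 i)))%:E =
    lebesgue_rV n B.
  rewrite IHn => [|i]; last by rewrite !mxE.
  by congr EFin; apply: eq_bigr => i _; rewrite !mxE.
rewrite /= /lebesgue_rV_succ /pushforward.
rewrite (_ : _ @^-1` _ = `[a ord0 ord0, b ord0 ord0] `*` B); last first.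
  apply/seteqP; split => -[x v] /=.
    move=> h; split => /=.
      by have := h ord0; rewrite mxE unlift_none in_itv.
    by move=> i; have := h (lift ord0 i); rewrite !mxE liftK.
  rewrite in_itv => -[/= xab vB] i; rewrite mxE.
  by case: (unliftP ord0 i) => [j ->|->//]; have := vB j; rewrite !mxE.
have mB : measurable B.
  rewrite (_ : B = \bigcap_(i in [set: 'I_n])
      (rV_coord i @^-1` `[tl a ord0 i, tl b ord0 i])); last first.
    apply/seteqP; split => v /= h i => [_|]; last first.
      by have := h i I; rewrite /= in_itv.
    by rewrite /= in_itv; exact: h.
  apply: fin_bigcap_measurable => // i _.
  by rewrite -[X in measurable X]setTI; exact: measurable_rV_coord.
rewrite product_measure1E//.
congr (_ * _)%E; rewrite [LHS]lebesgue_measure_itv/= lte_fin.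
have := ab ord0; rewrite le_eqVlt => /predU1P[->|->]; last by rewrite EFinB.
by rewrite ltxx subrr.
Qed.

End lebesgue_rV.

Section functions_rV.
Context {R : realType} {N : nat}.
Implicit Types (f phi u w : 'rV[R]_N -> R) (g : 'rV[R]_N -> 'rV[R]_N).

Local Notation mu := (@lebesgue_rV R N).

(* The Euclidean norm; the library's `|x| is the sup norm. *)
Definition enorm (x : 'rV[R]_N) : R := Num.sqrt (\sum_i x ord0 i ^+ 2).

Definition at_infinity : set_system 'rV[R]_N :=
  [set A | exists M : R, forall x, M < enorm x -> A x].

Global Instance at_infinity_filter : Filter at_infinity.
Proof.
split; first by exists 0.
- move=> A B [M AM] [M' BM']; exists (Num.max M M') => x.
  by rewrite gt_max => /andP[Mx M'x]; split; [exact: AM|exact: BM'].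
- by move=> A B AB [M AM]; exists M => x /AM /AB.
Qed.

Definition partial (i : 'I_N) f : 'rV[R]_N -> R :=
  fun x => 'D_(delta_mx ord0 i) f x.

Definition laplacian f : 'rV[R]_N -> R :=
  fun x => \sum_i partial i (partial i f) x.

(* The partial derivative of f of order s, for a list of indices s. *)
Definition iter_partial (s : seq 'I_N) f : 'rV[R]_N -> R := foldr partial f s.

Definition smooth f : Prop := forall s : seq 'I_N,
  continuous (iter_partial s f) /\
  forall i x, derivable (iter_partial s f) x (delta_mx ord0 i).

Definition test_function phi : Prop :=
  smooth phi /\ compact (closure [set x | phi x != 0]).

Definition weak_gradient u g : Prop := forall (i : 'I_N) phi, test_function phi ->
  \int[mu]_x (u x * partial i phi x) = - \int[mu]_x (g x ord0 i * phi x).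

Definition weak_laplacian u w : Prop := forall phi, test_function phi ->
  \int[mu]_x (u x * laplacian phi x) = \int[mu]_x (w x * phi x).

Definition L2_gradient u g : Prop := weak_gradient u g /\
  forall i, (fun x => g x ord0 i) \in Lfun mu 2%:E.

Definition L2_laplacian u w : Prop := weak_laplacian u w /\ w \in Lfun mu 2%:E.

(* D^{1,2}(R^N), for N >= 3: the functions in L^{2N/(N-2)} whose weak gradient
   is in L^2. *)
Definition D12 u : Prop :=
  u \in Lfun mu (2 * N%:R / (N%:R - 2))%:E /\ exists g, L2_gradient u g.

Definition X_space u : Prop := D12 u /\ exists w, L2_laplacian u w.

Definition radial u : Prop := exists2 h : R -> R,
  measurable_fun setT h & {ae mu, forall x, u x = h (enorm x)}.

(* gamma Delta^2 u - Delta u = |u|^(2 sigma) u in the weak sense; the witnesses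
   g and w are the gradient and the Laplacian of u, unique almost everywhere. *)
Definition weak_solution (gamma sigma : R) u : Prop :=
  exists g w, [/\ L2_gradient u g, L2_laplacian u w &
    forall phi, test_function phi ->
      gamma * (\int[mu]_x (w x * laplacian phi x))
        + (\int[mu]_x (\sum_i (g x ord0 i * partial i phi x)))
      = \int[mu]_x (`|u x| `^ (2 * sigma) * u x * phi x)].

End functions_rV.

(* Main.v *)
Require Import Defs.
From HB Require Import structures.
From mathcomp Require Import all_boot all_order all_algebra.
From mathcomp Require Import all_classical all_reals all_analysis.
From mathcomp Require Import measurable_realfun ftc.
From mathcomp Require Import ring lra.
Import Order.TTheory GRing.Theory Num.Theory.
Import numFieldNormedType.Exports.

(** Write N = n + 3 with n = 0 or 1, m = N - 2 = n + 1, r = |x| and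
    u(x) = H(|x|). With w = lap u and v = u - gamma w the equation becomes the
    second order system
      H - gamma lap H = v,      - lap v = |H|^(2 sigma) H,
    and the whole proof is about its radial form radial_system, a first order
    system for H, v and the fluxes P = r^(N-1) H' and F = - r^(N-1) v'.

    Asymptotics. Finite energy gives H = O(r^(-m/2)): the oscillation of H
    between two spheres is bounded by the Dirichlet energy (profile_oscillation),
    and integrability of a power of u excludes a nonzero limit (profile_decay).
    If H = O(r^(-a)), integrating F and then v gives
    v = O(r^(2 - (2 sigma + 1) a)) up to the exponent m, and the maximum
    principle for 1 - gamma lap hands the bound on to H (decay_step). The
    condition sigma m > 2, which reads sigma > 2 for N = 3 and sigma > 1 for
    N = 4, makes every such step a gain, so that H = O(r^(-a))
    for every a < m (decay_bootstrap). Then F' is integrable at infinity, F tends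
    to a limit m A, hence v = A r^(-m) + O(r^(-m-1)), and barriers give the same
    expansion for H (radial_asymptotics).

    The limit is not zero. Suppose A = 0. Then v is small compared with H near
    infinity (tail_smallness), so |H| has no interior maximum there and
    decreases (tail_monotone); H has a constant sign, say H > 0, and H' <= 0.
    Since F and v vanish at infinity and F' >= 0, also F <= 0 and v <= 0. These
    signs propagate inwards, so that P is bounded away from 0 near the origin
    (inward_flux). But w is square summable, and by Cauchy-Schwarz
    P = O(r^(n+1)) at the origin: a contradiction, unless H vanishes near
    infinity and therefore everywhere (backward_uniqueness).

    From the weak formulation to the system. A test function theta(|x|) with
    r^(N-1) theta' = chi turns each integral against m(x) into an integral of
    chi against the mass of m in the ball of radius r (mass_fubini). The weak
    identities become identities on the half-line for these masses
    (divergence_identity, radial_equation), and lemmas of du Bois-Reymond type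
    yield the derivatives of H and of w (differentiable_profile,
    solution_system). This needs integration in polar coordinates, which follows
    from the scaling of Lebesgue measure and the uniqueness of measures
    (ge0_radial_integral). At the origin the bound on P makes H grow slower than
    every negative power of r, which bootstraps to a limit of H
    (radial_origin_limit), so that u has a continuous representative. *)

Set Implicit Arguments.
Unset Strict Implicit.
Unset Printing Implicit Defensive.

Local Open Scope classical_set_scope.
Local Open Scope ring_scope.

(** * Calculus of one real variable *)

Section pointwise_derivatives.
Context {R : realType}.
Implicit Types (f g : R -> R) (x a b : R).

(* The rules of differentiation for explicit functions of a real variable; the
   derivative is a parameter, so that it can be matched by der_eq. *)
Lemma derD f g x a b : is_derive x 1 f a -> is_derive x 1 g b ->
  is_derive x 1 (fun y => f y + g y) (a + b).
Proof. by move=> ? ?; apply: is_deriveD. Qed.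

Lemma derB f g x a b : is_derive x 1 f a -> is_derive x 1 g b ->
  is_derive x 1 (fun y => f y - g y) (a - b).
Proof. by move=> ? ?; apply: is_deriveB. Qed.

Lemma derN f x a : is_derive x 1 f a -> is_derive x 1 (fun y => - f y) (- a).
Proof. by move=> ?; apply: is_deriveN. Qed.

Lemma derM f g x a b : is_derive x 1 f a -> is_derive x 1 g b ->
  is_derive x 1 (fun y => f y * g y) (a * g x + f x * b).
Proof.
move=> fa gb; have := @is_deriveM R _ f g x 1 a b fa gb.
by rewrite (mulrC a) addrC.
Qed.

Lemma derZ (k : R) f x a : is_derive x 1 f a ->
  is_derive x 1 (fun y => k * f y) (k * a).
Proof. by move=> ?; apply: is_deriveZ. Qed.

Lemma der_cst (k : R) x : is_derive x 1 (fun=> k) 0.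
Proof. exact: is_derive_cst. Qed.

Lemma der_id x : is_derive x 1 (fun y : R => y) 1.
Proof. exact: is_derive_id. Qed.

Lemma der_pow (n : nat) x : is_derive x 1 (fun y : R => y ^+ n.+1) (n.+1%:R * x ^+ n).
Proof.
have := @is_deriveX R _ id n.+1 x 1 1 (is_derive_id _ _).
by rewrite /GRing.scale/= mulr1 exprfctE.
Qed.

Lemma der_powR (k x : R) : 0 < x ->
  is_derive x 1 (fun y : R => y `^ k) (k * x `^ (k - 1)).
Proof. exact: is_derive1_powR. Qed.

Lemma derV f x a : f x != 0 -> is_derive x 1 f a ->
  is_derive x 1 (fun y => (f y)^-1) (- (a / f x ^+ 2)).
Proof.
move=> fx0 [df <-]; apply: DeriveDef; first exact: derivableV.
by rewrite deriveV// /GRing.scale/= mulNr mulrC.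
Qed.

Lemma der_eq f x a b : is_derive x 1 f a -> a = b -> is_derive x 1 f b.
Proof. by move=> h <-. Qed.

Lemma der_ext f g x a : {near x, f =1 g} -> is_derive x 1 f a ->
  is_derive x 1 g a.
Proof. by move=> fg fa; apply: near_eq_is_derive fa => //; rewrite oner_neq0. Qed.

Lemma der_comp f g x a b : is_derive x 1 g b -> is_derive (g x) 1 f a ->
  is_derive x 1 (fun y => f (g y)) (a * b).
Proof. by move=> ? ?; apply: is_derive1_comp. Qed.

Lemma der_cont f x a : is_derive x 1 f a -> {for x, continuous f}.
Proof. by move=> [/derivable1_diffP/differentiable_continuous]. Qed.

Lemma der_within f f' (a b : R) : (forall x, a <= x <= b -> is_derive x 1 f (f' x)) ->
  {within `[a, b], continuous f}.
Proof.
move=> d; apply: continuous_in_subspaceT => x.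
by rewrite inE/= in_itv/= => /d/der_cont.
Qed.

Lemma mvt f f' a b : a < b -> (forall x, a <= x <= b -> is_derive x 1 f (f' x)) ->
  exists2 c, a < c < b & f b - f a = f' c * (b - a).
Proof.
move=> ab d; have [||c] := @MVT R f f' _ _ ab; last by rewrite in_itv/=; exists c.
- by move=> x; rewrite in_itv/= => /andP[ax xb]; apply: d; rewrite !ltW.
- exact: der_within d.
Qed.

Lemma der_le f g f' g' a b : a <= b ->
  (forall x, a <= x <= b -> is_derive x 1 f (f' x)) ->
  (forall x, a <= x <= b -> is_derive x 1 g (g' x)) ->
  (forall x, a < x < b -> f' x <= g' x) -> f b - f a <= g b - g a.
Proof.
rewrite le_eqVlt => /predU1P[->|ab] df dg fg; first by rewrite !subrr.
have [|c cab] := mvt (f := fun y => g y - f y) (f' := fun y => g' y - f' y) ab.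
  by move=> x xab; apply: derB; [exact: dg|exact: df].
move=> e; have : 0 <= (g' c - f' c) * (b - a).
  by rewrite mulr_ge0// subr_ge0 ?fg// ltW.
by rewrite -e; lra.
Qed.

Lemma der_norm_le f g f' g' a b : a <= b ->
  (forall x, a <= x <= b -> is_derive x 1 f (f' x)) ->
  (forall x, a <= x <= b -> is_derive x 1 g (g' x)) ->
  (forall x, a < x < b -> `|f' x| <= g' x) -> `|f b - f a| <= g b - g a.
Proof.
move=> ab df dg fg; rewrite ler_norml; apply/andP; split; last first.
  by apply: (der_le ab df dg) => x /fg; rewrite ler_norml => /andP[].
have -> : - (g b - g a) = - g b - - g a by lra.
apply: (@der_le (fun x => - g x) f (fun x => - g' x) f') => // x.
  by move=> /dg; exact: derN.
by move=> /fg; rewrite ler_norml => /andP[].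
Qed.

Lemma der_ge0_le f f' a b : a <= b ->
  (forall x, a <= x <= b -> is_derive x 1 f (f' x)) ->
  (forall x, a < x < b -> 0 <= f' x) -> f a <= f b.
Proof.
move=> ab df f0; have := @der_le (fun=> 0) f (fun=> 0) f' a b ab.
move=> /(_ (fun x _ => der_cst 0 x) df f0); lra.
Qed.

Lemma der_gt0_lt f f' a b : a < b ->
  (forall x, a <= x <= b -> is_derive x 1 f (f' x)) ->
  (forall x, a < x < b -> 0 < f' x) -> f a < f b.
Proof.
move=> ab df f0; have [c /f0 c0 e] := mvt ab df.
by rewrite -subr_gt0 e mulr_gt0// subr_gt0.
Qed.

(** The least upper bound below is the limit of g at infinity; phrasing the
    limit by the explicit rate spares any further limit argument. *)
Lemma tail_limit g g' (C e a : R) : 0 < a -> 0 < e -> 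
  (forall r, a <= r -> is_derive r 1 g (g' r)) ->
  (forall r, a <= r -> `|g' r| <= C * r `^ (- e - 1)) ->
  exists l, forall r, a <= r -> `|g r - l| <= C / e * r `^ (- e).
Proof.
move=> a0 e0 dg bg; pose k r := C / e * r `^ (- e).
have gk r s : a <= r -> r <= s -> `|g s - g r| <= k r - k s.
  move=> ar rs; have -> : k r - k s = - k s - - k r by lra.
  apply: (@der_norm_le g (fun r => - k r) g' (fun r => C * r `^ (- e - 1))).
  - exact: rs.
  - by move=> x /andP[rx _]; exact: (dg _ (le_trans ar rx)).
  - move=> x /andP[rx _]; 
    refine (der_eq (derN (derZ _ (der_powR _ (lt_le_trans a0 (le_trans ar rx))))) _).
    by field; rewrite gt_eqF.
  - by move=> x /andP[rx _]; exact: (bg _ (le_trans ar (ltW rx))).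
pose S := [set g s - k s | s in [set s | a <= s]].
have C0 : 0 <= C.
  have := le_trans (normr_ge0 _) (bg a (lexx _)).
  by rewrite pmulr_lge0// powR_gt0.
have k0 r : 0 <= k r by rewrite /k mulr_ge0 ?powR_ge0// divr_ge0// ltW.
have kS r : a <= r -> ubound S (g r + k r).
  move=> ar _ [s /= as_ <-]; have [rs|/ltW sr] := leP r s.
    by have := gk _ _ ar rs; rewrite ler_norml => /andP[]; have := k0 s; have := k0 r; lra.
  by have := gk _ _ as_ sr; rewrite ler_norml => /andP[]; have := k0 s; have := k0 r; lra.
exists (sup S) => r ar; rewrite -/(k r) ler_norml; apply/andP; split.
  have : sup S <= g r + k r by apply: ge_sup; [exists (g a - k a), a => //=|exact: kS].
  lra.
have : g r - k r <= sup S.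
  by apply: ub_le_sup; [exists (g a + k a); exact: kS|exists r].
lra.
Qed.

End pointwise_derivatives.

(** * The radial resolvent equation and the maximum principle *)

Section powers.
Context {R : realType}.
Implicit Types r x y : R.

Lemma pwD r x y : 0 < r -> r `^ (x + y) = r `^ x * r `^ y.
Proof. by move=> r0; rewrite powRD// (gt_eqF r0) implybT. Qed.

Lemma pwn r k : 0 < r -> r ^+ k = r `^ k%:R.
Proof. by move=> r0; rewrite powR_mulrn// ltW. Qed.

Lemma pwB1 r x : 0 < r -> r `^ (x - 1) = r `^ x / r.
Proof. by move=> r0; rewrite pwD// powRN powRr1// ltW. Qed.

Lemma pw_le r x y : 1 <= r -> x <= y -> r `^ x <= r `^ y.
Proof. by move=> r1 xy; apply: ler_powR. Qed.

Lemma pw_ge r x y : 0 < r <= 1 -> x <= y -> r `^ y <= r `^ x.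
Proof. by move=> r1 xy; apply: ger_powR. Qed.

Lemma pwN_small (e x : R) : 0 < e -> 0 < x ->
  exists2 r0 : R, 1 <= r0 & forall r, r0 <= r -> r `^ (- x) <= e.
Proof.
move=> e0 x0; exists (Num.max 1 (e^-1 `^ (x^-1))); first by rewrite le_max lexx.
move=> r; rewrite ge_max => /andP[r1 er].
have rp : 0 < r by apply: lt_le_trans r1.
rewrite powRN invf_ple ?posrE ?powR_gt0//.
have := @ge0_ler_powR _ x (ltW x0) (e^-1 `^ x^-1) r.
rewrite !nnegrE powR_ge0 (ltW rp) er => /(_ isT isT isT).
by rewrite -powRrM mulVf ?gt_eqF// powRr1// invr_ge0 ltW.
Qed.

Lemma upper3 r x y : exists b, [/\ r <= b, x <= b & y <= b].
Proof.
exists (Num.max r (Num.max x y)).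
by split; rewrite !le_max lexx ?orbT.
Qed.

End powers.

Section linear_part.
Context {R : realType} (n : nat).

(** At an interior maximum c the flux Pz vanishes; since lap z = q > 0 near c,
    the flux is positive just after c and z increases there. *)
Lemma no_interior_max (z Pz q : R -> R) (a b c : R) : 0 < a -> a < c < b ->
  (forall r, a <= r <= b -> is_derive r 1 z (Pz r / r ^+ n.+2)) ->
  (forall r, a <= r <= b -> is_derive r 1 Pz (r ^+ n.+2 * q r)) ->
  (forall r, a <= r <= b -> z r <= z c) ->
  {for c, continuous q} -> 0 < q c -> False.
Proof.
move=> a0 /andP[ac cb] dz dP zc cq qc.
have ab : a < b by exact: lt_trans ac cb.
have Pc : Pz c = 0.
  have dc : is_derive c 1 z 0.
    apply: (@derive1_at_max _ z a b c (ltW ab)).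
    - by move=> t; rewrite in_itv/= => /andP[at_ tb]; have [] := dz t; rewrite ?ltW.
    - by rewrite in_itv/= ac cb.
    - by move=> t; rewrite in_itv/= => /andP[at_ tb]; apply: zc; rewrite !ltW.
  have [_ e1] := dz c (introT andP (conj (ltW ac) (ltW cb))).
  have [_ e2] := dc.
  have /eqP : Pz c / c ^+ n.+2 = 0 by rewrite -e1 e2.
  by rewrite mulf_eq0 invr_eq0 expf_eq0/= (gt_eqF (lt_trans a0 ac)) orbF => /eqP.
have [h h0 hq] : exists2 h, 0 < h & forall r, `|r - c| < h -> 0 < q r.
  have /nbhs_ballP[h h0 hq] : \forall r \near c, 0 < q r.
    exact: (cvgr_gt (q c) cq _ qc).
  by exists h => // r rc; apply: hq; rewrite /ball/= distrC.
pose d := Num.min (c + h / 2) b.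
have cd : c < d by rewrite lt_min cb andbT ltrDl divr_gt0.
have db : d <= b by rewrite ge_min lexx orbT.
have dh : d <= c + h / 2 by rewrite ge_min lexx.
have q0 r : c <= r <= d -> 0 < q r.
  move=> /andP[cr rd]; apply: hq; rewrite ger0_norm ?subr_ge0//.
  by lra.
have ccd r : c <= r <= d -> a <= r <= b.
  by move=> /andP[cr rd]; rewrite (le_trans (ltW ac) cr) (le_trans rd db).
have Pp r : c < r <= d -> 0 < Pz r.
  move=> /andP[cr rd]; rewrite -Pc; apply: (@der_gt0_lt _ Pz (fun r => r ^+ n.+2 * q r) c r cr).
    by move=> x /andP[cx xr]; apply: dP; apply: ccd; rewrite cx (le_trans xr rd).
  move=> x /andP[cx xr]; rewrite mulr_gt0 ?exprn_gt0 ?(lt_trans a0 (lt_trans ac cx))//.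
  by apply: q0; rewrite (ltW cx) (le_trans (ltW xr) rd).
have : z c < z d.
  apply: (@der_gt0_lt _ z (fun r => Pz r / r ^+ n.+2) c d cd).
    by move=> x cxd; apply: dz; apply: ccd.
  move=> x /andP[cx xd]; rewrite divr_gt0 ?exprn_gt0 ?(lt_trans a0 (lt_trans ac cx))//.
  by apply: Pp; rewrite cx ltW.
by rewrite ltNge zc// (le_trans (ltW ac) (ltW cd)).
Qed.

(** The maximum principle on the exterior of a ball: z > 0 would be attained at
    an interior maximum, as z is nonpositive at a and small at infinity. *)
Lemma max_principle (z Pz q : R -> R) (a : R) : 0 < a ->
  (forall r, a <= r -> is_derive r 1 z (Pz r / r ^+ n.+2)) ->
  (forall r, a <= r -> is_derive r 1 Pz (r ^+ n.+2 * q r)) ->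
  (forall r, a <= r -> {for r, continuous q}) ->
  (forall r, a < r -> 0 < z r -> 0 < q r) ->
  z a <= 0 ->
  (forall e, 0 < e -> exists r0 : R, forall r, r0 <= r -> z r <= e) ->
  forall r, a <= r -> z r <= 0.
Proof.
move=> a0 dz dP cq zq za zoo r ar; rewrite leNgt; apply/negP => zr.
have [r0 r0z] := zoo (z r / 2) (divr_gt0 zr (ltr0Sn _ 1)).
pose b := Num.max r0 r + 1.
have rb : r < b by apply: (@le_lt_trans _ _ (Num.max r0 r)); rewrite ?le_max ?lexx ?orbT ?ltrDl.
have r0b : r0 <= b by apply: (@le_trans _ _ (Num.max r0 r)); rewrite ?le_max ?lexx ?lerDl.
have ab : a < b by exact: le_lt_trans ar rb.
have [|c] := @EVT_max _ z a b (ltW ab).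
  by apply: (@der_within _ z (fun r => Pz r / r ^+ n.+2)) => x /andP[ax _]; exact: dz.
rewrite in_itv/= => /andP[ac cb] zmax.
have zc : z r <= z c by apply: zmax; rewrite in_itv/= ar ltW.
have zc0 : 0 < z c by exact: lt_le_trans zr zc.
have ac' : a < c.
  by rewrite lt_neqAle ac andbT; apply/eqP => ac'; move: zc0; rewrite -ac' ltNge za.
have cb' : c < b.
  rewrite lt_neqAle cb andbT; apply/eqP => cb'; move: zc; rewrite cb'.
  by have := r0z _ r0b; lra.
apply: (@no_interior_max z Pz q a b c a0).
- by rewrite ac' cb'.
- by move=> x /andP[ax _]; exact: dz.
- by move=> x /andP[ax _]; exact: dP.
- by move=> x axb; apply: zmax; rewrite in_itv.
- exact: cq.
- exact: zq.
Qed.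

Variable gamma : R.
Hypothesis gamma0 : 0 < gamma.

(** The radial form of H - gamma lap H = v in dimension n + 3, where P is the
    flux r^(n+2) H'. *)
Definition resolvent_ode (H P v : R -> R) : Prop :=
  [/\ forall r : R, 0 < r -> is_derive r 1 H (P r / r ^+ n.+2),
      forall r : R, 0 < r -> is_derive r 1 P (r ^+ n.+2 * ((H r - v r) / gamma)) &
      forall r : R, 0 < r -> {for r, continuous v}].

Lemma resolvent_odeN H P v : resolvent_ode H P v ->
  resolvent_ode (fun r => - H r) (fun r => - P r) (fun r => - v r).
Proof.
move=> [dH dP cv]; split => r r0.
- refine (der_eq (derN (dH r r0)) _); by rewrite mulNr.
- refine (der_eq (derN (dP r r0)) _); rewrite -mulrN -mulNr.
  by congr (_ * (_ / _)); lra.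
- exact: continuousN (cv r r0).
Qed.

Definition vanishes_at_infinity (g : R -> R) : Prop :=
  forall e, 0 < e -> exists r0 : R, forall r, r0 <= r -> `|g r| <= e.

Let m : R := n.+1%:R.
Let m0 : 0 < m. Proof. by rewrite ltr0n. Qed.

Let pow_flux (K b r : R) : 0 < r ->
  is_derive r 1 (fun x : R => x ^+ n.+2 * (K * x `^ (- b - 1)))
    (r ^+ n.+2 * (K * (m - b) * r `^ (- b - 2))).
Proof.
move=> r0; refine (der_eq (derM (der_pow n.+1 r) (derZ K (der_powR (- b - 1) r0))) _).
have -> : - b - 2 = - b - 1 - 1 :> R by lra.
have e : n.+2%:R = m + 1 by rewrite /m natr1.
rewrite !pwB1// e !(exprS r n.+1).
by field; rewrite gt_eqF.
Qed.

(** The comparison function is A r^(-m) + K r^(-b). The first term is harmonic,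
    and gamma lap r^(-b) = - gamma b (m - b) r^(-b-2), so the lower bound on K
    says that it is a supersolution. *)
Lemma resolvent_upper (H P v : R -> R) (A K b a C : R) : resolvent_ode H P v ->
  0 < a -> 0 < b ->
  (forall r, a <= r -> v r <= A * r `^ (- m) + C * r `^ (- b)) ->
  (forall r, a <= r -> C < K * (1 + gamma * b * (m - b) / r ^+ 2)) ->
  H a <= A * a `^ (- m) + K * a `^ (- b) ->
  (forall e, 0 < e -> exists r0 : R, forall r, r0 <= r -> H r <= e) ->
  0 <= K ->
  forall r, a <= r -> H r <= A * r `^ (- m) + K * r `^ (- b).
Proof.
move=> [dH dP cv] a0 b0 vb CK Ha Hoo K0 r ar; rewrite -subr_le0.
have p0 x : a <= x -> 0 < x by exact: lt_le_trans.
pose z x := H x - (A * x `^ (- m) + K * x `^ (- b)).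
pose Pz x := P x - (x ^+ n.+2 * (A * - m * x `^ (- m - 1)) + x ^+ n.+2 * (K * - b * x `^ (- b - 1))).
pose q x := (H x - v x) / gamma - (A * - m * (m - m) * x `^ (- m - 2) + K * - b * (m - b) * x `^ (- b - 2)).
rewrite -/(z r); move: r ar; apply: (@max_principle z Pz q a a0).
- move=> x ax; have x0 := p0 _ ax.
  refine (der_eq (derB (dH x x0) (derD (derZ A (der_powR (- m) x0)) (derZ K (der_powR (- b) x0)))) _).
  by rewrite /Pz; field; rewrite expf_eq0/= gt_eqF.
- move=> x ax; have x0 := p0 _ ax.
  refine (der_eq (derB (dP x x0) (derD (pow_flux (A * - m) m x0) (pow_flux (K * - b) b x0))) _).
  by rewrite /q; ring.
- move=> x ax; have x0 := p0 _ ax.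
  apply: continuousB.
    apply: continuousM; last exact: cst_continuous.
    by apply: continuousB; [exact: (der_cont (dH x x0))|exact: cv].
  exact: (der_cont (derD (derZ _ (der_powR _ x0)) (derZ _ (der_powR _ x0)))).
- move=> x ax; have x0 := p0 _ (ltW ax).
  rewrite /z subr_gt0 => Hx; rewrite /q subrr mulr0 mul0r add0r.
  have -> : - b - 2 = - b - 1 - 1 :> R by lra.
  rewrite !pwB1//; set X := x `^ (- b); have X0 : 0 < X by rewrite powR_gt0.
  have vx := vb _ (ltW ax); have CKx := CK _ (ltW ax).
  rewrite -(pmulr_rgt0 _ gamma0).
  have -> : gamma * ((H x - v x) / gamma - K * - b * (m - b) * (X / x / x)) =
     (H x - v x) + (K * (1 + gamma * b * (m - b) / x ^+ 2)) * X - K * X.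
    by field; rewrite !gt_eqF.
  have : C * X < K * (1 + gamma * b * (m - b) / x ^+ 2) * X by rewrite ltr_pM2r.
  by move: Hx vx; rewrite -/X; lra.
- by rewrite subr_le0.
- move=> e e0; have e20 : 0 < e / 2 by lra.
  have [r0 Hr0] := Hoo _ e20.
  have [r1 r11 Hr1] := pwN_small (divr_gt0 e20 (ltr_pwDl ltr01 (normr_ge0 A))) m0.
  exists (Num.max r0 r1) => x; rewrite ge_max => /andP[/Hr0 h0 /Hr1 h1].
  rewrite /z; have := mulr_ge0 K0 (powR_ge0 x (- b)).
  have : - (A * x `^ (- m)) <= e / 2.
    rewrite ler_pdivlMr ?ltr_pwDl// in h1.
    apply: le_trans h1; rewrite -mulNr mulrC ler_wpM2l ?powR_ge0//.
    by have := ler_norm (- A); rewrite normrN; lra.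
  lra.
Qed.

(** For b <= m the barrier r^(-b) is superharmonic, and any K > C that dominates
    the boundary value at r = 1 will do. *)
Lemma resolvent_decay (H P v : R -> R) (b C : R) : resolvent_ode H P v ->
  0 < b <= m -> vanishes_at_infinity H ->
  (forall r, 1 <= r -> `|v r| <= C * r `^ (- b)) ->
  exists K, forall r, 1 <= r -> `|H r| <= K * r `^ (- b).
Proof.
move=> ode /andP[b0 bm] Hoo vb.
have C0 : 0 <= C.
  by have := le_trans (normr_ge0 _) (vb 1 (lexx _)); rewrite powR1 mulr1.
pose K := C + 1 + `|H 1|.
have K0 : 0 <= K by have := normr_ge0 (H 1); rewrite /K; lra.
have KC r : 1 <= r -> C < K * (1 + gamma * b * (m - b) / r ^+ 2).
  move=> r1; have g0 : 0 <= gamma * b * (m - b) / r ^+ 2.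
    by rewrite divr_ge0 ?sqr_ge0// mulr_ge0 ?subr_ge0// mulr_ge0// ltW.
  rewrite mulrDr mulr1; have := mulr_ge0 K0 g0; have := normr_ge0 (H 1).
  rewrite /K; lra.
have up (H' P' v' : R -> R) : resolvent_ode H' P' v' -> (forall r, `|H' r| = `|H r|) ->
    (forall r, `|v' r| = `|v r|) -> forall r, 1 <= r -> H' r <= K * r `^ (- b).
  move=> ode' HH vv r r1.
  suff : H' r <= 0 * r `^ (- m) + K * r `^ (- b) by rewrite mul0r add0r.
  apply: (@resolvent_upper H' P' v' 0 K b 1 C ode' ltr01 b0 _ KC _ _ K0 r r1).
  - move=> x x1; rewrite mul0r add0r; apply: le_trans (ler_norm _) _.
    by rewrite vv; exact: vb.
  - by rewrite mul0r add0r powR1 mulr1; have := ler_norm (H' 1); rewrite HH /K; lra.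
  - move=> e /Hoo[r0 hr0]; exists r0 => x /hr0; rewrite -HH.
    exact: le_trans (ler_norm _).
exists K => r r1; rewrite ler_norml; apply/andP; split; last exact: up ode _ _ _ r1.
have := up _ _ _ (resolvent_odeN ode) (fun x => normrN _) (fun x => normrN _) r r1.
lra.
Qed.

(** Beyond the exponent m the barrier r^(-(m+1)) is no longer superharmonic, but
    gamma lap of it is a small fraction of it once r^2 > 2 gamma (m + 1): hence
    the radius a. *)
Lemma resolvent_asymptotics (H P v : R -> R) (A C : R) : resolvent_ode H P v ->
  vanishes_at_infinity H ->
  (forall r, 1 <= r -> `|v r - A * r `^ (- m)| <= C * r `^ (- (m + 1))) ->
  exists a K, 1 <= a /\ forall r, a <= r -> `|H r - A * r `^ (- m)| <= K * r `^ (- (m + 1)).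
Proof.
move=> ode Hoo vb.
have C0 : 0 <= C.
  by have := le_trans (normr_ge0 _) (vb 1 (lexx _)); rewrite !powR1 !mulr1.
pose a := 1 + 2 * (gamma * (m + 1)).
have gm0 : 0 < gamma * (m + 1) by rewrite mulr_gt0// ltr_wpDl// ltW.
have a1 : 1 <= a by rewrite /a; lra.
have a0 : 0 < a by lra.
pose B := (`|H a| + `|A| * a `^ (- m)) / a `^ (- (m + 1)).
have B0 : 0 <= B by rewrite /B divr_ge0 ?powR_ge0// addr_ge0// mulr_ge0// powR_ge0.
pose K := 2 * C + 1 + B.
have K0 : 0 <= K by rewrite /K; lra.
have KC r : a <= r -> C < K * (1 + gamma * (m + 1) * (m - (m + 1)) / r ^+ 2).
  move=> ar; have r0 : 0 < r by lra.
  have : gamma * (m + 1) / r ^+ 2 <= 1 / 2.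
    rewrite ler_pdivrMr ?exprn_gt0//.
    have : r <= r ^+ 2 by rewrite expr2 ler_peMl//; lra.
    by move: ar; rewrite /a; lra.
  have -> : gamma * (m + 1) * (m - (m + 1)) / r ^+ 2 = - (gamma * (m + 1) / r ^+ 2) by ring.
  set t := gamma * _ / _ => t2; rewrite mulrBr mulr1.
  have := ler_wpM2l K0 t2; rewrite /K; lra.
have up (H' P' v' : R -> R) (A' : R) : resolvent_ode H' P' v' -> (forall r, `|H' r| = `|H r|) ->
    `|A'| = `|A| ->
    (forall r, `|v' r - A' * r `^ (- m)| = `|v r - A * r `^ (- m)|) ->
    forall r, a <= r -> H' r <= A' * r `^ (- m) + K * r `^ (- (m + 1)).
  move=> ode' HH AA vv r ar.
  apply: (@resolvent_upper H' P' v' A' K (m + 1) a C ode' a0 _ _ KC _ _ K0 r ar).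
  - by rewrite ltr_wpDl// ltW.
  - move=> x ax; have := vb _ (le_trans a1 ax); rewrite -vv.
    move/(le_trans (ler_norm _)); lra.
  - have e : B * a `^ (- (m + 1)) = `|H a| + `|A| * a `^ (- m).
      by rewrite /B divfK// gt_eqF// powR_gt0.
    have eK : K * a `^ (- (m + 1)) =
        (2 * C + 1) * a `^ (- (m + 1)) + (`|H a| + `|A| * a `^ (- m)).
      by rewrite -e /K; ring.
    have h0 : 0 <= (2 * C + 1) * a `^ (- (m + 1)) by rewrite mulr_ge0 ?powR_ge0//; lra.
    have h1 : - (A' * a `^ (- m)) <= `|A| * a `^ (- m).
      by rewrite -AA -mulNr ler_wpM2r ?powR_ge0// -normrN ler_norm.
    have := ler_norm (H' a); rewrite HH eK; lra.
  - move=> e /Hoo[r0 hr0]; exists r0 => x /hr0; rewrite -HH.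
    exact: le_trans (ler_norm _).
exists a, K; split => // r ar; rewrite ler_norml; apply/andP; split; last first.
  by have := up _ _ _ A ode (fun=> erefl) erefl (fun=> erefl) r ar; lra.
have := up _ _ _ (- A) (resolvent_odeN ode) (fun x => normrN _) (normrN _) _ r ar.
rewrite mulNr => h; suff : - H r <= - (A * r `^ (- m)) + K * r `^ (- (m + 1)) by lra.
apply: h => x; rewrite mulNr -[in RHS]normrN; congr (`| _ |); lra.
Qed.

(** If v tends to l < 0 while H tends to 0, then gamma lap H is bounded below by
    a positive constant, the flux grows like r^(n+3), and H is unbounded. *)
Lemma resolvent_limit_ge0 (H P v : R -> R) l : resolvent_ode H P v ->
  vanishes_at_infinity H -> vanishes_at_infinity (fun r => v r - l) -> 0 <= l.
Proof.
move=> [dH dP _] Hoo vl; rewrite leNgt; apply/negP => l0.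
have l40 : 0 < - l / 4 by lra.
have [r1 hr1] := Hoo _ l40; have [r2 hr2] := vl _ l40; have [r3 hr3] := Hoo 1 ltr01.
have [a' [a1' ar1' ar2']] := upper3 1 r1 r2.
have [a [aa' ar3 _]] := upper3 a' r3 r3.
have [a1 ar1 ar2] : [/\ 1 <= a, r1 <= a & r2 <= a].
  by split; apply: le_trans aa'.
pose k := - l / 2 / gamma; have k0 : 0 < k by rewrite /k divr_gt0//; lra.
have qk r : a <= r -> k <= (H r - v r) / gamma.
  move=> ar; rewrite /k ler_pM2r ?invr_gt0//.
  have := hr1 _ (le_trans ar1 ar); have := hr2 _ (le_trans ar2 ar).
  by rewrite !ler_norml => /andP[? ?] /andP[? ?]; lra.
have Pk r : a <= r -> k / n.+3%:R * r ^+ n.+3 - k / n.+3%:R * a ^+ n.+3 <= P r - P a.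
  move=> ar; apply: (@der_le _ (fun r => k / n.+3%:R * r ^+ n.+3) P (fun r => k * r ^+ n.+2)
     (fun r => r ^+ n.+2 * ((H r - v r) / gamma)) a r ar).
  - move=> x _; refine (der_eq (derZ _ (der_pow n.+2 x)) _).
    by rewrite mulrA divfK// pnatr_eq0.
  - by move=> x /andP[ax _]; apply: dP; lra.
  - move=> x /andP[ax _]; rewrite mulrC ler_wpM2l ?exprn_ge0 ?qk ?ltW//; lra.
pose D := `|k / n.+3%:R * a ^+ n.+3 - P a|.
have [b [ba bD bk]] := upper3 a D (2 * n.+3%:R / k).
have H1 r : b <= r -> 1 <= P r / r ^+ n.+2.
  move=> br; have r1' : 1 <= r by lra.
  have rn0 : 0 < r ^+ n.+2 by rewrite exprn_gt0; lra.
  rewrite ler_pdivlMr// mul1r.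
  have := Pk _ (le_trans ba br).
  have rn : r <= r ^+ n.+2 by rewrite exprS ler_peMr ?exprn_ege1//; lra.
  have : 2 * r ^+ n.+2 <= k / n.+3%:R * r ^+ n.+3.
    rewrite (exprS r n.+2) [k / _ * _]mulrA ler_pM2r//.
    have := le_trans bk br; rewrite ler_pdivrMr// => h.
    by rewrite mulrAC ler_pdivlMr ?ltr0n//; lra.
  have : k / n.+3%:R * a ^+ n.+3 - P a <= D by exact: ler_norm.
  move: rn br bD; move: D (r ^+ n.+2) (k / _ * r ^+ _) (k / _ * a ^+ _) => D x y t.
  lra.
have : (b + 3) - b <= H (b + 3) - H b.
  apply: (@der_le _ (fun x => x) H (fun=> 1) (fun r => P r / r ^+ n.+2) b (b + 3)); first by lra.
  - by move=> x /andP[bx _]; apply: dH; lra.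
  - by move=> x /andP[/ltW bx _]; exact: H1.
have := hr3 b (le_trans ar3 ba); have := hr3 (b + 3).
rewrite !ler_norml => /(_ _)/andP[]; first by lra.
by move=> ? ? /andP[? ?]; lra.
Qed.

Lemma resolvent_limit_eq0 (H P v : R -> R) l : resolvent_ode H P v ->
  vanishes_at_infinity H -> vanishes_at_infinity (fun r => v r - l) -> l = 0.
Proof.
move=> ode Hoo vl; apply/eqP; rewrite eq_le (resolvent_limit_ge0 ode Hoo vl) andbT.
rewrite -oppr_ge0; apply: (resolvent_limit_ge0 (resolvent_odeN ode)).
- by move=> e /Hoo[r0 h]; exists r0 => r /h; rewrite normrN.
- by move=> e /vl[r0 h]; exists r0 => r /h; rewrite -opprD normrN.
Qed.

Lemma rate_vanishes (g : R -> R) (C x : R) : 0 < x -> 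
  (forall r, 1 <= r -> `|g r| <= C * r `^ (- x)) -> vanishes_at_infinity g.
Proof.
move=> x0 gC e e0.
have C0 : 0 <= C.
  by have := le_trans (normr_ge0 _) (gC 1 (lexx _)); rewrite powR1 mulr1.
have C1 : 0 < C + 1 by lra.
have [r0 r01 hr0] := pwN_small (divr_gt0 e0 C1) x0.
exists r0 => r r0r; apply: le_trans (gC _ (le_trans r01 r0r)) _.
have := hr0 _ r0r; rewrite ler_pdivlMr//.
have := powR_ge0 r (- x); lra.
Qed.

End linear_part.

(** * Expansion at infinity *)

Section nonlinearity.
Context {R : realType} (sigma : R).
Hypothesis sigma0 : 0 < sigma.

(** The power nonlinearity of the equation. *)
Definition pnl (s : R) : R := `|s| `^ (2 * sigma) * s.

Lemma pnlN s : pnl (- s) = - pnl s.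
Proof. by rewrite /pnl normrN mulrN. Qed.

Lemma pnl_norm_le (B s : R) : `|s| <= B -> `|pnl s| <= B `^ (2 * sigma) * `|s|.
Proof.
move=> sB; rewrite normrM ger0_norm ?powR_ge0// ler_wpM2r//.
apply: ge0_ler_powR; rewrite ?nnegrE//; first by rewrite mulr_ge0// ltW.
exact: le_trans sB.
Qed.

Lemma pnl_le_pow (B s : R) : `|s| <= B -> `|pnl s| <= B `^ (2 * sigma + 1).
Proof.
move=> sB; have B0 : 0 <= B by exact: le_trans sB.
apply: le_trans (pnl_norm_le sB) _.
rewrite -(@mulr_powRB1 _ B (2 * sigma + 1))//; last by rewrite ltr_wpDl// mulr_ge0// ltW.
by rewrite addrK mulrC ler_wpM2r ?powR_ge0.
Qed.

Lemma pnl_ge0 s : 0 <= s -> 0 <= pnl s.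
Proof. by move=> s0; rewrite mulr_ge0// powR_ge0. Qed.

End nonlinearity.

Section radial_system.
Context {R : realType} (n : nat) (gamma sigma : R).
Hypothesis gamma0 : 0 < gamma.
Let m : R := n.+1%:R.
Hypothesis msigma : 2 < sigma * m.

Let m0 : 0 < m. Proof. by rewrite ltr0n. Qed.
Let sigma0 : 0 < sigma.
Proof. by rewrite -(pmulr_lgt0 _ m0); apply: lt_trans msigma. Qed.

Let flux_pow (r : R) : 0 < r -> r ^+ n.+2 = r `^ (m + 1).
Proof. by move=> r0; rewrite pwn// /m natr1. Qed.

Local Notation f := (pnl sigma).

(** The radial form, in dimension n + 3, of the system H - gamma lap H = v,
    - lap v = |H|^(2 sigma) H; P and - F are the fluxes r^(n+2) H' and
    r^(n+2) v'. *)
Definition radial_system (H P v F : R -> R) : Prop :=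
  [/\ forall r : R, 0 < r -> is_derive r 1 H (P r / r ^+ n.+2),
      forall r : R, 0 < r -> is_derive r 1 P (r ^+ n.+2 * ((H r - v r) / gamma)),
      forall r : R, 0 < r -> is_derive r 1 v (- (F r / r ^+ n.+2)) &
      forall r : R, 0 < r -> is_derive r 1 F (r ^+ n.+2 * f (H r))].

Lemma radial_systemN H P v F : radial_system H P v F ->
  radial_system (fun r => - H r) (fun r => - P r) (fun r => - v r) (fun r => - F r).
Proof.
move=> [dH dP dv dF]; split => r r0.
- refine (der_eq (derN (dH r r0)) _); by rewrite mulNr.
- refine (der_eq (derN (dP r r0)) _); rewrite -mulrN -mulNr.
  by congr (_ * (_ / _)); lra.
- refine (der_eq (derN (dv r r0)) _); by rewrite mulNr.
- refine (der_eq (derN (dF r r0)) _); by rewrite pnlN mulrN.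
Qed.

Lemma radial_system_resolvent H P v F : radial_system H P v F ->
  resolvent_ode n gamma H P v.
Proof. by move=> [dH dP dv dF]; split => // r r0; exact: (der_cont (dv r r0)). Qed.

Definition decays (H : R -> R) (a : R) : Prop :=
  exists C, forall r, 1 <= r -> `|H r| <= C * r `^ (- a).

Lemma decays_vanish H a : 0 < a -> decays H a -> vanishes_at_infinity H.
Proof. by move=> a0 [C hC]; exact: rate_vanishes hC. Qed.

(** Integrating F' = O(r^(m-b-1)) and v' = - F / r^(m+1) gives v = O(r^(-b)) up
    to an additive constant, which is 0 because H vanishes at infinity; the
    maximum principle passes the rate on to H. For b >= m the flux F would be
    dominated by its limit. *)
Lemma decay_step H P v F a b : radial_system H P v F -> 0 < a ->
  0 < b < m -> b + 2 <= (2 * sigma + 1) * a -> decays H a -> decays H b.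
Proof.
move=> sys a0 /andP[b0 bm] ba Ha; have [C hC] := Ha.
have [dH dP dv dF] := sys.
have C0 : 0 <= C.
  by have := le_trans (normr_ge0 _) (hC 1 (lexx _)); rewrite powR1 mulr1.
pose D := C `^ (2 * sigma + 1).
have dFb r : 1 <= r -> `|r ^+ n.+2 * f (H r)| <= D * r `^ (m - b - 1).
  move=> r1; have r0 : 0 < r by lra.
  rewrite normrM ger0_norm ?exprn_ge0 ?(ltW r0)//.
  have -> : m - b - 1 = (m + 1) + (- b - 2) by lra.
  rewrite pwD// -flux_pow// [leRHS]mulrCA ler_wpM2l ?exprn_ge0 ?(ltW r0)//.
  apply: le_trans (pnl_le_pow sigma0 (hC r r1)) _.
  rewrite powRM ?powR_ge0// -powRrM ler_wpM2l ?powR_ge0//.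
  by apply: pw_le => //; rewrite mulNr mulrC; lra.
have mb0 : 0 < m - b by rewrite subr_gt0.
have D0 : 0 <= D by exact: powR_ge0.
pose E := `|F 1| + D / (m - b).
have Fb r : 1 <= r -> `|F r| <= E * r `^ (m - b).
  move=> r1; have : `|F r - F 1| <= D / (m - b) * r `^ (m - b) - D / (m - b) * 1 `^ (m - b).
    apply: (@der_norm_le _ F (fun r => D / (m - b) * r `^ (m - b)) (fun r => r ^+ n.+2 * f (H r))
      (fun r => D * r `^ (m - b - 1)) 1 r r1).
    - by move=> x /andP[x1 _]; apply: dF; lra.
    - move=> x /andP[x1 _]; have x0 : 0 < x by lra.
      refine (der_eq (derZ _ (der_powR _ x0)) _).
      by rewrite mulrA divfK// gt_eqF.
    - by move=> x /andP[/ltW x1 _]; exact: dFb.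
  have : 1 <= r `^ (m - b) by rewrite -(powRr0 r); apply: pw_le => //; exact: ltW.
  have : 0 <= D / (m - b) by rewrite divr_ge0// ltW.
  rewrite powR1 mulr1 /E mulrDl.
  move: (D / (m - b)) (r `^ (m - b)) => x y x0 y1.
  have := ler_wpM2l (normr_ge0 (F 1)) y1.
  have := ler_normD (F r - F 1) (F 1); rewrite subrK; lra.
have dvb r : 1 <= r -> `|- (F r / r ^+ n.+2)| <= E * r `^ (- b - 1).
  move=> r1; have r0 : 0 < r by lra.
  rewrite normrN normrM normfV (ger0_norm (exprn_ge0 _ (ltW r0))).
  rewrite ler_pdivrMr ?exprn_gt0// flux_pow// -mulrA -pwD//.
  have -> : - b - 1 + (m + 1) = m - b by lra.
  exact: Fb.
have [|l hl] := tail_limit (g := v) ltr01 b0 _ dvb.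
  by move=> r r1; apply: dv; lra.
have l0 : l = 0.
  apply: (resolvent_limit_eq0 gamma0 (radial_system_resolvent sys) (decays_vanish a0 Ha)).
  exact: rate_vanishes hl.
have bm' : 0 < b <= m by rewrite b0 ltW.
apply: (resolvent_decay gamma0 (radial_system_resolvent sys) bm' (decays_vanish a0 Ha)).
by move=> r r1; have := hl r r1; rewrite l0 subr0; exact.
Qed.

(** Each step gains the exponent sigma m - 2 > 0, which is where the
    restriction on sigma enters. *)
Lemma decay_bootstrap H P v F a : radial_system H P v F -> decays H (m / 2) ->
  m / 2 <= a < m -> decays H a.
Proof.
move=> sys H0 /andP[ma am]; pose d := sigma * m - 2.
have d0 : 0 < d by rewrite /d subr_gt0.
have step k : decays H (Num.min (m / 2 + k%:R * d) a).
  elim: k => [|k IHk]; first by rewrite mul0r addr0 min_l.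
  set a' := Num.min _ a in IHk.
  have a'a : a' <= a by rewrite ge_min lexx orbT.
  have a'm : m / 2 <= a'.
    by rewrite le_min ma andbT lerDl mulr_ge0// ltW.
  have a'0 : 0 < a' by lra.
  set b := Num.min _ a.
  have ba : b <= a by rewrite ge_min lexx orbT.
  have a'b : a' <= b.
    by rewrite le_min a'a andbT ge_min -[k.+1%:R]natr1 mulrDl mul1r addrA lerDl (ltW d0).
  have ba' : b <= a' + d.
    have -> : a' + d = Num.min (m / 2 + k.+1%:R * d) (a + d).
      by rewrite /a' addr_minl -addrA -[k.+1%:R]natr1 mulrDl mul1r.
    by rewrite le_min /b !ge_min lexx lerDl (ltW d0) orbT.
  apply: (decay_step sys a'0 _ _ IHk).
    by apply/andP; split; lra.
  have : sigma * m <= 2 * sigma * a'.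
    by rewrite -mulrA mulrCA ler_wpM2l ?(ltW sigma0)//; lra.
  by rewrite mulrDl mul1r; move: ba'; rewrite /d; lra.
have := step (Num.truncn ((a - m / 2) / d)).+1; rewrite min_r//.
rewrite -lerBlDl -ler_pdivrMr//; apply/ltW/truncnS_gt.
Qed.

Lemma vanishing_limit (g : R -> R) (l C x r0 : R) : 0 < x -> vanishes_at_infinity g ->
  (forall r, r0 <= r -> `|g r - l| <= C * r `^ (- x)) -> l = 0.
Proof.
move=> x0 goo hg; apply/eqP; rewrite -normr_le0 leNgt; apply/negP => l0.
have l30 : 0 < `|l| / 3 by lra.
have [r1 hr1] := goo _ l30.
have C0 : 0 < `|C| + 1 by rewrite ltr_wpDl.
have [r2 r21 hr2] := pwN_small (divr_gt0 l30 C0) x0.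
have [b [b0 b1 b2]] := upper3 r0 r1 r2.
have := hr1 _ b1; have := hg _ b0; have := hr2 _ b2.
rewrite ler_pdivlMr// => h1 h2 h3.
have : `|l| <= `|g b| + `|g b - l|.
  by rewrite -[in leLHS](subKr (g b) l); apply: ler_normB.
have : C * b `^ (- x) <= `|C| * b `^ (- x) by rewrite ler_wpM2r ?powR_ge0// ler_norm.
have := powR_ge0 b (- x); lra.
Qed.

(** A is determined by the limit m A of the flux F: the function with flux m A
    is A r^(-m), and v differs from it by the contribution of F - m A = O(1/r). *)
Lemma radial_asymptotics H P v F : radial_system H P v F -> decays H (m / 2) ->
  exists A a K, [/\ 1 <= a,
    vanishes_at_infinity (fun r => F r - m * A),
    vanishes_at_infinity v &
    forall r, a <= r -> `|H r - A * r `^ (- m)| <= K * r `^ (- (m + 1))].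
Proof.
move=> sys H0; have [dH dP dv dF] := sys.
pose p := 2 * sigma + 1; have p0 : 0 < p by have := sigma0; rewrite /p; lra.
have ps : p * m > 4 + m by rewrite /p mulrDl mul1r -mulrA; move: (sigma * m) msigma => t; lra.
(* the exponent a is chosen close enough to m for p a to be at least the
   dimension plus 1 *)
pose a := m - Num.min (m / 2) p^-1.
have am : m / 2 <= a < m.
  have : 0 < Num.min (m / 2) p^-1 by rewrite lt_min invr_gt0 p0 andbT divr_gt0.
  have : Num.min (m / 2) p^-1 <= m / 2 by rewrite ge_min lexx.
  by rewrite /a; move: (Num.min _ _) m0 => t; lra.
have pa : m + 3 <= p * a.
  have : p * Num.min (m / 2) p^-1 <= 1.
    by rewrite -(mulfV (lt0r_neq0 p0)) ler_wpM2l ?ge_min ?lexx ?orbT// ltW.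
  by rewrite /a mulrBr; lra.
have Ha := decay_bootstrap sys H0 am.
have a0 : 0 < a by have := m0; lra.
have Hoo := decays_vanish a0 Ha.
have [C hC] := Ha.
have dFb r : 1 <= r -> `|r ^+ n.+2 * f (H r)| <= C `^ p * r `^ (- 1 - 1).
  move=> r1; have r0 : 0 < r by lra.
  have C0 : 0 <= C.
    by have := le_trans (normr_ge0 _) (hC 1 (lexx _)); rewrite powR1 mulr1.
  rewrite normrM ger0_norm ?exprn_ge0 ?(ltW r0)//.
  have -> : - 1 - 1 = (m + 1) + (- m - 3) by lra.
  rewrite pwD// -flux_pow// [leRHS]mulrCA ler_wpM2l ?exprn_ge0 ?(ltW r0)//.
  apply: le_trans (pnl_le_pow sigma0 (hC r r1)) _.
  rewrite powRM ?powR_ge0// -powRrM ler_wpM2l ?powR_ge0//.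
  by apply: pw_le => //; rewrite mulNr mulrC -/p; lra.
have [|l hl] := tail_limit (g := F) ltr01 ltr01 _ dFb.
  by move=> r r1; apply: dF; lra.
pose A := l / m; have mA : m * A = l by rewrite /A mulrC divfK// gt_eqF.
pose D := C `^ p / 1.
have dvb r : 1 <= r ->
    `|- (F r / r ^+ n.+2) - A * (- m * r `^ (- m - 1))| <= D * r `^ (- (m + 1) - 1).
  move=> r1; have r0 : 0 < r by lra.
  have -> : - (F r / r ^+ n.+2) - A * (- m * r `^ (- m - 1)) = - ((F r - l) * r `^ (- m - 1)).
    rewrite flux_pow// -powRN -mA; have -> : - (m + 1) = - m - 1 by lra.
    ring.
  rewrite normrN normrM (ger0_norm (powR_ge0 _ _)).
  have -> : - (m + 1) - 1 = - 1 + (- m - 1) by lra.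
  by rewrite (pwD (-1))// mulrA; apply: ler_wpM2r (powR_ge0 _ _) _ _ (hl r r1).
have m10 : 0 < m + 1 by have := m0; lra.
have [|k hk] := tail_limit (g := fun r => v r - A * r `^ (- m)) ltr01 m10 _ dvb.
  move=> r r1; have r0 : 0 < r by lra.
  exact: (derB (dv r r0) (derZ A (der_powR (- m) r0))).
have vk : vanishes_at_infinity (fun r => v r - k).
  apply: (@rate_vanishes _ _ (D / (m + 1) + `|A|) m m0) => r r1.
  have : r `^ (- (m + 1)) <= r `^ (- m) by apply: pw_le => //; lra.
  have := hk r r1; set X := r `^ (- (m + 1)); set Y := r `^ (- m) => h XY.
  have DD : 0 <= D / (m + 1) by rewrite !divr_ge0 ?powR_ge0// ltW.
  have -> : v r - k = (v r - A * Y - k) + A * Y by ring.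
  apply: le_trans (ler_normD _ _) _.
  rewrite mulrDl lerD//; last by rewrite normrM (ger0_norm (powR_ge0 _ _)).
  by apply: le_trans h _; rewrite ler_wpM2l.
have k0 : k = 0.
  exact: (resolvent_limit_eq0 gamma0 (radial_system_resolvent sys) Hoo vk).
have [|b [K [b1 hb]]] := resolvent_asymptotics (A := A) (C := D / (m + 1)) gamma0
    (radial_system_resolvent sys) Hoo.
  by move=> r r1; have := hk r r1; rewrite k0 subr0; exact.
exists A, b, K; split => //.
- by rewrite mA; apply: rate_vanishes hl.
- by move=> e /vk[r0 h]; exists r0 => r /h; rewrite k0 subr0.
Qed.

End radial_system.

(** * The leading coefficient does not vanish *)

Section nonvanishing.
Context {R : realType} (n : nat) (gamma sigma : R).
Hypothesis gamma0 : 0 < gamma.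
Hypothesis n1 : (n <= 1)%N.
Let m : R := n.+1%:R.
Hypothesis msigma : 2 < sigma * m.

Let m0 : 0 < m. Proof. by rewrite ltr0n. Qed.
Let m2 : m <= 2. Proof. by rewrite /m ler_nat ltnS. Qed.
Let sigma0 : 0 < sigma.
Proof. by rewrite -(pmulr_lgt0 _ m0); apply: lt_trans msigma. Qed.

Let flux_pow (r : R) : 0 < r -> r ^+ n.+2 = r `^ (m + 1).
Proof. by move=> r0; rewrite pwn// /m natr1. Qed.

Local Notation f := (pnl sigma).
Local Notation radial_system := (radial_system n gamma sigma).

Let cross_ge (k K x y : R) : 0 <= k -> k <= K -> - (K * (x ^+ 2 + y ^+ 2)) <= 2 * k * (x * y).
Proof.
move=> k0 kK; have : 0 <= k * (x + y) ^+ 2 by rewrite mulr_ge0// sqr_ge0.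
have : k * (x ^+ 2 + y ^+ 2) <= K * (x ^+ 2 + y ^+ 2).
  by rewrite ler_wpM2r// addr_ge0// sqr_ge0.
rewrite sqrrD mulr2n; move: (k * _) => t; nra.
Qed.

(** Gronwall's inequality for the energy E = H^2 + P^2 + v^2 + F^2, whose
    logarithmic derivative is bounded below away from the origin. *)
Lemma backward_uniqueness H P v F b : radial_system H P v F -> 0 < b ->
  H b = 0 -> P b = 0 -> v b = 0 -> F b = 0 -> forall r, 0 < r <= b -> H r = 0.
Proof.
move=> [dH dP dv dF] b0 Hb Pb vb Fb a /andP[a0 ab].
have p0 r : a <= r <= b -> 0 < r by move=> /andP[ar _]; exact: lt_le_trans ar.
have [|c _ Hc] := @EVT_max _ (fun r => H r * H r) a b ab.
  apply: (@der_within _ _ (fun r => P r / r ^+ n.+2 * H r + H r * (P r / r ^+ n.+2))).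
  by move=> x /p0 x0; exact: derM (dH x x0) (dH x x0).
pose L := `|H c| `^ (2 * sigma).
have fL r : a <= r <= b -> `|f (H r)| <= L * `|H r|.
  move=> rab; apply: pnl_norm_le => //.
  have := Hc r; rewrite in_itv/= => /(_ rab).
  by rewrite -!expr2 -[leLHS]real_normK ?num_real// -[leRHS]real_normK ?num_real// ler_sqr ?nnegrE.
have L0 : 0 <= L by exact: powR_ge0.
pose A := (a ^+ n.+2)^-1; pose B := b ^+ n.+2.
have A0 : 0 <= A by rewrite invr_ge0 exprn_ge0// ltW.
have B0 : 0 <= B by rewrite exprn_ge0// ltW.
have rA r : a <= r <= b -> 0 <= (r ^+ n.+2)^-1 <= A.
  move=> rab; have r0 := p0 _ rab; case/andP: rab => ar rb.
  rewrite invr_ge0 exprn_ge0 ?(ltW r0)//= lef_pV2 ?posrE ?exprn_gt0//.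
  by rewrite lerXn2r// nnegrE ltW.
have rB r : a <= r <= b -> 0 <= r ^+ n.+2 <= B.
  move=> rab; have r0 := p0 _ rab; case/andP: rab => ar rb.
  by rewrite exprn_ge0 ?(ltW r0)//= lerXn2r// nnegrE ltW.
pose E r := H r * H r + P r * P r + (v r * v r + F r * F r).
pose K := 2 * A + 2 * (B / gamma) + B / gamma + B * (L ^+ 2 + 1).
pose E' r := 2 * (r ^+ n.+2)^-1 * (H r * P r) + 2 * (r ^+ n.+2 / gamma) * (P r * H r)
   + 2 * (r ^+ n.+2 / gamma) * (- P r * v r) + 2 * (r ^+ n.+2)^-1 * (- v r * F r)
   + 2 * r ^+ n.+2 * (F r * f (H r)).
have dE r : a <= r <= b -> is_derive r 1 E (E' r).
  move=> /p0 r0; have [hH hP hv hF] := And4 (dH r r0) (dP r r0) (dv r r0) (dF r r0).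
  refine (der_eq (derD (derD (derM hH hH) (derM hP hP)) (derD (derM hv hv) (derM hF hF))) _).
  by rewrite /E'; field; rewrite expf_eq0/= !gt_eqF.
have E'K r : a <= r <= b -> - (K * E r) <= E' r.
  move=> rab; have /andP[a1 a2] := rA _ rab; have /andP[b1 b2] := rB _ rab.
  have bg1 : 0 <= r ^+ n.+2 / gamma by rewrite divr_ge0// ltW.
  have bg2 : r ^+ n.+2 / gamma <= B / gamma by rewrite ler_pM2r ?invr_gt0.
  have := cross_ge (H r) (P r) a1 a2.
  have := cross_ge (P r) (H r) bg1 bg2.
  have := cross_ge (- P r) (v r) bg1 bg2.
  have := cross_ge (- v r) (F r) a1 a2.
  have := cross_ge (F r) (f (H r)) b1 b2.
  have f2 : f (H r) ^+ 2 <= L ^+ 2 * H r ^+ 2.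
    rewrite -exprMn -[leLHS]real_normK ?num_real// -[leRHS]real_normK ?num_real//.
    by rewrite ler_sqr ?nnegrE// [leRHS]normrM (ger0_norm L0); exact: fL.
  have := ler_wpM2l B0 f2.
  rewrite /E' /E /K !sqrrN -!expr2.
  have G0 : 0 <= B / gamma by rewrite divr_ge0// ltW.
  have [hH hP hv hF] := And4 (sqr_ge0 (H r)) (sqr_ge0 (P r)) (sqr_ge0 (v r)) (sqr_ge0 (F r)).
  move: (H r ^+ 2) (P r ^+ 2) (v r ^+ 2) (F r ^+ 2) hH hP hv hF => xH xP xv xF hH hP hv hF.
  have := mulr_ge0 A0 (addr_ge0 (addr_ge0 hH hP) (addr_ge0 hv hF)).
  have := mulr_ge0 G0 (addr_ge0 (addr_ge0 (addr_ge0 hH hH) hP) (addr_ge0 (addr_ge0 hv hv) (addr_ge0 hF (addr_ge0 hF hF)))).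
  have := mulr_ge0 B0 (addr_ge0 (addr_ge0 hH hP) hv).
  have := mulr_ge0 (mulr_ge0 B0 (sqr_ge0 L)) (addr_ge0 (addr_ge0 hP hv) hF).
  move: (r ^+ n.+2 / gamma) (B / gamma) ((r ^+ n.+2)^-1) (r ^+ n.+2) (f (H r)) => s G t w fH.
  move: (L ^+ 2) => LL; lra.
have EK0 : E a * expR (K * a) <= E b * expR (K * b).
  apply: (@der_ge0_le _ (fun r => E r * expR (K * r))
    (fun r => E' r * expR (K * r) + E r * (expR (K * r) * (K * 1))) a b ab).
  - move=> x xab; exact: (derM (dE x xab) (der_comp (derZ K (der_id x)) (is_derive_expR _))).
  - move=> x /andP[ax xb].
    have := E'K x (introT andP (conj (ltW ax) (ltW xb))).
    have := expR_gt0 (K * x); set e := expR _ => e0 h.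
    rewrite mulr1 [e * K]mulrC mulrA -mulrDl mulr_ge0 ?(ltW e0)//.
    by rewrite [E x * K]mulrC; lra.
have : E a <= 0.
  move: EK0; rewrite {2}/E Hb Pb vb Fb !mulr0 !addr0 mul0r.
  by rewrite pmulr_lle0 ?expR_gt0.
rewrite /E -!expr2 => Ea; apply/eqP; rewrite -sqrf_eq0; apply/eqP.
have := sqr_ge0 (H a); have := sqr_ge0 (P a); have := sqr_ge0 (v a); have := sqr_ge0 (F a); lra.
Qed.

(** The decay rate r^(-m) makes the nonlinearity O(M r^(-2 sigma m)), and
    sigma m > 2: as m <= 2, two integrations from infinity leave at least the
    factor r^(-2 (sigma m - 2)), which tends to 0. *)
Lemma tail_smallness H P v F C a : radial_system H P v F -> 
  vanishes_at_infinity F -> vanishes_at_infinity v ->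
  1 <= a -> 0 <= C -> (forall r, a <= r -> `|H r| <= C * r `^ (- m)) ->
  exists2 b, a <= b & forall r M, b <= r -> 0 <= M -> (forall s, r <= s -> `|H s| <= M) ->
    `|v r| <= M / 2.
Proof.
move=> [dH dP dv dF] Foo voo a1 C0 hC.
pose d := sigma * m - 2; have d0 : 0 < d by rewrite /d subr_gt0.
pose x := 2 * d; have x0 : 0 < x by rewrite /x; lra.
pose D := C `^ (2 * sigma).
have D0 : 0 <= D by exact: powR_ge0.
have e0 : 0 < x ^+ 2 / 2 / (D + 1) by rewrite !divr_gt0 ?exprn_gt0//; lra.
have [b b1 hb] := pwN_small e0 x0.
exists (Num.max a b); first by rewrite le_max lexx.
move=> r M; rewrite ge_max => /andP[ar br] M0 HM.
have r0 : 0 < r by lra.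
have dFb s : r <= s -> `|s ^+ n.+2 * f (H s)| <= D * M * s `^ (- x - 1).
  move=> rs; have s1 : 1 <= s by lra. 
  have s0 : 0 < s by lra.
  rewrite normrM ger0_norm ?exprn_ge0 ?(ltW s0)//.
  apply: (@le_trans _ _ (s ^+ n.+2 * (D * s `^ (- m * (2 * sigma)) * M))).
    rewrite ler_wpM2l ?exprn_ge0 ?(ltW s0)//.
    apply: le_trans (pnl_norm_le sigma0 (hC s (le_trans ar rs))) _.
    rewrite powRM ?powR_ge0// -powRrM ler_wpM2l ?mulr_ge0 ?powR_ge0//.
    exact: HM.
  have -> : s ^+ n.+2 * (D * s `^ (- m * (2 * sigma)) * M) =
      D * M * (s `^ (m + 1) * s `^ (- m * (2 * sigma))) by rewrite flux_pow//; ring.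
  rewrite ler_wpM2l ?mulr_ge0// -pwD//.
  apply: pw_le => //; rewrite /x /d.
  have -> : - m * (2 * sigma) = - (2 * (sigma * m)) by ring.
  by have := m2; move: (sigma * m) => t; lra.
have [|l hl] := tail_limit (g := F) r0 x0 _ dFb.
  by move=> s rs; apply: dF; lra.
have l0 := vanishing_limit x0 Foo hl.
have dvb s : r <= s -> `|- (F s / s ^+ n.+2)| <= D * M / x * s `^ (- x - 1).
  move=> rs; have s1 : 1 <= s by lra.
  have s0 : 0 < s by lra.
  rewrite normrN normrM normfV (ger0_norm (exprn_ge0 _ (ltW s0))).
  have := hl s rs; rewrite l0 subr0 => h.
  rewrite ler_pdivrMr ?exprn_gt0//; apply: le_trans h _.
  have -> : D * M / x * s `^ (- x - 1) * s ^+ n.+2 = D * M / x * (s `^ (- x - 1) * s `^ (m + 1)).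
    by rewrite flux_pow// mulrA.
  rewrite -pwD//; apply: ler_wpM2l; first by rewrite divr_ge0 ?mulr_ge0// ltW.
  by apply: pw_le => //; have := m0; lra.
have [|k hk] := tail_limit (g := v) r0 x0 _ dvb.
  by move=> s rs; apply: dv; lra.
have k0 := vanishing_limit x0 voo hk.
have := hk r (lexx r); rewrite k0 subr0 => h; apply: le_trans h _.
have := hb r br; rewrite ler_pdivlMr; last by lra.
rewrite ler_pdivlMr// => h.
have -> : D * M / x / x * r `^ (- x) = M * (D * r `^ (- x) / x ^+ 2).
  by field; rewrite gt_eqF.
rewrite ler_wpM2l// ler_pdivrMr ?exprn_gt0//.
by have := powR_ge0 r (- x); lra.
Qed.

(** An interior maximum of |H| is impossible where |v| <= |H| / 2, because
    there gamma lap H = H - v has the sign of H. *)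
Lemma tail_monotone H P v F a : radial_system H P v F -> 0 < a ->
  vanishes_at_infinity H ->
  (forall r M, a <= r -> 0 <= M -> (forall s, r <= s -> `|H s| <= M) -> `|v r| <= M / 2) ->
  forall r s, a <= r -> r <= s -> `|H s| <= `|H r|.
Proof.
move=> sys a0 Hoo hv r s ar rs; rewrite leNgt; apply/negP => Hrs.
have Hs0 : 0 < `|H s| by exact: le_lt_trans Hrs.
have Hs20 : 0 < `|H s| / 2 by lra.
have r0 : 0 < r by exact: lt_le_trans ar.
have [dH _ _ _] := sys.
have [r1 hr1] := Hoo _ Hs20.
have [b [b1 b2 _]] := upper3 r1 (s + 1) r.
have rb : r <= b by lra.
have [|c] := @EVT_max _ (fun x => H x * H x) r b rb.
  apply: (@der_within _ _ (fun r => P r / r ^+ n.+2 * H r + H r * (P r / r ^+ n.+2))).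
  by move=> x /andP[rx _]; have x0 : 0 < x by [lra]; exact: derM (dH x x0) (dH x x0).
rewrite in_itv/= => /andP[rc cb] Hc.
have Hc' x : r <= x <= b -> `|H x| <= `|H c|.
  move=> rxb; have := Hc x; rewrite in_itv/= => /(_ rxb).
  by rewrite -!expr2 -[leLHS]real_normK ?num_real// -[leRHS]real_normK ?num_real// ler_sqr ?nnegrE.
have sc : `|H s| <= `|H c| by apply: Hc'; apply/andP; split; lra.
have cr : r < c.
  by rewrite lt_neqAle rc andbT; apply/eqP => rc'; move: Hrs; rewrite rc' ltNge sc.
have cb' : c < b.
  rewrite lt_neqAle cb andbT; apply/eqP => cb'.
  by have := hr1 b b1; rewrite -cb'; lra.
have HM x : r <= x -> `|H x| <= `|H c|.
  move=> rx; have [xb|bx] := leP x b; first by apply: Hc'; rewrite rx.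
  by apply: le_trans (hr1 x _) _; lra.
have vc : `|v c| <= `|H c| / 2.
  by apply: hv => // [|x cx]; [lra|apply: HM; lra].
suff noc (H' P' v' : R -> R) : resolvent_ode n gamma H' P' v' ->
    (forall x, `|H' x| = `|H x|) -> (forall x, `|v' x| = `|v x|) -> 0 < H' c -> False.
  have ode := radial_system_resolvent sys.
  have [Hc0|Hc0|Hc0] := ltgtP (H c) 0.
  - apply: (noc _ _ _ (resolvent_odeN ode)); last by rewrite oppr_gt0.
    + by move=> x; rewrite normrN.
    + by move=> x; rewrite normrN.
  - exact: (noc _ _ _ ode).
  - by move: sc; rewrite Hc0 normr0; lra.
move=> [dH' dP' cv'] HH vv H'c.
apply: (@no_interior_max R n H' P' (fun x => (H' x - v' x) / gamma) r b c r0).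
- by rewrite cr.
- by move=> x /andP[rx _]; apply: dH'; lra.
- by move=> x /andP[rx _]; apply: dP'; lra.
- move=> x /Hc'; rewrite -!HH (gtr0_norm H'c); exact: le_trans (ler_norm _).
- have c0 : 0 < c by lra.
  apply: continuousM; last exact: cst_continuous.
  by apply: continuousB; [exact: (der_cont (dH' c c0))|exact: cv'].
- rewrite divr_gt0// subr_gt0; apply: le_lt_trans (ler_norm _) _.
  by rewrite vv; apply: le_lt_trans vc _; rewrite -HH (gtr0_norm H'c); lra.
Qed.

(** Integrating inwards from a point where H > 0 while P, v, F <= 0, these four
    signs persist, so that the flux P stays away from 0 at the origin. *)
Lemma inward_flux H P v F b C : radial_system H P v F -> 0 < b ->
  0 < H b -> P b <= 0 -> v b <= 0 -> F b <= 0 ->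
  (forall r, 0 < r <= 1 -> `|P r| <= C * r ^+ n.+1) -> False.
Proof.
move=> [dH dP dv dF] b0 Hb Pb vb Fb PC.
have signs r : 0 < r <= b -> (forall x, r < x <= b -> 0 < H x) ->
    [/\ forall x, r <= x <= b -> v x <= 0, forall x, r <= x <= b -> P x <= 0 & H b <= H r].
  move=> /andP[r0 rb] Hpos.
  have p0 x y : r <= x -> x <= y <= b -> 0 < y by move=> rx /andP[xy _]; lra.
  have F0 x : r <= x <= b -> F x <= 0.
    move=> /andP[rx xb]; apply: le_trans Fb.
    apply: (@der_ge0_le _ F (fun r => r ^+ n.+2 * f (H r)) x b xb).
      by move=> y /p0 => /(_ rx) y0; exact: dF.
    move=> y /andP[xy yb]; rewrite mulr_ge0 ?exprn_ge0//; first by lra.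
    by apply/pnl_ge0/ltW/Hpos; lra.
  have v0 x : r <= x <= b -> v x <= 0.
    move=> /andP[rx xb]; apply: le_trans vb.
    apply: (@der_ge0_le _ v (fun r => - (F r / r ^+ n.+2)) x b xb).
      by move=> y /p0 => /(_ rx) y0; exact: dv.
    move=> y /andP[xy yb]; rewrite oppr_ge0 mulr_le0_ge0//; first by apply: F0; lra.
    by rewrite invr_ge0 exprn_ge0//; lra.
  have P0 x : r <= x <= b -> P x <= 0.
    move=> /andP[rx xb]; apply: le_trans Pb.
    apply: (@der_ge0_le _ P (fun r => r ^+ n.+2 * ((H r - v r) / gamma)) x b xb).
      by move=> y /p0 => /(_ rx) y0; exact: dP.
    move=> y /andP[xy yb]; rewrite mulr_ge0 ?exprn_ge0//; first by lra.
    rewrite divr_ge0 ?(ltW gamma0)//.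
    have : v y <= 0 by apply: v0; lra.
    have : 0 < H y by apply: Hpos; lra.
    lra.
  split => //.
  rewrite -lerN2; apply: (@der_ge0_le _ (fun r => - H r) (fun r => - (P r / r ^+ n.+2)) r b rb).
    by move=> y /p0 => /(_ (lexx _)) y0; exact: derN (dH y y0).
  move=> y /andP[xy yb]; rewrite oppr_ge0 mulr_le0_ge0//; first by apply: P0; lra.
  by rewrite invr_ge0 exprn_ge0//; lra.
have Hpos r : 0 < r <= b -> 0 < H r.
  move=> /andP[r0 rb]; rewrite ltNge; apply/negP => Hr.
  pose S := [set x | r <= x <= b /\ H x <= 0].
  have Sr : S r by split => //; rewrite lexx.
  have Sb : ubound S b by move=> x [/andP[]].
  have hsS : has_sup S by split; [exists r|exists b].
  set c := sup S.
  have leS x : S x -> x <= c by move=> Sx; apply: ub_le_sup => //; exists b.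
  have rc : r <= c by exact: leS.
  have cb : c <= b by apply: ge_sup => //; exists r.
  have c0 : 0 < c by lra.
  have Hc : 0 < H c.
    apply: lt_le_trans Hb _; have [||_ _ //] := signs c; first by rewrite c0.
    move=> x /andP[cx xb]; rewrite ltNge; apply/negP => Hx.
    have : x <= c by apply: leS; split => //; rewrite xb (le_trans rc)// ltW.
    by rewrite leNgt cx.
  have [h h0 hq] : exists2 h, 0 < h & forall x, `|x - c| < h -> 0 < H x.
    have /nbhs_ballP[h h0 hq] : \forall x \near c, 0 < H x.
      exact: (cvgr_gt (H c) (der_cont (dH c c0)) _ Hc).
    by exists h => // x rx; apply: hq; rewrite /ball/= distrC.
  have [x [/andP[rx xb] Hx] cx] := sup_adherent h0 hsS.
  have xc : x <= c by apply: leS; split => //; rewrite rx.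
  by move: Hx; rewrite leNgt hq// ler0_norm ?subr_le0// opprB ltrBlDr -ltrBlDl -/c.
have HbP r : 0 < r <= b -> H b <= H r /\ P r <= 0 /\ v r <= 0.
  move=> /andP[r0 rb]; have [||h1 h2 h3] := signs r; first by rewrite r0.
    by move=> x /andP[rx xb]; apply: Hpos; rewrite xb andbT; lra.
  by split=> //; split; [apply: h2|apply: h1]; rewrite lexx.
pose k := H b / gamma / n.+3%:R; have k0 : 0 < k by rewrite !divr_gt0.
have Pk r : 0 < r <= b -> P r <= - (k * (b ^+ n.+3 - r ^+ n.+3)).
  move=> /andP[r0 rb].
  have : k * b ^+ n.+3 - k * r ^+ n.+3 <= P b - P r.
    apply: (@der_le _ (fun r => k * r ^+ n.+3) P (fun r => H b / gamma * r ^+ n.+2)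
      (fun r => r ^+ n.+2 * ((H r - v r) / gamma)) r b rb).
    - move=> x _; refine (der_eq (derZ _ (der_pow n.+2 x)) _).
      by rewrite mulrA divfK// pnatr_eq0.
    - by move=> x /andP[rx _]; apply: dP; lra.
    - move=> x /andP[rx xb]; have x0 : 0 < x by lra.
      have [|h1 [_ h2]] := HbP x; first by rewrite x0 ltW.
      rewrite mulrC ler_wpM2l ?exprn_ge0 ?(ltW x0)// ler_pM2r ?invr_gt0//; lra.
  by rewrite mulrBr; lra.
pose c := k * b ^+ n.+3; have c0 : 0 < c by rewrite mulr_gt0// exprn_gt0.
pose r := Num.min 1 (Num.min b (c / (`|C| + k + 1))).
have Ck : 0 < `|C| + k + 1 by have := normr_ge0 C; lra.
have r0 : 0 < r by rewrite !lt_min ltr01 b0 divr_gt0.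
have r1 : r <= 1 by rewrite ge_min lexx.
have rb : r <= b by rewrite !ge_min lexx orbT.
have rc : r * (`|C| + k + 1) <= c.
  by rewrite -ler_pdivlMr// !ge_min lexx !orbT.
have r01 : 0 < r <= 1 by rewrite r0.
have := Pk r; rewrite r0 rb => /(_ isT).
have := PC r r01; rewrite ler_norml => /andP[h _].
have e1 : r ^+ n.+1 <= r by rewrite exprS ler_piMr ?exprn_ile1// ltW.
have e3 : r ^+ n.+3 <= r by rewrite exprS ler_piMr ?exprn_ile1// ltW.
rewrite mulrBr -/c.
have : C * r ^+ n.+1 <= `|C| * r.
  apply: (@le_trans _ _ (`|C| * r ^+ n.+1)).
    by rewrite ler_wpM2r ?ler_norm// exprn_ge0// ltW.
  by rewrite ler_wpM2l.
have := ler_wpM2l (ltW k0) e3.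
lra.
Qed.

(** The remaining components of the system vanish on the tail as well, and
    backward_uniqueness applies. *)
Lemma trivial_tail H P v F r : radial_system H P v F -> 0 < r ->
  vanishes_at_infinity F -> vanishes_at_infinity v ->
  (forall s, r <= s -> H s = 0) -> forall s, 0 < s -> H s = 0.
Proof.
move=> sys r0 Foo voo Hr0 s s0; have [dH dP dv dF] := sys.
have [sr|rs] := ltP s r; last exact: Hr0.
have const0 (g : R -> R) : (forall x, r <= x -> is_derive x 1 g 0) ->
    vanishes_at_infinity g -> forall x, r <= x -> g x = 0.
  move=> dg goo x rx; apply/eqP; rewrite -normr_le0; apply/ler_addgt0Pl => e e0.
  have [r1 h1] := goo e e0; have [y [y1 y2 _]] := upper3 r1 x x.
  have h : `|g y - g x| <= 0 - 0.
    refine (@der_norm_le _ g (fun=> 0) (fun=> 0) (fun=> 0) x y y2 _ (fun z _ => der_cst 0 z) _).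
      by move=> z /andP[xz _]; apply: dg; lra.
    by move=> z _; rewrite normr0.
  move: h; rewrite subrr normr_le0 subr_eq0 ?addr0 ?add0r => /eqP <-; exact: h1.
have F0 : forall x, r <= x -> F x = 0.
  apply: const0 => // x rx; have x0 : 0 < x by lra.
  by refine (der_eq (dF x x0) _); rewrite Hr0// /pnl mulr0 mulr0.
have v0 : forall x, r <= x -> v x = 0.
  apply: const0 => // x rx; have x0 : 0 < x by lra.
  by refine (der_eq (dv x x0) _); rewrite F0// mul0r oppr0.
have P0 : P (r + 1) = 0.
  have x0 : 0 < r + 1 by lra.
  have dH0 : is_derive (r + 1) 1 H 0.
    apply: der_ext (der_cst 0 _).
    have : \forall x \near r + 1, r < x by apply: lt_nbhsr; rewrite ltrDl.
    by apply: filterS => x rx; rewrite Hr0// ltW.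
  have [_ e1] := dH _ x0; have [_ e2] := dH0.
  have /eqP : P (r + 1) / (r + 1) ^+ n.+2 = 0 by rewrite -e1 e2.
  by rewrite mulf_eq0 invr_eq0 expf_eq0/= (gt_eqF x0) orbF => /eqP.
apply: (@backward_uniqueness H P v F (r + 1) sys) => //.
- by lra.
- by apply: Hr0; lra.
- by apply: v0; lra.
- by apply: F0; lra.
- by rewrite s0/=; lra.
Qed.

(** The hypothesis on F is the vanishing of the coefficient of r^(-m) in the
    expansion of H. Up to the symmetry of the system under change of sign, H is
    positive near infinity, where the signs that inward_flux needs are read off
    by integrating from infinity. *)
Lemma vanishing_flux_trivial H P v F a C D : radial_system H P v F ->
  vanishes_at_infinity F -> vanishes_at_infinity v ->
  1 <= a -> 0 <= C -> (forall r, a <= r -> `|H r| <= C * r `^ (- m)) ->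
  (forall r, 0 < r <= 1 -> `|P r| <= D * r ^+ n.+1) ->
  forall r, 0 < r -> H r = 0.
Proof.
move=> sys Foo voo a1 C0 HC PD.
have Hoo : vanishes_at_infinity H.
  have C1 : 0 < C + 1 by lra.
  move=> e e0; have [r0 r01 hr0] := pwN_small (divr_gt0 e0 C1) m0.
  have [b [b1 b2 _]] := upper3 r0 a a.
  exists b => r br; apply: le_trans (HC _ (le_trans b2 br)) _.
  have := hr0 r (le_trans b1 br); rewrite ler_pdivlMr//.
  have := powR_ge0 r (- m); lra.
have [b ab hb] := tail_smallness sys Foo voo a1 C0 HC.
have b0 : 0 < b by lra.
have mono := tail_monotone sys b0 Hoo hb.
have [[s bs Hs]|Hne] := pselect (exists2 s, b <= s & H s = 0).
  apply: (trivial_tail sys (lt_le_trans b0 bs) Foo voo) => r sr.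
  by apply/eqP; rewrite -normr_le0; have := mono s r bs sr; rewrite Hs normr0.
exfalso.
have pos (H' P' v' F' : R -> R) : radial_system H' P' v' F' ->
    (forall x, `|H' x| = `|H x|) -> (forall x, `|P' x| = `|P x|) ->
    (forall x, `|v' x| = `|v x|) -> (forall x, `|F' x| = `|F x|) -> 0 < H' b -> False.
  move=> sys' HH PP vv FF H'b.
  have [dH dP dv dF] := sys'.
  have nz s : b <= s -> H' s != 0.
    by move=> bs; rewrite -normr_eq0 HH normr_eq0; apply/eqP => Hs; apply: Hne; exists s.
  have Hpos s : b <= s -> 0 < H' s.
    move=> bs; rewrite lt_neqAle eq_sym nz//= leNgt; apply/negP => Hs.
    have [|| c] := @IVT _ H' b s 0 bs.
    - apply: (@der_within _ H' (fun r => P' r / r ^+ n.+2)) => x /andP[bx _].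
      by apply: dH; lra.
    - by rewrite ge_min le_max (ltW Hs) (ltW H'b) orbT.
    - by rewrite in_itv/= => /andP[bc _]; apply/eqP/nz.
  have Pb : P' b <= 0.
    have bn : 0 < b ^+ n.+2 by rewrite exprn_gt0.
    rewrite leNgt; apply/negP => Pb.
    have [h h0 hq] : exists2 h, 0 < h & forall x, `|x - b| < h -> 0 < P' x.
      have /nbhs_ballP[h h0 hq] : \forall x \near b, 0 < P' x.
        exact: (cvgr_gt (P' b) (der_cont (dP b b0)) _ Pb).
      by exists h => // x rx; apply: hq; rewrite /ball/= distrC.
    have bh : b < b + h / 2 by rewrite ltrDl divr_gt0.
    have : H' b < H' (b + h / 2).
      apply: (@der_gt0_lt _ H' (fun r => P' r / r ^+ n.+2) _ _ bh).
        by move=> x /andP[bx _]; apply: dH; lra.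
      move=> x /andP[bx xb]; rewrite divr_gt0 ?exprn_gt0//; last by lra.
      by apply: hq; rewrite ger0_norm; lra.
    have := mono b (b + h / 2) (lexx _) (ltW bh).
    rewrite -!HH (gtr0_norm H'b) gtr0_norm; first by lra.
    by apply: Hpos; exact: ltW.
  have sgn_le0 (g g' : R -> R) : (forall x, b <= x -> is_derive x 1 g (g' x)) ->
      (forall x, b <= x -> 0 <= g' x) -> vanishes_at_infinity g ->
      forall x, b <= x -> g x <= 0.
    move=> dg g0 goo x bx; apply/ler_addgt0Pl => e e0; rewrite addr0.
    have [r1 h1] := goo e e0; have [y [y1 y2 _]] := upper3 r1 x x.
    apply: (@le_trans _ _ (g y)); last by apply: le_trans (ler_norm _) (h1 y y1).
    apply: (@der_ge0_le _ g g' x y y2) => z /andP[xz _]; first by apply: dg; lra.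
    by apply: g0; lra.
  have oo (g g' : R -> R) : (forall x, `|g' x| = `|g x|) -> vanishes_at_infinity g ->
      vanishes_at_infinity g'.
    by move=> gg goo e /goo[r1 h1]; exists r1 => r /h1; rewrite gg.
  have F'le : forall x, b <= x -> F' x <= 0.
    apply: (sgn_le0 F' (fun r => r ^+ n.+2 * f (H' r))); last exact: oo Foo.
    - by move=> x bx; apply: dF; lra.
    - by move=> x bx; rewrite mulr_ge0 ?exprn_ge0 ?pnl_ge0//; [lra|exact/ltW/Hpos].
  have v'le : forall x, b <= x -> v' x <= 0.
    apply: (sgn_le0 v' (fun r => - (F' r / r ^+ n.+2))); last exact: oo voo.
    - by move=> x bx; apply: dv; lra.
    - move=> x bx; rewrite oppr_ge0 mulr_le0_ge0 ?F'le// invr_ge0 exprn_ge0//; lra.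
  apply: (inward_flux (C := D) sys' b0 H'b Pb (v'le _ (lexx _)) (F'le _ (lexx _))).
  by move=> r r01; rewrite PP; exact: PD.
have [Hb0|Hb0|Hb0] := ltgtP (H b) 0.
- apply: (pos _ _ _ _ (radial_systemN sys)); rewrite ?oppr_gt0// => x; exact: normrN.
- exact: (pos _ _ _ _ sys).
- by apply: Hne; exists b.
Qed.

End nonvanishing.

(** * Behaviour at the origin *)

Section origin.
Context {R : realType} (n : nat).

Definition vanishes_at_origin (g : R -> R) : Prop :=
  forall e, 0 < e -> exists2 d, 0 < d & forall r, 0 < r < d -> `|g r| <= e.

Lemma origin_power (g g' : R -> R) (C : R) (k : nat) :
  (forall r : R, 0 < r <= 1 -> is_derive r 1 g (g' r)) ->
  (forall r, 0 < r <= 1 -> `|g' r| <= C * r ^+ k) ->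
  vanishes_at_origin g -> forall r, 0 < r <= 1 -> `|g r| <= C * r ^+ k.+1.
Proof.
move=> dg g'C g0 r /andP[r0 r1]; apply/ler_addgt0Pl => e e0.
have [d d0 gd] := g0 e e0.
pose a := Num.min (d / 2) r.
have a0 : 0 < a by rewrite lt_min r0 divr_gt0.
have ar : a <= r by rewrite ge_min lexx orbT.
have ad : a <= d / 2 by rewrite ge_min lexx.
have C0 : 0 <= C.
  have := g'C 1; rewrite ltr01 lexx expr1n mulr1 => /(_ isT); exact: le_trans.
pose c := C / k.+1%:R.
have c0 : 0 <= c by rewrite divr_ge0.
have : `|g r - g a| <= c * r ^+ k.+1 - c * a ^+ k.+1.
  apply: (@der_norm_le _ g (fun r => c * r ^+ k.+1) g' (fun r => C * r ^+ k) a r ar).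
  - by move=> x /andP[ax xr]; apply: dg; lra.
  - move=> x _; refine (der_eq (derZ _ (der_pow k x)) _).
    by rewrite mulrA divfK// pnatr_eq0.
  - by move=> x /andP[ax xr]; apply: g'C; lra.
have := gd a; rewrite a0/= => /(_ _); have -> : a < d by lra.
move=> /(_ isT) ga.
have : 0 <= c * a ^+ k.+1 by rewrite mulr_ge0// exprn_ge0// ltW.
have : c * r ^+ k.+1 <= C * r ^+ k.+1.
  rewrite ler_wpM2r ?exprn_ge0 ?(ltW r0)// ler_pdivrMr ?ltr0n// ler_peMr//.
  by rewrite ler1n.
have := ler_normD (g r - g a) (g a); rewrite subrK; lra.
Qed.

Lemma origin_limit (g g' : R -> R) (C : R) :
  (forall r : R, 0 < r <= 1 -> is_derive r 1 g (g' r)) ->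
  (forall r, 0 < r <= 1 -> `|g' r| <= C) ->
  exists l, forall r, 0 < r <= 1 -> `|g r - l| <= C * r.
Proof.
move=> dg g'C.
have C0 : 0 <= C.
  have := g'C 1; rewrite ltr01 lexx => /(_ isT); exact: le_trans.
have gk r s : 0 < r -> r <= s -> s <= 1 -> `|g s - g r| <= C * s - C * r.
  move=> r0 rs s1; apply: (@der_norm_le _ g (fun r => C * r) g' (fun=> C) r s rs).
  - by move=> x /andP[rx xs]; apply: dg; lra.
  - move=> x _; refine (der_eq (derZ _ (der_id x)) _); by rewrite mulr1.
  - by move=> x /andP[rx xs]; apply: g'C; lra.
pose S := [set g s - C * s | s in [set s | 0 < s <= 1]].
have kS r : 0 < r <= 1 -> ubound S (g r + C * r).
  move=> /andP[r0 r1] _ [s /= /andP[s0 s1] <-].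
  have Cr : 0 <= C * r by rewrite mulr_ge0// ltW.
  have Cs : 0 <= C * s by rewrite mulr_ge0// ltW.
  have [rs|/ltW sr] := leP r s.
    by have := gk _ _ r0 rs s1; rewrite ler_norml => /andP[]; lra.
  by have := gk _ _ s0 sr r1; rewrite ler_norml => /andP[]; lra.
have one : 0 < (1 : R) <= 1 by rewrite ltr01 lexx.
exists (sup S) => r r01; rewrite ler_norml; apply/andP; split.
  have : sup S <= g r + C * r by apply: ge_sup; [exists (g 1 - C * 1), 1 => //=|exact: kS].
  lra.
have : g r - C * r <= sup S.
  by apply: ub_le_sup; [exists (g 1 + C * 1); exact: kS|exists r].
lra.
Qed.

(** Here H' = O(1/r), so that H is at most logarithmic. *)
Lemma origin_growth (H P : R -> R) (C e : R) : 0 < e ->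
  (forall r : R, 0 < r -> is_derive r 1 H (P r / r ^+ n.+2)) ->
  (forall r, 0 < r <= 1 -> `|P r| <= C * r ^+ n.+1) ->
  exists2 K, 0 <= K & forall r, 0 < r <= 1 -> `|H r| <= K * r `^ (- e).
Proof.
move=> e0 dH PC.
have C0 : 0 <= C.
  have := PC 1; rewrite ltr01 lexx expr1n mulr1 => /(_ isT); exact: le_trans.
have Ce : 0 <= C / e by rewrite divr_ge0// ltW.
exists (`|H 1| + C / e); first by rewrite addr_ge0.
move=> r /andP[r0 r1].
have : `|H 1 - H r| <= - (C / e) * 1 `^ (- e) - - (C / e) * r `^ (- e).
  apply: (@der_norm_le _ H (fun r => - (C / e) * r `^ (- e)) (fun r => P r / r ^+ n.+2)
     (fun r => C * r `^ (- e - 1)) r 1 r1).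
  - by move=> x /andP[rx _]; apply: dH; lra.
  - move=> x /andP[rx _]; have x0 : 0 < x by lra.
    refine (der_eq (derZ _ (der_powR _ x0)) _).
    by field; rewrite gt_eqF.
  - move=> x /andP[rx x1]; have x0 : 0 < x by lra.
    rewrite normrM normfV (ger0_norm (exprn_ge0 _ (ltW x0))) ler_pdivrMr ?exprn_gt0//.
    have x01 : 0 < x <= 1 by rewrite x0 ltW.
    apply: le_trans (PC x x01) _; rewrite -mulrA ler_wpM2l//.
    rewrite (exprS x n.+1) mulrA ler_peMl ?exprn_ge0 ?(ltW x0)//.
    rewrite pwB1// divfK ?gt_eqF// -(powRr0 x).
    by apply: pw_ge => //; lra.
have : 1 <= r `^ (- e).
  by rewrite -(powRr0 r); apply: pw_ge; [rewrite r0 r1|lra].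
rewrite powR1 mulr1 mulrDl.
move: (C / e) Ce (r `^ (- e)) => x x0 y y1.
have := ler_wpM2l (normr_ge0 (H 1)) y1.
have := ler_normB (H 1) (H 1 - H r); rewrite opprB addrC subrK; lra.
Qed.

Variables (gamma sigma : R).
Hypothesis gamma0 : 0 < gamma.
Hypothesis sigma0 : 0 < sigma.

(** The growth bound for e = 1 / (2 sigma + 1) makes the nonlinearity O(1/r), so
    v' is bounded and v has a limit; the bound H = O(1/r) then improves P to
    O(r^(n+2)), so that H' is bounded. *)
Lemma radial_origin_limit H P v F C : radial_system n gamma sigma H P v F ->
  (forall r, 0 < r <= 1 -> `|P r| <= C * r ^+ n.+1) ->
  vanishes_at_origin F ->
  exists l K, forall r, 0 < r <= 1 -> `|H r - l| <= K * r.
Proof.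
move=> [dH dP dv dF] PC F0.
have p0 : 0 < 2 * sigma + 1 by have := sigma0; lra.
have pi0 : 0 < (2 * sigma + 1)^-1 by rewrite invr_gt0.
have [K K0 hK] := origin_growth pi0 dH PC.
have [K1 K10 hK1] := origin_growth ltr01 dH PC.
have dom (r : R) : 0 < r <= 1 -> 0 < r by case/andP.
pose D := K `^ (2 * sigma + 1).
have FD : forall r, 0 < r <= 1 -> `|F r| <= D * r ^+ n.+2.
  apply: (origin_power (g' := fun r => r ^+ n.+2 * pnl sigma (H r))) => //.
    by move=> r /dom; exact: dF.
  move=> r r01; have r0 := dom r r01.
  rewrite normrM (ger0_norm (exprn_ge0 _ (ltW r0))) (exprSr r n.+1) -mulrA mulrC.
  rewrite ler_wpM2r ?exprn_ge0 ?(ltW r0)//.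
  rewrite -ler_pdivlMl// mulrC.
  apply: le_trans (pnl_le_pow sigma0 (hK r r01)) _.
  rewrite powRM ?powR_ge0// -powRrM mulNr mulVf ?gt_eqF//.
  by rewrite powR_inv1// ltW.
have dvD r : 0 < r <= 1 -> `|- (F r / r ^+ n.+2)| <= D.
  move=> r01; have r0 := dom r r01.
  rewrite normrN normrM normfV (ger0_norm (exprn_ge0 _ (ltW r0))).
  by rewrite ler_pdivrMr ?exprn_gt0// FD.
have D0 : 0 <= D by exact: powR_ge0.
have [l hl] := origin_limit (g := v) (fun r r01 => dv r (dom r r01)) dvD.
pose E := (K1 + `|l| + D) / gamma.
have PE : forall r, 0 < r <= 1 -> `|P r| <= E * r ^+ n.+2.
  apply: (origin_power (g' := fun r => r ^+ n.+2 * ((H r - v r) / gamma))) => //.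
  - by move=> r /dom; exact: dP.
  - move=> r r01; have r0 := dom r r01.
    rewrite normrM (ger0_norm (exprn_ge0 _ (ltW r0))) (exprSr r n.+1) -mulrA mulrC.
    rewrite ler_wpM2r ?exprn_ge0 ?(ltW r0)//.
    rewrite normrM normfV (gtr0_norm gamma0) mulrA ler_pM2r ?invr_gt0//.
    case/andP: r01 (hK1 r r01) (hl r r01) => _ r1.
    rewrite powR_inv1 ?(ltW r0)// ler_pdivlMr// [_ * r]mulrC => h1 h2.
    have : `|H r - v r| <= `|H r| + (`|l| + D * r).
      have -> : H r - v r = H r - (l + (v r - l)) by lra.
      apply: le_trans (ler_normB _ _) _; rewrite lerD2l.
      by apply: le_trans (ler_normD _ _) _; rewrite lerD2l.
    move=> /(ler_wpM2l (ltW r0)) h; apply: le_trans h _.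
    rewrite !mulrDr addrA; apply: lerD; first apply: lerD => //.
      by rewrite ler_piMl.
    by rewrite mulrCA ler_piMr// -expr2 expr_le1// ltW.
  - move=> e e0.
    have C0 : 0 <= C.
      have := PC 1; rewrite ltr01 lexx expr1n mulr1 => /(_ isT); exact: le_trans.
    have C1 : 0 < C + 1 by lra.
    exists (Num.min 1 (e / (C + 1))); first by rewrite lt_min ltr01 divr_gt0.
    move=> r /andP[r0]; rewrite lt_min => /andP[/ltW r1]; rewrite ltr_pdivlMr// => /ltW re.
    have r01 : 0 < r <= 1 by rewrite r0.
    apply: le_trans (PC r r01) (le_trans _ re).
    rewrite mulrDr mulr1; apply: (@le_trans _ _ (C * r)).
      by rewrite ler_wpM2l// exprS ler_piMr ?exprn_ile1// ltW.
    by rewrite mulrC lerDl ltW.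
have dHE r : 0 < r <= 1 -> `|P r / r ^+ n.+2| <= E.
  move=> r01; have r0 := dom r r01.
  rewrite normrM normfV (ger0_norm (exprn_ge0 _ (ltW r0))).
  by rewrite ler_pdivrMr ?exprn_gt0// PE.
have [l' hl'] := origin_limit (g := H) (fun r r01 => dH r (dom r r01)) dHE.
by exists l', E.
Qed.

End origin.

(** * Decay rate of solutions of the radial system *)

Lemma radial_decay (R : realType) (n : nat) (gamma sigma : R)
    (H P v F : R -> R) (C : R) :
  0 < gamma -> (n <= 1)%N -> 2 < sigma * n.+1%:R ->
  radial_system n gamma sigma H P v F ->
  (forall r, 0 < r <= 1 -> `|P r| <= C * r ^+ n.+1) ->
  decays H (n.+1%:R / 2) ->
  (exists2 r, 0 < r & H r != 0) ->
  exists A a K, [/\ A != 0, 1 <= a &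
    forall r, a <= r -> `|H r - A * r `^ (- n.+1%:R)| <= K * r `^ (- (n.+1%:R + 1))].
Proof.
move=> gamma0 n1 msigma sys PC dec [r0 r00 Hr0].
have [A [a [K [a1 Foo voo hA]]]] := radial_asymptotics gamma0 msigma sys dec.
exists A, a, K; split => //; apply/eqP => A0; move/eqP: Hr0; apply.
apply: (vanishing_flux_trivial (a := a) (C := `|K|) gamma0 n1 msigma sys _ voo a1 _ _ PC r00).
- by move=> e /Foo[b hb]; exists b => r /hb; rewrite A0 mulr0 subr0.
- exact: normr_ge0.
- move=> r ar; have := hA r ar; rewrite A0 mul0r subr0 => /le_trans; apply.
  apply: (@le_trans _ _ (`|K| * r `^ (- (n.+1%:R + 1)))).
    by rewrite ler_wpM2r ?powR_ge0// ler_norm.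
  by rewrite ler_wpM2l//; apply: pw_le; [exact: le_trans ar|lra].
Qed.

(** * Test functions of the half-line *)

Section smooth_functions.
Context {R : realType}.
Implicit Types (f g : R -> R) (k : nat).

Fixpoint diffn k f : Prop :=
  if k is k'.+1 then
    exists2 f' : R -> R, forall x : R, is_derive x 1 f (f' x) & diffn k' f'
  else True.

Definition smooth1 f : Prop := forall k, diffn k f.

Lemma diffnW k f : diffn k.+1 f -> diffn k f.
Proof. by elim: k f => // k IH f [f' df /IH kf']; exists f'. Qed.

Lemma diffn_cst k (c : R) : diffn k (fun=> c).
Proof.
elim: k c => // k IH c; exists (fun=> 0) => [x|]; first exact: der_cst.
exact: IH.
Qed.

Lemma diffn_id k : diffn k (fun x : R => x).
Proof.
case: k => // k; exists (fun=> 1) => [x|]; first exact: der_id.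
exact: diffn_cst.
Qed.

Lemma diffnD k f g : diffn k f -> diffn k g -> diffn k (fun x => f x + g x).
Proof.
elim: k f g => // k IH f g [f' df kf'] [g' dg kg'].
exists (fun x => f' x + g' x) => [x|]; first exact: derD (df x) (dg x).
exact: IH.
Qed.

Lemma diffnM k f g : diffn k f -> diffn k g -> diffn k (fun x => f x * g x).
Proof.
elim: k f g => // k IH f g kf kg; have [f' df kf'] := kf; have [g' dg kg'] := kg.
exists (fun x => f' x * g x + f x * g' x) => [x|]; first exact: derM (df x) (dg x).
by apply: diffnD; apply: IH => //; exact: diffnW.
Qed.

Lemma diffn_affine k f (a b : R) : diffn k f -> diffn k (fun x => f (a * x + b)).
Proof.
elim: k f => // k IH f [f' df kf'].
exists (fun x => f' (a * x + b) * (a * 1 + 0)) => [x|].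
  exact: der_comp (derD (derZ a (der_id x)) (der_cst b x)) (df _).
by apply: diffnM; [exact: IH|exact: diffn_cst].
Qed.

Lemma diffn_div_id k f (e : R) : 0 < e -> (forall x, x < e -> f x = 0) ->
  diffn k f -> diffn k (fun x => f x / x).
Proof.
move=> e0; elim: k f => // k IH f fe kf; have [f' df kf'] := kf.
have f'e x : x < e -> f' x = 0.
  move=> xe; have [_ <-] := df x; have [_] : is_derive x 1 f 0; last by [].
  apply: der_ext (der_cst 0 x).
  by apply: filterS (lt_nbhsl xe) => y /fe.
exists (fun x => f' x / x + (- 1) * (f x / x / x)).
  move=> x; have [xe|ex] := ltP x e.
    rewrite fe// f'e// !mul0r mulr0 addr0; apply: der_ext (der_cst 0 x).
    by apply: filterS (lt_nbhsl xe) => y /fe ->; rewrite mul0r.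
  have x0 : x != 0 by rewrite gt_eqF//; exact: lt_le_trans ex.
  refine (der_eq (derM (df x) (derV x0 (der_id x))) _).
  by field.
apply: diffnD; first exact: IH.
apply: diffnM; first exact: diffn_cst.
apply: (IH); first by move=> x /fe ->; rewrite mul0r.
by apply: IH => //; exact: diffnW.
Qed.

Lemma smooth1_derive f : smooth1 f ->
  exists2 f' : R -> R, forall x : R, is_derive x 1 f (f' x) & smooth1 f'.
Proof.
move=> sf; have [f' df _] := sf 1; exists f' => // k; have [g dg kg] := sf k.+1.
suff -> : f' = g by [].
by apply/funext => x; have [_ <-] := df x; have [_ <-] := dg x.
Qed.

Lemma smooth1_primitive f f' : (forall x : R, is_derive x 1 f (f' x)) -> smooth1 f' ->
  smooth1 f.
Proof. by move=> df sf' [//|k]; exists f'. Qed.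

Lemma smooth1_continuous f : smooth1 f -> continuous f.
Proof. by move=> /smooth1_derive[f' df _] x; exact: der_cont (df x). Qed.

(** The functions y^j exp(-y) of y = 1/x, extended by 0 to x <= 0. *)
Definition flat (j : nat) (x : R) : R :=
  if 0 < x then x^-1 ^+ j * expR (- x^-1) else 0.

Lemma flat_ge0 j x : 0 <= flat j x.
Proof.
by rewrite /flat; case: ifPn => // x0; rewrite mulr_ge0 ?expR_ge0// exprn_ge0// invr_ge0 ltW.
Qed.

(** From y^(j+1) / (j+1)! <= exp y with y = 1/x. *)
Lemma flat_le j x : 0 <= x -> flat j x <= j.+1`!%:R * x.
Proof.
move=> x0; rewrite /flat; case: ifPn => [xp|_]; last by rewrite mulr_ge0.
have y0 : 0 <= x^-1 by rewrite invr_ge0.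
have := expR_ge1Dxn j y0; set t := (X in 1 + X) => h.
have {}h : t <= expR x^-1 by lra.
rewrite expRN -ler_pdivlMr ?invr_gt0 ?expR_gt0// invrK.
rewrite /t ler_pdivrMr ?ltr0n ?fact_gt0// in h.
rewrite mulrAC mulrC -ler_pdivrMl// mulrC [leRHS]mulrC; apply: le_trans h.
by rewrite exprSr.
Qed.

Lemma flat_continuous0 j : {for 0, continuous (flat j)}.
Proof.
have f00 : flat j 0 = 0 by rewrite /flat ltxx.
apply/cvgrPdist_le => e e0; rewrite f00.
have c0 : 0 < j.+1`!%:R :> R by rewrite ltr0n fact_gt0.
have : \forall x \near 0, `|x : R| < e / j.+1`!%:R.
  by apply/nbhs_norm0P; exists (e / j.+1`!%:R) => //=; rewrite divr_gt0.
apply: filterS => x; rewrite ltr_pdivlMr// => xe.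
rewrite sub0r normrN ger0_norm ?flat_ge0//.
have [x0|x0] := leP 0 x; last by rewrite /flat ltNge (ltW x0) ltW.
by apply: le_trans (flat_le j x0) _; rewrite mulrC -(ger0_norm x0) ltW.
Qed.

Lemma flat_derive j (x : R) : is_derive x 1 (flat j) (flat j.+2 x - j%:R * flat j.+1 x).
Proof.
have [x0|x0|->] := ltgtP x 0.
- have -> : flat j.+2 x - j%:R * flat j.+1 x = 0.
    by rewrite /flat ltNge (ltW x0)/= mulr0 subr0.
  apply: der_ext (der_cst 0 x).
  by apply: filterS (lt_nbhsl x0) => y y0; rewrite /flat ltNge (ltW y0).
- apply: (@der_ext _ (fun x => x^-1 ^+ j * expR (- x^-1))).
    by apply: filterS (lt_nbhsr x0) => y y0; rewrite /flat y0.
  rewrite /flat x0; have xn : x != 0 by rewrite gt_eqF.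
  elim: j => [|j IH].
    refine (der_eq (derM (der_cst 1 x) (der_comp (derN (derV xn (der_id x))) (is_derive_expR _))) _).
    by field.
  rewrite (_ : (fun x => _) = fun x => x^-1 * (x^-1 ^+ j * expR (- x^-1))); last first.
    by apply/funext => y; rewrite exprS mulrA.
  refine (der_eq (derM (derV xn (der_id x)) IH) _).
  by rewrite -[j.+1%:R]natr1 !exprS; field.
- have -> : flat j.+2 0 - j%:R * flat j.+1 0 = 0.
    by rewrite /flat ltxx mulr0 subr0.
  apply/is_derive1_caratheodory; exists (flat j.+1); split.
  + move=> z; rewrite /flat ltxx !subr0; case: ifPn => z0; last by rewrite mul0r.
    by rewrite exprS [RHS]mulrC !mulrA mulfV ?mul1r// gt_eqF.
  + exact: flat_continuous0.
  + by rewrite /flat ltxx.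
Qed.

(** The span of these functions is closed under differentiation. *)
Lemma flat_smooth j : smooth1 (flat j).
Proof.
move=> k; elim: k j => // k IH j.
exists (fun x => flat j.+2 x + (- j%:R) * flat j.+1 x) => [x|].
  by rewrite mulNr; exact: flat_derive.
by apply: diffnD => //; apply: diffnM => //; exact: diffn_cst.
Qed.

(** The test functions of the half-line ]0, +oo[. *)
Definition half_test (f : R -> R) : Prop := smooth1 f /\
  exists a b, [/\ 0 < a, a < b & forall x, ~~ (a <= x <= b) -> f x = 0].

Lemma half_testD f g : half_test f -> half_test g -> half_test (fun x => f x + g x).
Proof.
move=> [sf [a [b [a0 ab fab]]]] [sg [c [d [c0 cd gcd]]]]; split.
  by move=> k; exact: diffnD.
exists (Num.min a c), (Num.max b d); split; first by rewrite lt_min a0.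
  by rewrite gt_min lt_max ab.
move=> x; rewrite ge_min le_max => xabcd.
rewrite fab ?gcd ?addr0//; apply: contra xabcd => /andP[-> ->]; by rewrite ?orbT.
Qed.

Lemma half_testMl f g : smooth1 g -> half_test f -> half_test (fun x => g x * f x).
Proof.
move=> sg [sf [a [b [a0 ab fab]]]]; split; first by move=> k; exact: diffnM.
by exists a, b; split => // x /fab ->; rewrite mulr0.
Qed.

Lemma half_testZ (c : R) f : half_test f -> half_test (fun x => c * f x).
Proof. by apply: half_testMl => k; exact: diffn_cst. Qed.

Lemma half_test_div f : half_test f -> half_test (fun x => f x / x).
Proof.
move=> [sf [a [b [a0 ab fab]]]]; split.
  by move=> k; apply: (diffn_div_id a0) => // x xa; rewrite fab// leNgt xa.
by exists a, b; split => // x /fab ->; rewrite mul0r.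
Qed.

Lemma half_test_divX n f : half_test f -> half_test (fun x => f x / x ^+ n).
Proof.
move=> hf; elim: n => [|n IH].
  by rewrite (_ : (fun x => _) = f)//; apply/funext => x; rewrite expr0 divr1.
rewrite (_ : (fun x => _) = fun x => (f x / x ^+ n) / x); first exact: half_test_div.
by apply/funext => x; rewrite exprSr invfM mulrA.
Qed.

Lemma half_test_mulX n f : half_test f -> half_test (fun x => x ^+ n * f x).
Proof.
move=> hf; apply: half_testMl hf => k; elim: n => [|n IH].
  by rewrite (_ : (fun x : R => _) = cst 1); [exact: diffn_cst|apply/funext => x; rewrite expr0].
rewrite (_ : (fun x : R => _) = fun x : R => x * x ^+ n).
  by apply: diffnM => //; exact: diffn_id.
by apply/funext => x; rewrite exprS.
Qed.

Lemma half_test_derive f f' : (forall x : R, is_derive x 1 f (f' x)) -> half_test f ->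
  half_test f'.
Proof.
move=> df [sf [a [b [a0 ab fab]]]]; split.
  have [g dg sg] := smooth1_derive sf.
  suff -> : f' = g by [].
  by apply/funext => x; have [_ <-] := df x; have [_ <-] := dg x.
exists a, b; split => // x xab; have [_ <-] := df x.
have [_] : is_derive x 1 f 0; last by [].
apply: der_ext (der_cst 0 x).
move: xab; rewrite negb_and -!ltNge => /orP[xa|bx].
  by apply: filterS (lt_nbhsl xa) => y ya; rewrite fab// leNgt ya.
by apply: filterS (lt_nbhsr bx) => y yb; rewrite fab// negb_and -!ltNge yb orbT.
Qed.

(** A sequence of test functions that increases to the indicator of ]a, b[. *)
Definition plateau (a b : R) (n : nat) (x : R) : R :=
  flat 0 (n.+1%:R * (x - a)) * flat 0 (n.+1%:R * (b - x)).

Lemma plateau_test a b n : 0 < a -> a < b -> half_test (plateau a b n).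
Proof.
move=> a0 ab; split.
  move=> k; apply: diffnM.
    rewrite (_ : (fun x => _) = fun x => flat 0 (n.+1%:R * x + - (n.+1%:R * a))).
      by apply: diffn_affine; exact: flat_smooth.
    by apply/funext => x; rewrite mulrBr.
  rewrite (_ : (fun x => _) = fun x => flat 0 (- n.+1%:R * x + (n.+1%:R * b))).
    by apply: diffn_affine; exact: flat_smooth.
  by apply/funext => x; rewrite mulrBr mulNr addrC.
exists a, b; split => // x; rewrite negb_and -!ltNge /plateau => /orP[xa|bx].
  by rewrite {1}/flat pmulr_rgt0// subr_gt0 ltNge (ltW xa) mul0r.
by rewrite {2}/flat pmulr_rgt0// subr_gt0 ltNge (ltW bx) mulr0.
Qed.

Lemma flat0_le1 x : flat 0 x <= 1.
Proof.
rewrite /flat; case: ifPn => // x0; rewrite expr0 mul1r expR_le1 oppr_le0.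
by rewrite invr_ge0 ltW.
Qed.

Lemma plateau_ge0 a b n x : 0 <= plateau a b n x.
Proof. by rewrite mulr_ge0 ?flat_ge0. Qed.

Lemma plateau_le1 a b n x : plateau a b n x <= 1.
Proof. by rewrite mulr_ile1 ?flat_ge0 ?flat0_le1. Qed.

Lemma plateau_out a b n x : ~~ (a < x < b) -> plateau a b n x = 0.
Proof.
rewrite negb_and -!leNgt /plateau => /orP[xa|bx].
  by rewrite {1}/flat pmulr_rgt0// subr_gt0 ltNge xa mul0r.
by rewrite {2}/flat pmulr_rgt0// subr_gt0 ltNge bx mulr0.
Qed.


Lemma flat_cvg1 (x : R) : 0 < x -> flat 0 (n.+1%:R * x) @[n --> \oo] --> (1 : R).
Proof.
move=> x0; rewrite (_ : (fun n => _) = fun n : nat => expR (- (n.+1%:R^-1 * x^-1))); last first.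
  by apply/funext => n; rewrite /flat pmulr_rgt0// x0 expr0 mul1r invfM.
have h : - (n.+1%:R^-1 * x^-1) @[n --> \oo] --> - (0 * x^-1).
  by apply: cvgN; apply: cvgMl; exact: cvg_harmonic.
have := continuous_cvg _ (@continuous_expR R _) h.
by rewrite mul0r oppr0 expR0; apply.
Qed.

Lemma plateau_cvg a b x : plateau a b n x @[n --> \oo] --> (\1_`]a, b[ x : R).
Proof.
rewrite indicE; have [xab|xab] := boolP (a < x < b).
  rewrite mem_set/= ?in_itv//=; case/andP: xab => ax xb.
  by rewrite -[1%:R]mulr1; apply: cvgM; apply: flat_cvg1; rewrite subr_gt0.
rewrite memNset/=; last by rewrite in_itv/=; exact/negP.
rewrite (_ : (fun n => _) = cst 0); first exact: cvg_cst.
by apply/funext => n; rewrite plateau_out.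
Qed.

End smooth_functions.

(** * Weak identities on the half-line *)

Lemma ae_mono d (T : measurableType d) (R : realType) (mu : {measure set T -> \bar R})
    (P Q : T -> Prop) :
  (forall x, P x -> Q x) -> {ae mu, forall x, P x} -> {ae mu, forall x, Q x}.
Proof. by move=> PQ; exact: filterS. Qed.

Section half_line.
Context {R : realType}.
Notation mu := (@lebesgue_measure R).
Implicit Types (f g k : R -> R) (a b : R).

Local Notation pos := (`]0, +oo[%classic : set R).

Definition locint f : Prop :=
  forall a b, 0 < a -> mu.-integrable `[a, b] (EFin \o f).

Lemma cont_integrable f a b : (forall x, a <= x <= b -> {for x, continuous f}) ->
  mu.-integrable `[a, b] (EFin \o f).
Proof.
move=> cf; apply: continuous_compact_integrable; first exact: segment_compact.
by apply: continuous_in_subspaceT => x; rewrite inE/= in_itv/= => /cf.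
Qed.

Lemma cont_locint f : (forall x, 0 < x -> {for x, continuous f}) -> locint f.
Proof.
move=> cf a b a0; apply: cont_integrable => x /andP[ax _]; apply: cf.
exact: lt_le_trans ax.
Qed.

(** The base point of the integral is moved below x, because k may fail to be
    integrable at 0. *)
Lemma pos_primitive k : (forall x, 0 < x -> {for x, continuous k}) ->
  exists K, forall x : R, 0 < x -> is_derive x 1 K (k x).
Proof.
move=> ck.
pose I a x := \int[mu]_(t in `[a, x]) k t.
have IB a b x : 0 < a -> a <= b -> b <= x -> I a x - I a b = I b x.
  move=> a0 ab bx; have b0 : 0 < b by exact: lt_le_trans ab.
  rewrite /I Rintegral_itvB ?bnd_simp//; last exact: cont_locint.
  rewrite Rintegral_itv_obnd_cbnd//.
  by apply: integrableS (cont_locint ck x b0) => //; apply: subset_itvr; rewrite bnd_simp.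
exists (fun x => I (Num.min x 1) x - I (Num.min x 1) 1) => x x0.
pose d := Num.min x 1 / 2.
have m0 : 0 < Num.min x 1 by rewrite lt_min x0 ltr01.
have d0 : 0 < d by rewrite divr_gt0.
have dm : d < Num.min x 1 by rewrite /d; lra.
have [dx d1] : d < x /\ d < 1 by move: dm; rewrite lt_min => /andP[].
apply: (@der_ext _ (fun y => I d y - I d 1)).
  apply: filterS (lt_nbhsr dx) => y dy.
  have dy1 : d <= Num.min y 1 by rewrite le_min !ltW.
  have [y1|y1] := leP y 1.
    rewrite -[in RHS](@IB d) ?(ltW dy)// -[I y 1](@IB d) ?(ltW dy)//; lra.
  rewrite -[I 1 y](@IB d) ?(ltW d1) ?(ltW y1)// -[in RHS](@IB d 1 1) ?(ltW d1)//; lra.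
have [||||h1 h2] := @continuous_FTC1_closed _ k d x (x + 1).
- by rewrite ltrDl.
- exact: cont_locint.
- exact: dx.
- exact: ck.
have e : 'D_1 (I d) x = k x by rewrite -derive1E.
have dI := DeriveDef h1 e.
by refine (der_eq (derB dI (der_cst _ _)) _); rewrite subr0.
Qed.

Lemma ftc2 f f' a b : a <= b -> (forall x, a <= x <= b -> is_derive x 1 f (f' x)) ->
  (forall x, a <= x <= b -> {for x, continuous f'}) ->
  \int[mu]_(x in `[a, b]) f' x = f b - f a.
Proof.
rewrite le_eqVlt => /predU1P[->|ab] df cf'.
  by rewrite set_itv1 Rintegral_set1 subrr.
rewrite /Rintegral (@continuous_FTC2 _ f' f a b ab)//.
- by apply: continuous_in_subspaceT => x; rewrite inE/= in_itv/= => /cf'.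
- split.
  + by move=> x; rewrite in_itv/= => /andP[/ltW ax /ltW xb]; have [] := df x; rewrite ?ax.
  + by apply: cvg_at_right_filter; apply: (der_cont (df a _)); rewrite lexx ltW.
  + by apply: cvg_at_left_filter; apply: (der_cont (df b _)); rewrite lexx ltW.
- move=> x; rewrite in_itv/= => /andP[/ltW ax /ltW xb].
  by have [_] := df x (introT andP (conj ax xb)); rewrite derive1E.
Qed.

Lemma restrict_supp g a b : 0 < a -> (forall x, ~~ (a <= x <= b) -> g x = 0) ->
  g \_ pos = g \_ `[a, b].
Proof.
move=> a0 gab; apply/funext => x; rewrite !patchE.
case: ifPn => [_|xP]; case: ifPn => [xab|xab] //.
- by apply: gab; move: xab; rewrite notin_setE/= in_itv/= => /negP.
- move: xP xab; rewrite notin_setE/= !in_itv/= andbT inE/= in_itv/= => h /andP[ax _].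
  by case: h; exact: lt_le_trans ax.
Qed.

Lemma Rint_supp g a b : 0 < a -> (forall x, ~~ (a <= x <= b) -> g x = 0) ->
  \int[mu]_(x in pos) g x = \int[mu]_(x in `[a, b]) g x.
Proof.
by move=> a0 gab; rewrite Rintegral_mkcond [RHS]Rintegral_mkcond (restrict_supp a0 gab).
Qed.

Lemma integrable_supp g a b : 0 < a -> (forall x, ~~ (a <= x <= b) -> g x = 0) ->
  mu.-integrable `[a, b] (EFin \o g) -> mu.-integrable pos (EFin \o g).
Proof.
move=> a0 gab ig; have mP : measurable (pos : set (measurableTypeR R)) by exact: measurable_itv.
have mab : measurable (`[a, b]%classic : set (measurableTypeR R)) by exact: measurable_itv.
apply: (@integrable_mkcond _ _ _ mu _ (EFin \o g) mP).2.
have := (@integrable_mkcond _ _ _ mu _ (EFin \o g) mab).1 ig.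
by rewrite !restrict_EFin (restrict_supp a0 gab).
Qed.

Lemma half_test_itv f g : half_test f -> half_test g -> exists a b,
  [/\ 0 < a, a < b, forall x, ~~ (a <= x <= b) -> f x = 0 &
      forall x, ~~ (a <= x <= b) -> g x = 0].
Proof.
move=> [_ [a [b [a0 ab fab]]]] [_ [c [d [c0 cd gcd]]]].
exists (Num.min a c), (Num.max b d); split.
- by rewrite lt_min a0.
- by rewrite gt_min lt_max ab.
- move=> x xabcd; apply: fab; apply: contra xabcd => /andP[ax xb].
  by rewrite ge_min le_max ax xb.
- move=> x xabcd; apply: gcd; apply: contra xabcd => /andP[ax xb].
  by rewrite ge_min le_max ax xb !orbT.
Qed.

Lemma half_test_cont f : half_test f -> continuous f.
Proof. by move=> [/smooth1_continuous]. Qed.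

Lemma locintM f g : locint f -> continuous g -> locint (fun x => f x * g x).
Proof.
move=> lf cg a b a0; have [ba|ab] := ltP b a.
  by rewrite set_itv_ge ?bnd_simp -?ltNge//; exact: integrable_set0.
have [|c _ gc] := @EVT_max _ (fun x => `|g x|) a b ab.
  apply: continuous_subspaceT => x; apply: continuous_comp; first exact: cg.
  exact: norm_continuous.
have mg : measurable_fun `[a, b] g.
  by apply: measurable_funTS; exact: continuous_measurable_fun.
apply: (@le_integrable _ _ _ mu `[a, b] _ _ (fun x => (`|g c|%:E * (f x)%:E)%E)) => //.
- apply/measurable_EFinP; apply: measurable_funM => //.
  apply/measurable_EFinP; exact: (measurable_int mu (lf a b a0)).
- move=> x xab /=; rewrite lee_fin !normrM normr_id mulrC ler_wpM2r//.
  exact: gc.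
- by apply: integrableZl => //; exact: lf.
Qed.

Lemma half_test_integrable f g : locint f -> half_test g ->
  mu.-integrable pos (EFin \o (fun x => f x * g x)).
Proof.
move=> lf hg; have [a [b [a0 ab gab _]]] := half_test_itv hg hg.
apply: (integrable_supp a0) => [x /gab ->|]; first by rewrite mulr0.
exact: (locintM lf (half_test_cont hg)).
Qed.

Definition pairing f g : R := \int[mu]_(x in pos) (f x * g x).

Lemma pairing_lin f g h (c : R) : locint f -> half_test g -> half_test h ->
  pairing f (fun x => g x + c * h x) = pairing f g + c * pairing f h.
Proof.
move=> lf hg hh; rewrite /pairing -RintegralZl//; last exact: half_test_integrable.
rewrite -RintegralD//.
- by apply: eq_Rintegral => x _; ring.
- exact: half_test_integrable.
- rewrite (_ : _ \o _ = EFin \o (fun x => f x * (c * h x))).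
    by apply: half_test_integrable => //; exact: half_testZ.
  by apply/funext => x /=; congr EFin; ring.
Qed.

Lemma pairingBl f g h : locint f -> locint g -> half_test h ->
  pairing (fun x => f x - g x) h = pairing f h - pairing g h.
Proof.
move=> lf lg hh; rewrite /pairing -RintegralB//; try exact: half_test_integrable.
by apply: eq_Rintegral => x _; ring.
Qed.

Lemma pairingZl f (c : R) h : locint f -> half_test h ->
  pairing (fun x => c * f x) h = c * pairing f h.
Proof.
move=> lf hh; rewrite /pairing -RintegralZl//; last exact: half_test_integrable.
by apply: eq_Rintegral => x _; ring.
Qed.

Lemma pairing_parts K k x x' : (forall r : R, 0 < r -> is_derive r 1 K (k r)) ->
  (forall r, 0 < r -> {for r, continuous k}) -> half_test x ->
  (forall r : R, is_derive r 1 x (x' r)) ->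
  pairing K x' = - pairing k x.
Proof.
move=> dK ck hx dx; have hx' := half_test_derive dx hx.
have [a [b [a0 ab xab x'ab]]] := half_test_itv hx hx'.
have lK : locint K by apply: cont_locint => r r0; exact: der_cont (dK r r0).
have lk : locint k by apply: cont_locint.
have e : \int[mu]_(r in `[a / 2, b + 1]) (k r * x r + K r * x' r) = 0.
  have ab' : a / 2 <= b + 1 by lra.
  have d (r : R) : a / 2 <= r <= b + 1 ->
      is_derive r 1 (fun r => K r * x r) (k r * x r + K r * x' r).
    move=> /andP[ar _]; have r0 : 0 < r by lra.
    exact: derM (dK r r0) (dx r).
  have c (r : R) : a / 2 <= r <= b + 1 ->
      {for r, continuous (fun r => k r * x r + K r * x' r)}.
    move=> /andP[ar _]; have r0 : 0 < r by lra.
    apply: continuousD; apply: continuousM.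
    + exact: ck.
    + exact: half_test_cont.
    + exact: der_cont (dK r r0).
    + exact: half_test_cont.
  rewrite (ftc2 ab' d c) !xab ?mulr0 ?subrr//.
    by rewrite negb_and -!ltNge; apply/orP; left; lra.
  by rewrite negb_and -!ltNge; apply/orP; right; lra.
apply/eqP; rewrite -subr_eq0 opprK addrC; apply/eqP; rewrite /pairing -RintegralD//;
  try exact: half_test_integrable.
rewrite -[RHS]e; apply: Rint_supp; first lra.
move=> r rab; rewrite xab ?x'ab ?mulr0 ?addr0//.
  by apply: contra rab => /andP[ar rb]; apply/andP; split; lra.
by apply: contra rab => /andP[ar rb]; apply/andP; split; lra.
Qed.

(** Applied to the weak form of a linear differential equation, this produces
    one constant of integration. *)
Lemma functional_multiple (L e : (R -> R) -> R) :
  (forall g h c, half_test g -> half_test h -> L (fun x => g x + c * h x) = L g + c * L h) ->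
  (forall g h c, half_test g -> half_test h -> e (fun x => g x + c * h x) = e g + c * e h) ->
  (forall g, half_test g -> e g = 0 -> L g = 0) ->
  exists c, forall g, half_test g -> L g = c * e g.
Proof.
move=> linL line ker; have [[h hh eh]|noh] := pselect (exists2 h, half_test h & e h != 0).
  exists (L h / e h) => g hg.
  have : L (fun x => g x + (- (e g / e h)) * h x) = 0.
    apply: ker; first by apply: half_testD => //; exact: half_testZ.
    by rewrite line// mulNr divfK// subrr.
  by rewrite linL// => /eqP; rewrite addr_eq0 => /eqP ->; field.
exists 0 => g hg; rewrite mul0r; apply: ker => //.
by apply/eqP; apply: contra_notT noh => eg; exists g.
Qed.

Lemma pairing_plateau_cvg f a b : locint f -> 0 < a -> a < b ->
  pairing f (plateau a b n) @[n --> \oo] --> \int[mu]_(x in `[a, b]) f x.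
Proof.
move=> lf a0 ab.
have mf : measurable_fun `[a, b] f by apply/measurable_EFinP; exact: (measurable_int mu (lf a b a0)).
have mb n : measurable_fun `[a, b] (plateau a b n : R -> R).
  by apply: measurable_funTS; apply: continuous_measurable_fun; exact: half_test_cont (plateau_test n a0 ab).
have fb n : pairing f (plateau a b n) = \int[mu]_(x in `[a, b]) (f x * plateau a b n x).
  rewrite /pairing (Rint_supp a0 (b := b))// => x xab; rewrite plateau_out ?mulr0//.
  by apply: contra xab => /andP[ax xb]; rewrite !ltW.
rewrite (_ : (fun n => _) = fun n => \int[mu]_(x in `[a, b]) (f x * plateau a b n x)); last exact/funext.
have mfE : measurable_fun `[a, b] (fun x => (f x * \1_`]a, b[ x)%:E).
  by apply/measurable_EFinP; apply: measurable_funM => //; exact: measurable_indic.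
have mnE n : measurable_fun `[a, b] (fun x => (f x * plateau a b n x)%:E).
  by apply/measurable_EFinP; apply: measurable_funM.
have cE : {ae mu, forall x, `[a, b]%classic x ->
    (f x * plateau a b n x)%:E @[n --> \oo] --> (f x * \1_`]a, b[ x)%:E}.
  apply: aeW => x _; apply: cvg_EFin; first by apply: nearW.
  by apply: cvgMr; exact: plateau_cvg.
have iE : mu.-integrable `[a, b] (fun x => `|f x|%:E).
  exact: (integrable_abse (lf a b a0)).
have bE : {ae mu, forall x n, `[a, b]%classic x ->
    (`|(f x * plateau a b n x)%:E| <= `|f x|%:E)%E}.
  apply: aeW => x n _; rewrite /= lee_fin normrM ler_piMr//.
  by rewrite ger0_norm ?plateau_ge0 ?plateau_le1.
have [i1 _ i3] := @dominated_convergence _ _ R mu `[a, b] (measurable_itv _)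
  _ _ _ mnE mfE cE iE bE.
have oc : `]a, b[%classic `<=` `[a, b]%classic.
  by move=> x; rewrite /= !in_itv/= => /andP[ax xb]; rewrite !ltW.
have e1 : \int[mu]_(x in `[a, b]) (f x * \1_`]a, b[ x) = \int[mu]_(x in `[a, b]) f x.
  transitivity (\int[mu]_(x in `]a, b[) f x).
    rewrite -[in RHS](setIidr oc) Rintegral_mkcondr; apply: eq_Rintegral => x _.
    by rewrite patchE indicE; case: ifPn; rewrite ?mulr1 ?mulr0.
  rewrite Rintegral_itv_bndo_bndc; last first.
    by apply: integrableS (lf a b a0) => //.
  rewrite Rintegral_itv_obnd_cbnd//.
  apply: integrableS (lf a b a0) => //.
  by move=> x; rewrite /= !in_itv/= => /andP[/ltW-> ->].
have e2 : (\int[mu]_(x in `[a, b]) (f x * \1_`]a, b[ x)%:E =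
    (\int[mu]_(x in `[a, b]) f x)%:E)%E.
  by rewrite -e1 /Rintegral fineK//; exact: integrable_fin_num.
rewrite e2 in i3; exact: fine_cvg i3.
Qed.

(** Lebesgue differentiation of the primitive of f restricted to [1/n, n]. *)
Lemma zero_itv_ae f : locint f ->
  (forall a b, 0 < a -> a < b -> \int[mu]_(x in `[a, b]) f x = 0) ->
  {ae mu, forall x, 0 < x -> f x = 0}.
Proof.
move=> lf f0.
have step n : {ae mu, forall x, n.+1%:R^-1 < x < n.+1%:R -> f x = 0}.
  pose a : R := n.+1%:R^-1; pose b : R := n.+1%:R.
  have a0 : 0 < a by rewrite invr_gt0 ltr0n.
  pose g := f \_ `[a, b].
  have ig : mu.-integrable setT (EFin \o g).
    have mab : measurable (`[a, b]%classic : set (measurableTypeR R)) by exact: measurable_itv.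
    have := (@integrable_mkcond _ _ _ mu _ (EFin \o f) mab).1 (lf a b a0).
    by rewrite restrict_EFin.
  have igx y : mu.-integrable `]-oo, y] (EFin \o g) by exact: integrableS ig.
  have lg : locally_integrable setT g by apply: open_integrable_locally => //; exact: openT.
  have G0 y : \int[mu]_(t in `]-oo, y]) g t = 0.
    rewrite /g -Rintegral_mkcondr.
    have [ya|ay] := ltP y a.
      rewrite (_ : _ `&` _ = set0) ?Rintegral_set0//.
      apply/seteqP; split => // x []; rewrite /= !in_itv/= => xy /andP[ax _].
      by move: (le_lt_trans xy ya); rewrite ltNge ax.
    rewrite (_ : _ `&` _ = `[a, Num.min b y]%classic); last first.
      apply/seteqP; split => x; rewrite /= !in_itv/= le_min.
        by move=> [-> /andP[-> ->]].
      by move=> /andP[-> /andP[-> ->]].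
    have : a <= Num.min b y.
      by rewrite le_min ay andbT /a /b (@le_trans _ _ 1)// ?invf_le1 ?ler1n ?ltr0n.
    rewrite le_eqVlt => /predU1P[<-|]; first by rewrite set_itv1 Rintegral_set1.
    exact: f0.
  have := FTC1Ny igx lg; apply: filterS; first exact: (ae_filter_ringOfSetsType mu).
  move=> x [_ hx] /andP[ax xb].
  move: hx; under eq_fun do rewrite G0.
  rewrite derive1_cst /g patchE mem_set//.
  by rewrite /= in_itv/= !ltW.
apply: ae_mono (ae_foralln step) => x h x0.
pose n := (Num.truncn (Num.max x x^-1)).
apply: (h n).
have : Num.max x x^-1 < n.+1%:R by exact: truncnS_gt.
rewrite gt_max => /andP[-> h2]; rewrite andbT.
by rewrite -[ltRHS]invrK ltf_pV2 ?posrE ?invr_gt0// ltr0n.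
Qed.

(** The fundamental lemma of the calculus of variations on ]0, +oo[. *)
Lemma fundamental_lemma f : locint f -> (forall g, half_test g -> pairing f g = 0) ->
  {ae mu, forall x, 0 < x -> f x = 0}.
Proof.
move=> lf f0; apply: zero_itv_ae => // a b a0 ab.
have := pairing_plateau_cvg lf a0 ab.
rewrite (_ : (fun n => _) = cst 0); last by apply/funext => n; rewrite f0//; exact: plateau_test.
by move/cvg_lim => <- //; rewrite lim_cst.
Qed.

(** The primitive that vanishes near infinity is smooth, and constant rather
    than zero near the origin, which is what a radial test function needs. *)
Lemma half_test_primitive g : half_test g ->
  exists G, [/\ forall x : R, is_derive x 1 G (g x), smooth1 G,
    exists2 a, 0 < a & forall x, x <= a -> G x = G 0 &
    exists b, forall x, b <= x -> G x = 0].
Proof.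
move=> hg; have [sg [a [b [a0 ab gab]]]] := hg.
have [K dK] := pos_primitive (fun x _ => half_test_cont hg (x := x)).
have d0 (x y : R) : 0 < x -> x <= y -> (forall z, x < z < y -> g z = 0) -> K x = K y.
  move=> x0 xy g0; apply/eqP; rewrite eq_le; apply/andP; split.
    apply: (@der_ge0_le _ K g x y xy) => [z /andP[xz _]|z /g0 ->//].
    by apply: dK; exact: lt_le_trans xz.
  rewrite -lerN2; apply: (@der_ge0_le _ (fun z => - K z) (fun z => - g z) x y xy).
    by move=> z /andP[xz _]; apply: derN; apply: dK; exact: lt_le_trans xz.
  by move=> z /g0 ->; rewrite oppr0.
have Ka x : 0 < x -> x <= a -> K x = K a.
  move=> x0 xa; apply: d0 => // z /andP[_ za]; apply: gab.
  by rewrite negb_and -!ltNge za.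
have Kb x : b <= x -> K x = K b.
  move=> bx; apply/esym/d0 => //; first by exact: lt_trans ab.
  by move=> z /andP[bz _]; apply: gab; rewrite negb_and -!ltNge bz orbT.
pose G x := K (Num.max x (a / 2)) - K b.
have dG (x : R) : is_derive x 1 G (g x).
  have [xa|ax] := ltP x a.
    rewrite gab; last by rewrite negb_and -!ltNge xa.
    apply: der_ext (der_cst (K a - K b) x).
    apply: filterS (lt_nbhsl xa) => y ya; rewrite /G (Ka (Num.max y _))//.
      by rewrite lt_max (divr_gt0 a0) ?orbT.
    by rewrite ge_max (ltW ya)/=; lra.
  have x0 : 0 < x by exact: lt_le_trans ax.
  apply: (@der_ext _ (fun y => K y - K b)).
    have h : a / 2 < x by lra.
    by apply: filterS (lt_nbhsr h) => y ya; rewrite /G max_l// ltW.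
  by refine (der_eq (derB (dK x x0) (der_cst _ x)) _); rewrite subr0.
exists G; split => //.
- exact: smooth1_primitive dG sg.
- exists (a / 2); first by rewrite divr_gt0.
  by move=> x xa; rewrite /G !max_r// ltW// divr_gt0.
- exists b => x bx; rewrite /G max_l ?Kb ?subrr//; lra.
Qed.


End half_line.

Section du_bois_reymond.
Context {R : realType}.
Local Notation mu := (@lebesgue_measure R).
Local Notation pos := (`]0, +oo[%classic : set R).
Implicit Types f g G : R -> R.

Lemma half_test_zero_mean g : half_test g -> pairing (fun=> 1) g = 0 ->
  exists2 G, half_test G & forall x : R, is_derive x 1 G (g x).
Proof.
move=> hg g0; have [G [dG sG [a a0 Ga] [b Gb]]] := half_test_primitive hg.
have [c [d [c0 cd gcd _]]] := half_test_itv hg hg.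
pose m := Num.min a c / 2; pose M := Num.max b d + 1.
have ma : 0 < m by rewrite divr_gt0// lt_min a0.
have mlt : m < Num.min a c by rewrite /m; have : 0 < Num.min a c by [rewrite lt_min a0]; lra.
have [mla mlc] : m < a /\ m < c by apply/andP; rewrite -lt_min.
have Mgt : Num.max b d < M by rewrite /M ltrDl.
have [Mb Md] : b < M /\ d < M by apply/andP; rewrite -gt_max.
have G0 : G 0 = 0.
  have : \int[mu]_(x in `[m, M]) g x = 0.
    rewrite -[RHS]g0 /pairing (Rint_supp (a := m) (b := M))//.
      by apply: eq_Rintegral => x _; rewrite mul1r.
    move=> x xn; rewrite mul1r gcd//; apply: contra xn => /andP[? ?]; apply/andP; split; lra.
  have mM : m <= M by lra.
  rewrite (ftc2 mM (fun x _ => dG x) (fun x _ => half_test_cont hg (x := x))).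
  by rewrite (Ga m) ?(ltW mla)// Gb ?(ltW Mb)// => /eqP; rewrite sub0r oppr_eq0 => /eqP.
exists G => //; split => //; exists m, M; split => //; first lra.
move=> x; rewrite negb_and -!ltNge => /orP[xm|Mx].
  by rewrite Ga// ltW// (lt_trans xm).
by rewrite Gb// ltW// (lt_trans Mb).
Qed.

Lemma locint_cst (c : R) : locint (fun=> c).
Proof. by apply: cont_locint => x _; exact: cst_continuous. Qed.

(** The constant comes out as a multiple of the mean value, the functional whose
    kernel is the set of derivatives of test functions. *)
Lemma du_bois_reymond f : locint f ->
  (forall x (x' : R -> R), half_test x -> (forall r : R, is_derive r 1 x (x' r)) ->
    pairing f x' = 0) ->
  exists c, forall g, half_test g -> pairing f g = c * pairing (fun=> 1) g.
Proof.
move=> lf f0; apply: functional_multiple.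
- by move=> g h c hg hh; rewrite pairing_lin.
- by move=> g h c hg hh; rewrite pairing_lin//; exact: locint_cst.
- by move=> g hg /(half_test_zero_mean hg)[G hG dG]; exact: f0 dG.
Qed.

Lemma half_test_der G (x : R) : half_test G -> is_derive x 1 G ('D_1 G x).
Proof. by move=> [/smooth1_derive[g dg _] _]; have [? _] := dg x; exact: DeriveDef. Qed.

(** The weak form of (f' r^(-k))' = 0. Differentiation of test functions
    reduces it to du_bois_reymond: modulo a multiple of r^(k+1), f annihilates
    all derivatives. *)
Lemma du_bois_reymond2 k f : locint f ->
  (forall x (x' xi : R -> R), half_test x -> (forall r : R, is_derive r 1 x (x' r)) ->
    (forall r : R, is_derive r 1 (fun r => x' r / r ^+ k) (xi r)) -> pairing f xi = 0) ->
  exists a b, forall g, half_test g -> pairing f g = pairing (fun r => a + b * r ^+ k.+1) g.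
Proof.
move=> lf f0; pose M G := pairing f ('D_1 G).
have cX n : locint (fun r : R => r ^+ n).
  by apply: cont_locint => x _; exact: exprn_continuous.
have hD G : half_test G -> half_test ('D_1 G : R -> R).
  by move=> hG; apply: half_test_derive (hG) => x; exact: half_test_der.
have [|||c Mc] := @functional_multiple _ M (pairing (fun r => r ^+ k)).
- move=> g h c hg hh; rewrite /M -pairing_lin//; [|exact: hD|exact: hD].
  apply: eq_Rintegral => x _; congr (_ * _).
  by have [_] := derD (half_test_der x hg) (derZ c (half_test_der x hh)).
- by move=> g h c hg hh; rewrite pairing_lin.
- move=> g hg gk; have hk := half_test_mulX k hg.
  have [|chi hchi dchi] := half_test_zero_mean hk.
    by rewrite -[RHS]gk; apply: eq_Rintegral => x _; rewrite mul1r.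
  apply: f0 hchi dchi _ => r; rewrite (_ : (fun r => _) = g); first exact: half_test_der.
  apply/funext => x; have [->|x0] := eqVneq x 0; last by rewrite mulrC mulKf// expf_neq0.
  have [a [b [a0 _ gab _]]] := half_test_itv hg hg.
  by rewrite gab ?mulr0 ?mul0r// negb_and -ltNge a0.
pose p r : R := - (c / k.+1%:R) * r ^+ k.+1.
have lp : locint p.
  by apply: cont_locint => x _; apply: continuousM; [exact: cst_continuous|exact: exprn_continuous].
have [|x x' hx dx|a fa] := @du_bois_reymond (fun r => f r - p r).
- by move=> u v u0; rewrite (_ : _ \o _ = (fun x => (f x)%:E - (p x)%:E)%E)//;
    apply: integrableB => //; [exact: lf|exact: lp].
- have hx' := half_test_derive dx hx.
  rewrite pairingBl//; have -> : pairing f x' = M x.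
    by apply: eq_Rintegral => r _; have [_ <-] := dx r.
  have dp (r : R) : 0 < r -> is_derive r 1 p (- c * r ^+ k).
    by move=> _; refine (der_eq (derZ _ (der_pow k r)) _); field.
  rewrite Mc// (pairing_parts dp _ hx dx).
    rewrite (@pairingZl _ (fun r => r ^+ k))//; ring.
  by move=> r _; apply: continuousM; [exact: cst_continuous|exact: exprn_continuous].
exists a, (- (c / k.+1%:R)) => g hg.
have := fa g hg; rewrite pairingBl// => /eqP; rewrite subr_eq => /eqP ->.
rewrite -pairingZl//; last exact: locint_cst.
rewrite /pairing -RintegralD//.
- by apply: eq_Rintegral => x _; rewrite /p; ring.
- by apply: half_test_integrable => //; exact: locint_cst.
- exact: half_test_integrable.
Qed.

Lemma continuous_pairing0 f : (forall x, 0 < x -> {for x, continuous f}) ->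
  (forall g, half_test g -> pairing f g = 0) -> forall x, 0 < x -> f x = 0.
Proof.
move=> cf f0 x x0; have [K dK] := pos_primitive cf.
have lf : locint f by exact: cont_locint.
have K0 a b : 0 < a -> a < b -> K b = K a.
  move=> a0 ab; have p0 y : a <= y <= b -> 0 < y by move=> /andP[ay _]; exact: lt_le_trans ay.
  have := ftc2 (ltW ab) (fun y yab => dK y (p0 y yab)) (fun y yab => cf y (p0 y yab)).
  suff -> : \int[mu]_(y in `[a, b]) f y = 0 by move/esym/eqP; rewrite subr_eq0 => /eqP.
  have := pairing_plateau_cvg lf a0 ab.
  rewrite (_ : (fun n => _) = cst 0); last by apply/funext => n; rewrite f0//; exact: plateau_test.
  by move/cvg_lim => <- //; rewrite lim_cst.
have [_ <-] := dK x x0; have [_] : is_derive x 1 K 0; last by [].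
have x2 : 0 < x / 2 by lra.
apply: der_ext (der_cst (K (x / 2)) x).
have h : x / 2 < x by lra.
by apply: filterS (lt_nbhsr h) => y xy; rewrite (K0 (x / 2)).
Qed.

End du_bois_reymond.

(** * Radial test functions *)

Section euclidean_norm.
Context {R : realType} {N : nat}.
Implicit Types (x y : 'rV[R]_N) (f : 'rV[R]_N -> R).

Lemma sum_sqr_ge0 x : 0 <= \sum_i x ord0 i ^+ 2.
Proof. by apply: sumr_ge0 => i _; exact: sqr_ge0. Qed.

Lemma enorm_ge0 x : 0 <= enorm x.
Proof. exact: sqrtr_ge0. Qed.

Lemma sqr_enorm x : enorm x ^+ 2 = \sum_i x ord0 i ^+ 2.
Proof. by rewrite sqr_sqrtr// sum_sqr_ge0. Qed.

Lemma coord_le_enorm x i : `|x ord0 i| <= enorm x.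
Proof.
rewrite -(@ler_pXn2r _ 2) ?nnegrE ?enorm_ge0// sqr_enorm (bigD1 i)//= real_normK ?num_real//.
by rewrite lerDl sumr_ge0// => j _; exact: sqr_ge0.
Qed.

Lemma enorm_continuous : continuous (@enorm R N).
Proof.
move=> x; apply: continuous_comp; last exact: sqrt_continuous.
have c i : continuous (fun y : 'rV[R]_N => y ord0 i ^+ 2).
  move=> y; apply: (@continuous_comp _ _ _ (fun y : 'rV[R]_N => y ord0 i) (fun z : R => z ^+ 2)).
    exact: coord_continuous.
  exact: exprn_continuous.
apply: continuous_big => [|i _]; [exact: add_continuous|exact: c].
Qed.

Lemma measurable_enorm : measurable_fun setT (@enorm R N).
Proof.
rewrite /enorm (_ : (fun x => _) = Num.sqrt \o (fun x : 'rV[R]_N => \sum_i rV_coord i x ^+ 2))//.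
apply: measurableT_comp; first by apply: continuous_measurable_fun; exact: sqrt_continuous.
apply: measurable_sum => i; apply: measurable_funX; exact: measurable_rV_coord.
Qed.

Lemma is_derive_line f x v d : is_derive (0 : R) (1 : R) (fun h : R => f (h *: v + x)) d ->
  is_derive x v f d.
Proof.
move=> [df <-]; apply: DeriveDef; first exact/derivable1P.
rewrite /derive; set g1 := fun h => h^-1 *: _; set g2 := fun h => h^-1 *: _.
suff -> : g1 = g2 by [].
by rewrite funeqE /g1 /g2 => h /=; rewrite addr0 scale0r add0r [_%:A]mulr1.
Qed.

Local Notation e i := (delta_mx ord0 i : 'rV[R]_N).

Lemma line_coord x i j (h : R) : (h *: e i + x) ord0 j = h * (j == i)%:R + x ord0 j.
Proof. by rewrite !mxE eqxx. Qed.

Lemma sqr_enorm_line x i (h : R) :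
  \sum_j (h *: e i + x) ord0 j ^+ 2 = enorm x ^+ 2 + h * (2 * x ord0 i) + h ^+ 2.
Proof.
rewrite sqr_enorm (bigD1 i)//= [in RHS](bigD1 i)//= line_coord eqxx mulr1.
rewrite [in LHS](eq_bigr (fun j => x ord0 j ^+ 2)); first by ring.
by move=> j ji; rewrite line_coord (negbTE ji) mulr0 add0r.
Qed.

Lemma is_derive_coord x i j : is_derive x (e i) (fun y : 'rV[R]_N => y ord0 j) (j == i)%:R.
Proof.
apply: is_derive_line; rewrite (_ : (fun h => _) = fun h => h * (j == i)%:R + x ord0 j).
  refine (der_eq (derD (derM (der_id 0) (der_cst _ 0)) (der_cst _ 0)) _); ring.
by apply/funext => h; exact: line_coord.
Qed.

Lemma is_derive_enorm x i : 0 < enorm x ->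
  is_derive x (e i) (@enorm R N) (x ord0 i / enorm x).
Proof.
move=> x0; apply: is_derive_line.
rewrite /enorm (_ : (fun h => _) =
    fun h => Num.sqrt (enorm x ^+ 2 + h * (2 * x ord0 i) + h * h)); last first.
  by apply/funext => h; rewrite sqr_enorm_line -expr2.
have d : is_derive (0 : R) (1 : R) (fun h : R => enorm x ^+ 2 + h * (2 * x ord0 i) + h * h)
    (2 * x ord0 i).
  refine (der_eq (derD (derD (der_cst _ 0) (derM (der_id 0) (der_cst _ 0))) (derM (der_id 0) (der_id 0))) _).
  by ring.
set q := (fun h : R => _ : R) in d *.
have q0 : q 0 = enorm x ^+ 2 by rewrite /q; ring.
have s : is_derive (q 0) 1 Num.sqrt (2 * Num.sqrt (q 0))^-1.
  by apply: is_derive1_sqrt; rewrite q0 exprn_gt0.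
refine (der_eq (der_comp d s) _).
by rewrite q0 sqrtr_sqr ger0_norm ?enorm_ge0// -/(enorm x); field; rewrite gt_eqF.
Qed.

Lemma is_derive_radial (g g' : R -> R) (a : R) x i : 0 < a ->
  (forall r, r < a -> g r = 0) -> (forall r : R, is_derive r 1 g (g' r)) ->
  is_derive x (e i) (fun y => g (enorm y)) (g' (enorm x) / enorm x * x ord0 i).
Proof.
move=> a0 g0 dg; have [xa|ax] := ltP (enorm x) a.
  have -> : g' (enorm x) = 0.
    have [_ <-] := dg (enorm x); have [_] : is_derive (enorm x) 1 g 0; last by [].
    apply: der_ext (der_cst 0 _).
    by apply: filterS (lt_nbhsl xa) => y ya; rewrite g0.
  rewrite !mul0r.
  have ya : \forall y \near x, enorm y < a by exact: (cvgr_lt (enorm x) (@enorm_continuous x) _ xa).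
  have e0 : \forall y \near x, cst 0 y = g (enorm y) by apply: filterS ya => y ya; rewrite /= g0.
  exact: near_eq_is_derive e0 (is_derive_cst _ _ _).
have x0 : 0 < enorm x by exact: lt_le_trans ax.
have dl : is_derive (0 : R) (1 : R) (fun h : R => enorm (h *: e i + x)) (x ord0 i / enorm x).
  have [dn en] := is_derive_enorm i x0.
  apply: DeriveDef; first exact: ((derivable1P _ _ _).1 dn).
  rewrite -[RHS]en /derive; set g1 := fun h => h^-1 *: _; set g2 := fun h => h^-1 *: _.
  suff -> : g1 = g2 by [].
  by rewrite funeqE /g1 /g2 => h /=; rewrite addr0 scale0r add0r [_%:A]mulr1.
apply: is_derive_line; have dc := der_comp dl (dg _).
refine (der_eq dc _); rewrite scale0r add0r; field; by rewrite gt_eqF.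
Qed.

(** Smoothness in several variables involves all iterated partial derivatives;
    a family that is closed under them reduces it to one differentiation. The
    profiles vanish near 0, where |x| is not differentiable; constants restore
    the radial functions that are merely constant there. *)
Inductive radial_poly : ('rV[R]_N -> R) -> Prop :=
| rp_cst (c : R) : radial_poly (fun=> c)
| rp_coord i : radial_poly (fun x => x ord0 i)
| rp_add f1 f2 : radial_poly f1 -> radial_poly f2 -> radial_poly (fun x => f1 x + f2 x)
| rp_mul f1 f2 : radial_poly f1 -> radial_poly f2 -> radial_poly (fun x => f1 x * f2 x)
| rp_radial (g : R -> R) (a : R) : 0 < a -> (forall r, r < a -> g r = 0) -> smooth1 g ->
    radial_poly (fun x => g (enorm x)).

Lemma radial_poly_continuous f : radial_poly f -> continuous f.
Proof.
elim=> [c|i|f1 f2 _ c1 _ c2|f1 f2 _ c1 _ c2|g a a0 g0 sg] x.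
- exact: cst_continuous.
- exact: coord_continuous.
- exact: (cvgD (c1 x) (c2 x)).
- exact: (cvgM (c1 x) (c2 x)).
- by apply: continuous_comp; [exact: enorm_continuous|exact: smooth1_continuous].
Qed.

Lemma radial_poly_derive f i : radial_poly f ->
  exists2 f', forall x, is_derive x (e i) f (f' x) & radial_poly f'.
Proof.
elim=> [c|j|f1 f2 r1 [f1' d1 r1'] r2 [f2' d2 r2']|f1 f2 r1 [f1' d1 r1'] r2 [f2' d2 r2']|g a a0 g0 sg].
- exists (fun=> 0) => [x|]; [exact: is_derive_cst|exact: rp_cst].
- exists (fun=> (j == i)%:R) => [x|]; [exact: is_derive_coord|exact: rp_cst].
- exists (fun x => f1' x + f2' x) => [x|]; last exact: rp_add.
  exact: (is_deriveD (d1 x) (d2 x)).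
- exists (fun x => f1 x * f2' x + f2 x * f1' x) => [x|].
    exact: (is_deriveM (d1 x) (d2 x)).
  by apply: rp_add; exact: rp_mul.
- have [g' dg sg'] := smooth1_derive sg.
  exists (fun x => g' (enorm x) / enorm x * x ord0 i) => [x|].
    exact: is_derive_radial a0 g0 dg.
  apply: rp_mul; last exact: rp_coord.
  have g'0 r : r < a -> g' r = 0.
    move=> ra; have [_ <-] := dg r; have [_] : is_derive r 1 g 0; last by [].
    by apply: der_ext (der_cst 0 r); apply: filterS (lt_nbhsl ra) => y ya; rewrite g0.
  apply: (@rp_radial (fun r => g' r / r) a a0).
    by move=> r ra; rewrite g'0// mul0r.
  by move=> k; exact: diffn_div_id a0 g'0 (sg' k).
Qed.

Lemma partialE f f' i : (forall x, is_derive x (e i) f (f' x)) -> partial i f = f'.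
Proof. by move=> df; apply/funext => x; have [_] := df x. Qed.

Lemma radial_poly_partial f i : radial_poly f -> radial_poly (partial i f).
Proof. by move=> /(radial_poly_derive i)[f' /partialE ->]. Qed.

Lemma radial_poly_smooth f : radial_poly f -> smooth f.
Proof.
move=> rf s; have rs : radial_poly (iter_partial s f).
  by elim: s => //= i s IH; exact: radial_poly_partial.
split; first exact: radial_poly_continuous.
by move=> i x; have [f' df _] := radial_poly_derive i rs; have [] := df x.
Qed.

Lemma closed_ball_compact (b : R) : compact [set x : 'rV[R]_N | forall i, `|x ord0 i| <= b].
Proof.
have := @rV_compact R N (fun _ => `[- b, b]%classic) (fun _ => @segment_compact _ _ _).
by congr compact; apply/seteqP; split => x /= h i; have := h i; rewrite in_itv/= ler_norml.
Qed.

Lemma radial_poly_test f (b : R) : radial_poly f -> (forall x, b <= enorm x -> f x = 0) ->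
  test_function f.
Proof.
move=> rf fb; split; first exact: radial_poly_smooth.
have cb := @closed_ball_compact b.
apply: (subclosed_compact (@topology_structure.closed_closure _ _) cb).
have clb : closed [set x : 'rV[R]_N | forall i, `|x ord0 i| <= b].
  by apply: compact_closed cb; exact: norm_hausdorff.
rewrite [X in _ `<=` X]((topology_structure.closure_id _).1 clb).
apply: topology_structure.closure_subset => x /= fx i.
apply: le_trans (coord_le_enorm x i) _; rewrite leNgt; apply/negP => bx.
by move/eqP: fx; apply; apply: fb; exact: ltW.
Qed.

Lemma radial_poly_measurable f : radial_poly f -> measurable_fun setT f.
Proof.
elim=> [c|i|f1 f2 _ m1 _ m2|f1 f2 _ m1 _ m2|g a a0 g0 sg].
- exact: measurable_cst.
- exact: measurable_rV_coord.
- exact: measurable_funD.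
- exact: measurable_funM.
- apply: (measurableT_comp (f := g)); last exact: measurable_enorm.
  exact: continuous_measurable_fun (smooth1_continuous sg).
Qed.

(** The margin 1 leaves out the sphere of radius b, near which f need not
    vanish. *)
Lemma partial_support f (b : R) i : (forall x, b <= enorm x -> f x = 0) ->
  forall x, b + 1 <= enorm x -> partial i f x = 0.
Proof.
move=> fb x bx; have xb : b < enorm x by lra.
have yb : \forall y \near x, b < enorm y by exact: (cvgr_gt (enorm x) (@enorm_continuous x) _ xb).
have e0 : \forall y \near x, cst 0 y = f y by apply: filterS yb => y yb; rewrite /= fb// ltW.
by have [_] := near_eq_is_derive e0 (is_derive_cst (0 : R) x (e i)).
Qed.

Lemma radial_poly_bounded f (b : R) : radial_poly f -> (forall x, b <= enorm x -> f x = 0) ->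
  exists B, forall x, `|f x| <= B.
Proof.
move=> rf fb; have cb := @closed_ball_compact `|b|.
have [||c _ fc] := @EVT_max_rV _ _ (fun x => `|f x|) _ _ cb.
- by exists 0 => i; rewrite mxE normr0.
- apply: continuous_subspaceT => x; apply: continuous_comp; first exact: radial_poly_continuous.
  exact: norm_continuous.
exists `|f c| => x; have [bx|xb] := leP b (enorm x); first by rewrite fb// normr0.
apply: fc; rewrite inE /= => i; apply: le_trans (coord_le_enorm x i) _.
by apply: le_trans (ltW xb) (ler_norm _).
Qed.

End euclidean_norm.

Section radial_test_functions.
Context {R : realType} (k : nat).
Local Notation N := k.+1.
Local Notation e i := (delta_mx ord0 i : 'rV[R]_N).

Lemma half_test_radial (g : R -> R) : half_test g ->
  @radial_poly R N (fun x => g (enorm x)).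
Proof.
move=> [sg [a [b [a0 ab gab]]]]; apply: (@rp_radial _ _ g a) => // r ra.
by apply: gab; rewrite negb_and -!ltNge ra.
Qed.


(** The radial function theta(|x|) whose flux r^k theta'(r) through the sphere of
    radius r is a given test function chi of the half-line: by the divergence
    theorem its Laplacian is r^(-k) chi'(r). *)
Lemma radial_potential (chi chi' : R -> R) : half_test chi ->
  (forall r : R, is_derive r 1 chi (chi' r)) ->
  exists theta b,
    [/\ forall r : R, is_derive r 1 theta (chi r / r ^+ k),
        forall r, b <= r -> theta r = 0,
        @radial_poly R N (fun x => theta (enorm x)),
        forall i, partial i (fun x : 'rV[R]_N => theta (enorm x)) =
          (fun x => chi (enorm x) / enorm x ^+ N * x ord0 i) &
        laplacian (fun x : 'rV[R]_N => theta (enorm x)) =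
          (fun x => chi' (enorm x) / enorm x ^+ k)].
Proof.
move=> hchi dchi; have hpsi := half_test_divX k hchi.
have [theta [dtheta stheta [a a0 ta] [b tb]]] := half_test_primitive hpsi.
pose ph := fun x : 'rV[R]_N => theta (enorm x).
have hrp : radial_poly ph.
  have -> : ph = fun x => theta 0 + (theta (enorm x) - theta 0).
    by apply/funext => x; rewrite /ph; lra.
  apply: rp_add; first exact: rp_cst.
  apply: (@rp_radial _ _ (fun r => theta r - theta 0) a) => //.
    by move=> r ra; rewrite ta ?subrr// ltW.
  move=> j; apply: diffnD; [exact: stheta|exact: diffn_cst].
have dph i x : is_derive x (e i) ph (chi (enorm x) / enorm x ^+ N * x ord0 i).
  have d0 (r : R) : is_derive r 1 (fun r => theta r - theta 0) (chi r / r ^+ k).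
    by refine (der_eq (derB (dtheta r) (der_cst _ r)) _); rewrite subr0.
  have g0 r : r < a -> theta r - theta 0 = 0 by move=> ra; rewrite ta ?subrr// ltW.
  have h : is_derive x (e i) (fun y => theta 0 + (theta (enorm y) - theta 0))
      (0 + chi (enorm x) / enorm x ^+ k / enorm x * x ord0 i).
    exact: (is_deriveD (is_derive_cst (theta 0 : R) x (e i)) (is_derive_radial x i a0 g0 d0)).
  rewrite (_ : (fun y => _) = ph) in h; last by apply/funext => y; rewrite /ph; lra.
  by move: h; rewrite add0r exprSr invfM mulrA.
have pph i := partialE (dph i).
exists theta, b; split => //.
apply/funext => x; rewrite /laplacian.
have hg := half_test_divX N hchi; set g := fun r => _ in hg.
have [g' dg _] := smooth1_derive hg.1.
have [_ [c [d [c0 cd gcd]]]] := hg.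
have gc r : r < c -> g r = 0 by move=> rc; apply: gcd; rewrite negb_and -!ltNge rc.
have dpp i y : is_derive y (e i) (partial i ph)
    (g' (enorm y) / enorm y * y ord0 i * y ord0 i + g (enorm y)).
  rewrite pph.
  have h : is_derive y (e i) (fun y => g (enorm y) * y ord0 i)
      (g (enorm y) *: (i == i)%:R + y ord0 i *: (g' (enorm y) / enorm y * y ord0 i)).
    exact: (is_deriveM (is_derive_radial y i c0 gc dg) (is_derive_coord y i i)).
  move: h; rewrite eqxx /GRing.scale/= mulr1 addrC [_ * (_ * _)]mulrC; exact.
under eq_bigr => i _ do rewrite (partialE (dpp i)).
rewrite big_split/= sumr_const card_ord.
under eq_bigr => i _ do rewrite -mulrA -expr2.
rewrite -mulr_sumr -sqr_enorm.
have [x0|x0] := ltP 0 (enorm x); last first.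
  have x00 : enorm x = 0 by apply/eqP; rewrite eq_le x0 enorm_ge0.
  have [_ [p [q [p0 pq chi0]]]] := half_test_derive dchi hchi.
  by rewrite x00 gc// chi0 ?mul0rn ?expr0n ?mulr0 ?mul0r ?addr0// negb_and -!ltNge p0.
have xn : enorm x != 0 by rewrite gt_eqF.
have xN : enorm x ^+ N != 0 by rewrite expf_eq0/=.
have -> : g' (enorm x) = chi' (enorm x) / enorm x ^+ N +
    chi (enorm x) * - (N%:R * enorm x ^+ k / (enorm x ^+ N) ^+ 2).
  have [_ <-] := dg (enorm x).
  have dV := @derV R (fun r => r ^+ N) (enorm x) _ xN (der_pow k (enorm x)).
  by have [_ <-] := derM (dchi (enorm x)) dV.
rewrite /g -mulr_natl !exprS; field.
by rewrite xn expf_neq0.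
Qed.

End radial_test_functions.

(** * Integration in polar coordinates *)

Section density_measure.
Local Open Scope ereal_scope.
Context d (T : measurableType d) (R : realType) (mu : {measure set T -> \bar R}).
Variable rho : T -> R.
Hypothesis mrho : measurable_fun setT rho.
Hypothesis rho0 : forall x, (0 <= rho x)%R.

Let rhoE0 x : 0 <= (rho x)%:E.
Proof. by rewrite lee_fin. Qed.

Let mrhoE : measurable_fun setT (EFin \o rho).
Proof. exact/measurable_EFinP. Qed.

(** The proofs are arguments in order that the measure structure can be inferred
    from the term. *)
Definition density (_ : measurable_fun setT rho) (_ : forall x, (0 <= rho x)%R)
    (A : set T) : \bar R := \int[mu]_(x in A) (rho x)%:E.

Let density0 : density mrho rho0 set0 = 0.
Proof. by rewrite /density integral_set0. Qed.

Let density_ge0 A : 0 <= density mrho rho0 A.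
Proof. exact: integral_ge0. Qed.

Let density_sigma_additive : semi_sigma_additive (density mrho rho0).
Proof.
move=> F mF tF mUF; rewrite /density ge0_integral_bigcup//; last exact: measurable_funTS.
by apply: is_cvg_ereal_nneg_natsum_cond => n _ _; exact: integral_ge0.
Qed.

HB.instance Definition _ := isMeasure.Build _ _ _ (density mrho rho0)
  density0 density_ge0 density_sigma_additive.

Import HBNNSimple.

Lemma ge0_integral_density (f : T -> \bar R) : measurable_fun setT f ->
  (forall x, 0 <= f x) ->
  \int[density mrho rho0]_x f x = \int[mu]_x (f x * (rho x)%:E).
Proof.
move=> mf f0; pose f_ := nnsfun_approx measurableT mf.
transitivity (limn (fun n => \int[density mrho rho0]_x (f_ n x)%:E)).
  rewrite -monotone_convergence//.
  - apply: eq_integral => y _; apply/esym/cvg_lim => //.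
    exact: cvg_nnsfun_approx.
  - by move=> n; exact/measurable_EFinP/measurable_funP.
  - by move=> n y _; rewrite lee_fin.
  - by move=> y _ m n mn; rewrite lee_fin; exact/lefP/nd_nnsfun_approx.
rewrite [X in limn X](_ : _ = (fun n => \int[mu]_x ((f_ n x)%:E * (rho x)%:E))).
  rewrite -monotone_convergence//.
  - apply: eq_integral => y _; apply/cvg_lim => //.
    by apply: cvgeMr => //; exact: cvg_nnsfun_approx.
  - move=> n; apply: emeasurable_funM => //; exact/measurable_EFinP/measurable_funP.
  - by move=> n y _; rewrite mule_ge0// lee_fin.
  - by move=> y _ m n mn; rewrite lee_wpmul2r// lee_fin; exact/lefP/nd_nnsfun_approx.
apply/funext => n.
transitivity (\sum_(k \in range (f_ n)) \int[mu]_x ((k * \1_(f_ n @^-1` [set k]) x)%:E * (rho x)%:E)).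
  under eq_integral do rewrite fimfunE -fsumEFin//.
  rewrite ge0_integral_fsum//; last 2 first.
  - by move=> y; exact/measurable_EFinP/measurable_funM.
  - by move=> y x _; rewrite nnfun_muleindic_ge0.
  apply: eq_fsbigr => r _; rewrite integralZl_indic_nnsfun// integral_indic//= setIT.
  have [r0|r0] := ltP r 0%R.
    rewrite preimage_nnfun0// /density integral_set0 mule0 integral0_eq// => x _.
    by rewrite indicE in_set0 mulr0 mul0e.
  under [RHS]eq_integral do rewrite EFinM -muleA.
  rewrite ge0_integralZl//; last 2 first.
  - apply: emeasurable_funM => //; exact/measurable_EFinP/measurable_indic.
  - by move=> x _; rewrite mule_ge0// lee_fin.
  congr (_ * _); rewrite /density integral_mkcond; apply: eq_integral => x _.
  by rewrite patchE indicE; case: ifPn => _; rewrite ?mul1e ?mul0e.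
rewrite -ge0_integral_fsum//.
- apply: eq_integral => x _; rewrite [in RHS]fimfunE -fsumEFin// ge0_mule_fsuml//.
  by move=> r; rewrite nnfun_muleindic_ge0.
- by move=> r; apply: emeasurable_funM => //; exact/measurable_EFinP/measurable_funM.
- by move=> r x _; rewrite mule_ge0// nnfun_muleindic_ge0.
Qed.

End density_measure.

Section scaled_image.
Local Open Scope ereal_scope.
Context d d' (T : measurableType d) (T' : measurableType d') (R : realType).
Variables (mu : {measure set T -> \bar R}) (c : {nonneg R}) (f : T -> T').
Variable mf : measurable_fun [set: T] f.

(** As for density, the proof is an argument for the sake of inference. *)
Definition scaled_image (_ : measurable_fun [set: T] f) (A : set T') : \bar R :=
  c%:num%:E * mu (f @^-1` A).

Let mimage A : measurable A -> measurable (f @^-1` A).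
Proof. by move=> mA; rewrite -[X in measurable X]setTI; exact: mf. Qed.

Let scaled_image0 : scaled_image mf set0 = 0.
Proof. by rewrite /scaled_image preimage_set0 measure0 mule0. Qed.

Let scaled_image_ge0 A : 0 <= scaled_image mf A.
Proof. by rewrite /scaled_image mule_ge0. Qed.

Let scaled_image_sigma_additive : semi_sigma_additive (scaled_image mf).
Proof.
move=> F mF tF mUF; rewrite /scaled_image preimage_bigcup.
under eq_cvg do rewrite -ge0_sume_distrr//.
apply: cvgeZl => //; apply: measure_semi_sigma_additive.
- by move=> n; exact: mimage.
- apply/trivIsetP => /= i j _ _ ij; rewrite -preimage_setI.
  by move/trivIsetP : tF => /(_ _ _ _ _ ij) ->//; rewrite preimage_set0.
- by rewrite -preimage_bigcup; exact: mimage.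
Qed.

HB.instance Definition _ := isMeasure.Build _ _ _ (scaled_image mf)
  scaled_image0 scaled_image_ge0 scaled_image_sigma_additive.

End scaled_image.

Section scaling.
Context {R : realType}.
Implicit Types r : R.
Local Notation mu := (@lebesgue_measure R).

Definition dil r (x : measurableTypeR R) : measurableTypeR R := r^-1 * x.

Lemma measurable_dil r : measurable_fun setT (dil r).
Proof. exact: mulrl_measurable. Qed.

Lemma lebesgue_dilation r (A : set (measurableTypeR R)) : 0 < r -> measurable A ->
  mu (dil r @^-1` A) = (r%:E * mu A)%E.
Proof.
move=> r0 mA; have ri0 : 0 <= r^-1 by rewrite invr_ge0 ltW.
have -> : mu A = scaled_image mu (NngNum ri0) (measurable_dil r) A.
  apply: lebesgue_measure_unique => // _ [[a b]] _ <-.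
  rewrite /= /scaled_image /= [X in (_ * X)%E](_ : _ = mu `]r * a, r * b]%classic).
    rewrite !lebesgue_measure_itv/= !lte_fin ltr_pM2l//; case: ifPn => _; last by rewrite mule0.
    by rewrite -!EFinB -EFinM -mulrBr mulKf// gt_eqF.
  congr (mu _); apply/seteqP.
  by split => x; rewrite /= !in_itv/= /dil ltr_pdivlMl// ler_pdivrMl.
by rewrite /scaled_image/= muleA -EFinM mulfV ?mul1e// gt_eqF.
Qed.

Definition dilv n r (v : 'rV[R]_n) : 'rV[R]_n := r^-1 *: v.

Lemma measurable_dilv n r : measurable_fun setT (@dilv n r).
Proof.
apply: measurable_fun_rVP => i.
rewrite (_ : _ \o _ = (fun x : R => r^-1 * x) \o rV_coord i).
  by apply: measurableT_comp; [exact: mulrl_measurable|exact: measurable_rV_coord].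
by apply/funext => v; rewrite /rV_coord /dilv /= mxE.
Qed.

(** Induction on the dimension, by uniqueness of product measures. *)
Lemma lebesgue_rV_dilation n r (A : set 'rV[R]_n) : 0 < r -> measurable A ->
  lebesgue_rV n (dilv r @^-1` A) = ((r ^+ n)%:E * lebesgue_rV n A)%E.
Proof.
move=> r0; elim: n A => [|n IH] A mA.
  rewrite expr0 mul1e; congr (lebesgue_rV 0 _); apply/seteqP.
  by split => v; rewrite /= /dilv; congr A; apply/rowP => -[].
pose dil2 (p : measurableTypeR R * 'rV[R]_n) := (dil r p.1, dilv r p.2).
have mdil2 : measurable_fun setT dil2.
  apply/measurable_fun_pairP; split.
    by apply: (measurableT_comp (measurable_dil r)); exact: measurable_fst.
  by apply: (measurableT_comp (@measurable_dilv n r)); exact: measurable_snd.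
have ri0 : 0 <= r ^- n.+1 by rewrite invr_ge0 exprn_ge0// ltW.
have mB : measurable (@rV_cons R n @^-1` A).
  by rewrite -[X in measurable X]setTI; exact: measurable_rV_cons.
rewrite /= /lebesgue_rV_succ /pushforward.
have -> : rV_cons (n := n) @^-1` (dilv r @^-1` A) = dil2 @^-1` (@rV_cons R n @^-1` A).
  have e p : dilv r (rV_cons p) = rV_cons (dil2 p).
    case: p => x v; apply/rowP => i; rewrite /dilv /rV_cons !mxE.
    by case: (unlift ord0 i) => [j|] //=; rewrite mxE.
  by apply/seteqP; split => p /=; rewrite e.
rewrite [X in (_ * X)%E](_ : _ = scaled_image (lebesgue_measure \x lebesgue_rV n)%E (NngNum ri0) mdil2 (@rV_cons R n @^-1` A)).
  by rewrite /scaled_image/= muleA -EFinM mulfV ?mul1e// expf_neq0// gt_eqF.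
apply: product_measure_unique => // B C mB' mC.
rewrite /= /scaled_image /=.
rewrite [X in (_ * X)%E](_ : _ = (lebesgue_measure \x lebesgue_rV n)%E
  ((dil r @^-1` B) `*` (dilv r @^-1` C)))//.
have m1 : measurable (dil r @^-1` B).
  by rewrite -[X in measurable X]setTI; exact: measurable_dil.
have m2 : measurable (dilv r @^-1` C).
  by rewrite -[X in measurable X]setTI; exact: measurable_dilv.
rewrite product_measure1E//= lebesgue_dilation// IH//.
have e1 : (r%:E * (r ^+ n)%:E = (r ^+ n.+1)%:E)%E by rewrite exprS.
have e2 : ((r ^- n.+1)%:E * (r ^+ n.+1)%:E = 1)%E.
  by rewrite -EFinM mulVf// expf_neq0// gt_eqF.
rewrite [X in (_ * X)%E]muleACA e1 [LHS]muleA.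
by rewrite [X in (X * _)%E](e2 : _ = 1%E) mul1e.
Qed.

Section ball.
Variable k : nat.
Local Notation N := k.+1.
Local Notation muN := (@lebesgue_rV R N).

Lemma enorm_dilv r (v : 'rV[R]_N) : 0 < r -> enorm (dilv r v) = r^-1 * enorm v.
Proof.
move=> r0; rewrite /enorm -[r^-1 in RHS]ger0_norm ?invr_ge0 ?(ltW r0)// -sqrtr_sqr.
rewrite -sqrtrM ?sqr_ge0// mulr_sumr; congr Num.sqrt.
by apply: eq_bigr => i _; rewrite /dilv mxE exprMn.
Qed.

Lemma measurable_enorm_preimage (A : set R) : measurable A ->
  measurable (@enorm R N @^-1` A).
Proof.
by move=> mA; rewrite -[X in measurable X]setTI; exact: measurable_enorm.
Qed.

Definition ball_volume : R := fine (muN [set x | enorm x < 1]).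

Lemma measurable_enorm_lt (r : R) : measurable [set x : 'rV[R]_N | enorm x < r].
Proof.
rewrite (_ : mkset _ = @enorm R N @^-1` `]-oo, r[); first exact: measurable_enorm_preimage.
by apply/seteqP; split => x; rewrite /= in_itv.
Qed.

Lemma box_volume (b : R) : 0 <= b ->
  muN [set v | forall i, - b <= v ord0 i <= b] = ((2 * b) ^+ N)%:E.
Proof.
move=> b0; have := @lebesgue_rV_box R N (const_mx (- b)) (const_mx b).
rewrite (_ : [set v | _] = [set v : 'rV[R]_N | forall i, - b <= v ord0 i <= b]); last first.
  by apply/seteqP; split => v /= h i; have := h i; rewrite !mxE.
move=> ->; last by move=> i; rewrite !mxE; lra.
congr EFin; rewrite (eq_bigr (fun=> 2 * b)) ?prodr_const ?card_ord// => i _.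
by rewrite !mxE; lra.
Qed.

Lemma measurable_box (b : R) : measurable [set v : 'rV[R]_N | forall i, - b <= v ord0 i <= b].
Proof.
rewrite (_ : mkset _ = \bigcap_(i in [set: 'I_N]) (rV_coord i @^-1` `[- b, b]%classic)).
  apply: fin_bigcap_measurable => // i _.
  by rewrite -[X in measurable X]setTI; exact: measurable_rV_coord.
apply/seteqP; split => v /= h i; first by move=> _; rewrite /= in_itv; exact: h.
by have := h i I; rewrite /= in_itv.
Qed.

Lemma unit_ball_fin : (muN [set x | (enorm x < 1)%R] < +oo)%E.
Proof.
apply: (@le_lt_trans _ _ (muN [set v | forall i, - 1 <= v ord0 i <= 1])).
  apply: le_measure; rewrite ?inE; [exact: measurable_enorm_lt|exact: measurable_box|].
  by move=> x /= x1 i; rewrite -ler_norml; exact: le_trans (coord_le_enorm x i) (ltW x1).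
by rewrite box_volume// ltry.
Qed.

Lemma ball_volumeE : muN [set x | enorm x < 1] = ball_volume%:E.
Proof. by rewrite /ball_volume fineK// ge0_fin_numE// unit_ball_fin. Qed.

Lemma ball_volume_gt0 : 0 < ball_volume.
Proof.
rewrite -lte_fin -ball_volumeE; have b0 : 0 < (N.+1%:R : R)^-1 by rewrite invr_gt0.
apply: (@lt_le_trans _ _ (muN [set v | forall i, - N.+1%:R^-1 <= v ord0 i <= N.+1%:R^-1])).
  by rewrite box_volume ?ltW// lte_fin exprn_gt0// mulr_gt0.
apply: le_measure; rewrite ?inE; [exact: measurable_box|exact: measurable_enorm_lt|].
move=> x /= xb; rewrite -(@ltr_pXn2r _ 2) ?nnegrE ?enorm_ge0// sqr_enorm expr1n.
have h i : x ord0 i ^+ 2 <= N.+1%:R^-1.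
  have := xb i; rewrite -ler_norml => xi.
  rewrite -real_normK ?num_real//; apply: (@le_trans _ _ (N.+1%:R^-1 ^+ 2)).
    by rewrite lerXn2r// nnegrE// ltW.
  by rewrite expr2 ler_piMl ?(ltW b0)// invf_le1 ?ler1n// ltr0n.
apply: (@le_lt_trans _ _ (\sum_(i < N) N.+1%:R^-1)); first by apply: ler_sum => i _; exact: h.
rewrite sumr_const card_ord -[N.+1%:R^-1 *+ N]mulr_natr mulrC ltr_pdivrMr ?ltr0n// mul1r.
by rewrite ltr_nat.
Qed.

Lemma ball_measure (r : R) : 0 < r ->
  muN [set x | enorm x < r] = (ball_volume * r ^+ N)%:E.
Proof.
move=> r0; rewrite (_ : mkset _ = dilv r @^-1` [set x : 'rV[R]_N | enorm x < 1]).
  by rewrite lebesgue_rV_dilation//; [rewrite ball_volumeE -EFinM mulrC|exact: measurable_enorm_lt].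
by apply/seteqP; split => x; rewrite /= enorm_dilv// ltr_pdivrMl// mulr1.
Qed.

End ball.

End scaling.

Section polar.
Context {R : realType} (k : nat).
Local Notation N := k.+1.
Local Notation muN := (@lebesgue_rV R N).
Local Notation mu := (@lebesgue_measure R).
Local Notation pos := (`]0, +oo[%classic : set R).

(** The area of the unit sphere. *)
Definition sphere_area : R := ball_volume k * N%:R.

Lemma sphere_area_gt0 : 0 < sphere_area.
Proof. by rewrite mulr_gt0// ball_volume_gt0. Qed.

Let rho (r : measurableTypeR R) : R := if 0 < r then sphere_area * r ^+ k else 0.

Let rhoE r : rho r = sphere_area * r ^+ k * \1_pos r.
Proof.
rewrite /rho indicE; case: ifPn => r0.
  by rewrite mem_set ?mulr1//= in_itv/= r0.
by rewrite memNset ?mulr0//= in_itv/= andbT; exact/negP.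
Qed.

Let rho0 r : 0 <= rho r.
Proof.
rewrite /rho; case: ifPn => // r0.
by rewrite mulr_ge0 ?(ltW sphere_area_gt0)// exprn_ge0// ltW.
Qed.

Let weight_continuous : continuous (fun r : R => sphere_area * r ^+ k).
Proof.
move=> x; apply: (@continuousM _ _ (fun=> sphere_area) (fun r : R => r ^+ k)).
  exact: cst_continuous.
exact: exprn_continuous.
Qed.

Let measurable_weight : measurable_fun setT (fun r : measurableTypeR R => sphere_area * r ^+ k).
Proof.
exact: continuous_measurable_fun weight_continuous.
Qed.

Let mrho : measurable_fun setT rho.
Proof.
rewrite (_ : rho = fun r => sphere_area * r ^+ k * \1_pos r); last exact/funext/rhoE.
by apply: measurable_funM => //; exact: measurable_indic.
Qed.

Let menorm : measurable_fun setT (@enorm R N : 'rV[R]_N -> measurableTypeR R).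
Proof. exact: measurable_enorm. Qed.

Let nu : {measure set (measurableTypeR R) -> \bar R} := scaled_image muN (NngNum (ler01 : 0 <= 1 :> R)) menorm.
Let de : {measure set (measurableTypeR R) -> \bar R} := density mu mrho rho0.

Lemma weight_integral (b : R) : 0 < b ->
  (\int[mu]_(r in `[0%R, b]) (sphere_area * r ^+ k)%:E = (ball_volume k * b ^+ N)%:E)%E.
Proof.
move=> b0.
have d (x : R) : 0 <= x <= b ->
    is_derive x 1 (fun r => ball_volume k * r ^+ N) (sphere_area * x ^+ k).
  by move=> _; refine (der_eq (derZ _ (der_pow k x)) _); rewrite /sphere_area mulrA.
have c (x : R) : 0 <= x <= b -> {for x, continuous (fun r : R => sphere_area * r ^+ k)}.
  by move=> _; exact: weight_continuous.
have := ftc2 (ltW b0) d c; rewrite expr0n mulr0 subr0 /Rintegral => <-.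
rewrite fineK//; apply: (@integrable_fin_num _ _ _ mu) => //.
exact: (cont_integrable c).
Qed.

Let nu_de (b : R) : nu `]-oo, b[%classic = de `]-oo, b[%classic.
Proof.
rewrite /nu /de /= /scaled_image /density /= mul1e.
have [b0|b0] := leP b 0.
  rewrite (_ : _ @^-1` _ = set0) ?measure0; last first.
    apply/seteqP; split => x //=; rewrite in_itv/= => xb.
    by have := enorm_ge0 x; rewrite leNgt (lt_le_trans xb b0).
  rewrite integral0_eq// => r; rewrite /= in_itv/= /rho => rb.
  by rewrite ltNge (ltW (lt_le_trans rb b0)).
rewrite [X in muN X](_ : _ = [set x : 'rV[R]_N | enorm x < b]); last first.
  by apply/seteqP; split => x; rewrite /= in_itv.
rewrite ball_measure// -weight_integral//.
have mw : measurable_fun setT (fun r : measurableTypeR R => (sphere_area * r ^+ k)%:E).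
  exact/measurable_EFinP.
rewrite -integral_itv_obnd_cbnd; last exact: measurable_funTS.
rewrite -integral_itv_bndo_bndc; last exact: measurable_funTS.
rewrite [LHS]integral_mkcond [RHS]integral_mkcond; apply: eq_integral => x _.
rewrite !patchE /rho !mem_setE !in_itv/=.
by case: (0 < x); case: (x < b).
Qed.

(** Both measures agree on the rays ]-oo, b[, which generate the Borel sets: this
    is the formula for the volume of balls. *)
Lemma nu_density A : measurable A -> nu A = de A.
Proof.
apply: (@measure_unique _ R (measurableTypeR R) (@RGenInftyO.G R) (fun n => `]-oo, n%:R[%classic)).
- exact: RGenInftyO.measurableE.
- move=> _ _ [x ->] [y ->]; exists (Num.min x y).
  by apply/seteqP; split => z; rewrite /= !in_itv/= lt_min; [case=> -> ->|move=> /andP[]].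
- by move=> n; exists n%:R.
- apply/seteqP; split => // x _; exists (Num.truncn `|x|).+1 => //=.
  by rewrite in_itv/=; apply: le_lt_trans (ler_norm _) _; exact: truncnS_gt.
- by move=> _ [x ->]; exact: nu_de.
- move=> n; rewrite /nu /= /scaled_image /= mul1e.
  have n0 : 0 < n.+1%:R :> R by rewrite ltr0n.
  apply: (@le_lt_trans _ _ (muN [set x | enorm x < n.+1%:R])); last by rewrite ball_measure// ltry.
  apply: le_measure; rewrite ?inE; [|exact: measurable_enorm_lt|].
    by apply: measurable_enorm_preimage.
  by move=> x; rewrite /= in_itv/= => /lt_trans; apply; rewrite ltr_nat.
Qed.

Lemma ge0_radial_integral (f : R -> \bar R) : measurable_fun setT f ->
  (forall r, (0 <= f r)%E) ->
  (\int[muN]_x f (enorm x) = \int[mu]_(r in pos) (f r * (sphere_area * r ^+ k)%:E))%E.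
Proof.
move=> mf f0.
transitivity (\int[nu]_r f r)%E.
  pose pf : {measure set (measurableTypeR R) -> \bar R} :=
    measure_function_pushforward__canonical__measure_function_Measure muN menorm.
  transitivity (\int[pf]_r f r)%E.
    by apply/esym; exact: (ge0_integral_pushforward menorm muN measurableT mf).
  by apply: eq_measure_integral => A mA _; rewrite /nu /pf /= /scaled_image /= mul1e.
transitivity (\int[de]_r f r)%E.
  by apply: eq_measure_integral => A mA _; exact: nu_density.
rewrite ge0_integral_density// [RHS]integral_mkcond; apply: eq_integral => r _.
rewrite patchE rhoE indicE; case: ifPn => _; first by rewrite mulr1.
by rewrite mulr0 mule0.
Qed.

End polar.

Section radial_transfer.
Context {R : realType} (k : nat).
Local Notation N := k.+1.
Local Notation muN := (@lebesgue_rV R N).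
Local Notation mu := (@lebesgue_measure R).
Local Notation pos := (`]0, +oo[%classic : set R).
Local Notation S := (@sphere_area R k).
Implicit Types f g : R -> R.

Lemma measurable_radial f : measurable_fun setT f ->
  measurable_fun setT (fun x : 'rV[R]_N => f (enorm x)).
Proof. by move=> mf; apply: measurableT_comp => //; exact: measurable_enorm. Qed.

Lemma weight_ge0 (r : R) : 0 <= r -> 0 <= S * r ^+ k.
Proof. by move=> r0; rewrite mulr_ge0 ?exprn_ge0// ltW// sphere_area_gt0. Qed.

Lemma measurable_weight : measurable_fun setT (fun r : R => S * r ^+ k).
Proof. by apply: measurable_funM => //; apply: measurable_funX. Qed.

Lemma radial_Rintegral f : measurable_fun setT f ->
  \int[muN]_x f (enorm x) = \int[mu]_(r in pos) (f r * (S * r ^+ k)).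
Proof.
move=> mf; rewrite /Rintegral; congr fine.
have mfE : measurable_fun setT (EFin \o f) by exact/measurable_EFinP.
rewrite integralE [RHS]integralE; congr (_ - _)%E.
- transitivity (\int[muN]_x funepos (EFin \o f) (enorm x))%E.
    by apply: eq_integral => x _; rewrite !(funeposE, funenegE).
  rewrite ge0_radial_integral//; last exact: measurable_funepos.
  apply: eq_integral => r; rewrite inE/= in_itv/= andbT => /ltW r0.
  by rewrite !(funeposE, funenegE) /= -!EFin_max -EFinM maxr_pMl ?mul0r// weight_ge0.
- transitivity (\int[muN]_x funeneg (EFin \o f) (enorm x))%E.
    by apply: eq_integral => x _; rewrite !(funeposE, funenegE).
  rewrite ge0_radial_integral//; last exact: measurable_funeneg.
  apply: eq_integral => r; rewrite inE/= in_itv/= andbT => /ltW r0.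
  by rewrite !(funeposE, funenegE) /= -!EFin_max -EFinM maxr_pMl ?mul0r ?mulNr// weight_ge0.
Qed.

Lemma radial_integrable f : measurable_fun setT f ->
  muN.-integrable setT (EFin \o (fun x => f (enorm x))) <->
  mu.-integrable pos (EFin \o (fun r => f r * (S * r ^+ k))).
Proof.
move=> mf.
have e : (\int[muN]_x `|(f (enorm x))%:E| =
    \int[mu]_(r in pos) `|(f r * (S * r ^+ k))%:E|)%E.
  rewrite (@ge0_radial_integral _ _ (fun r => `|(f r)%:E|%E))//; last first.
    by apply: measurableT_comp => //; exact/measurable_EFinP.
  apply: eq_integral => r; rewrite inE/= in_itv/= andbT => /ltW r0.
  by rewrite /= normrM (ger0_norm (weight_ge0 r0)).
split=> /integrableP[_ h]; apply/integrableP; split.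
- apply/measurable_EFinP/measurable_funTS; apply: measurable_funM => //; exact: measurable_weight.
- by move: h => /=; rewrite e.
- by apply/measurable_EFinP; exact: measurable_radial.
- by move: h => /=; rewrite -e.
Qed.

Lemma radial_ae f g : measurable_fun setT f -> measurable_fun setT g ->
  {ae mu, forall r, 0 < r -> f r = g r} ->
  {ae muN, forall x, f (enorm x) = g (enorm x)}.
Proof.
move=> mf mg fg.
pose E := [set r : R | f r != g r].
have mE : measurable E.
  rewrite (_ : E = (fun r => f r - g r) @^-1` [set~ 0]).
    rewrite -[X in measurable X]setTI; apply: measurable_funB => //.
    exact: measurableC.
  by apply/seteqP; split => r; rewrite /E /= -subr_eq0 => h; apply/eqP.
have z : (\int[muN]_x (\1_E (enorm x))%:E = 0)%E.
  rewrite (@ge0_radial_integral _ _ (fun r => (\1_E r)%:E))//; last first.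
    exact/measurable_EFinP/measurable_indic.
  apply/esym; rewrite -[LHS](@integral0 _ _ _ mu pos).
  apply: ae_eq_integral => //.
    apply/measurable_EFinP/measurable_funTS/measurable_funM; first exact: measurable_indic.
    exact: measurable_weight.
  apply: ae_mono fg => r fgr; rewrite /= in_itv/= andbT => r0.
  have rE : ~ E r by rewrite /E /= fgr// eqxx.
  by rewrite indicE memNset// mul0e.
have nE : muN (@enorm R N @^-1` E) = 0%E.
  have mEN := measurable_enorm_preimage (k := k) mE.
  by rewrite -[X in muN X]setIT -(integral_indic muN)// -[RHS]z.
exists (@enorm R N @^-1` E); split => //; first exact: measurable_enorm_preimage.
by move=> x /= h; apply/eqP => h'; apply: h.
Qed.

End radial_transfer.

(** * Masses of balls *)

Section mass.
Context {R : realType} (k : nat).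
Local Notation N := k.+1.
Local Notation muN := (@lebesgue_rV R N).
Local Notation mu := (@lebesgue_measure R).
Local Notation pos := (`]0, +oo[%classic : set R).
Implicit Types m : 'rV[R]_N -> R.

Definition oball (r : R) : set 'rV[R]_N := [set x | enorm x < r].

Definition mass m (r : R) : R := \int[muN]_(x in oball r) m x.

Definition locally_summable m : Prop := measurable_fun setT m /\
  forall r, muN.-integrable (oball r) (EFin \o m).

Lemma measurable_oball r : measurable (oball r).
Proof. exact: measurable_enorm_lt. Qed.

Lemma EFin_Rint d (T : measurableType d) (nu : {measure set T -> \bar R}) (D : set T)
    (f : T -> R) : measurable D -> nu.-integrable D (EFin \o f) ->
  (\int[nu]_(x in D) (f x)%:E = (\int[nu]_(x in D) f x)%:E)%E.
Proof. by move=> mD fi; rewrite /Rintegral fineK//; exact: integrable_fin_num. Qed.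

(** Write theta(|x|) as minus the integral of psi over ]|x|, +oo[ and exchange the
    integrals; m is cut off outside the support of theta to be integrable. *)
Lemma mass_fubini m (theta psi : R -> R) (a b : R) : locally_summable m ->
  (forall r : R, is_derive r 1 theta (psi r)) -> continuous psi ->
  0 < a -> (forall r, ~~ (a <= r <= b) -> psi r = 0) ->
  (forall r, b <= r -> theta r = 0) ->
  \int[muN]_x (m x * theta (enorm x)) = - \int[mu]_(r in pos) (mass m r * psi r).
Proof.
move=> [mm im] dtheta cpsi a0 psi0 theta0.
pose M x := m x * \1_(oball (b + 1)) x.
have Mrestrict : M = m \_ (oball (b + 1)).
  by apply/funext => x; rewrite /M patchE indicE; case: ifPn; rewrite ?mulr1 ?mulr0.
have mM : measurable_fun setT M.
  by apply: measurable_funM => //; exact: measurable_indic (measurable_oball _).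
have iM : muN.-integrable setT (EFin \o M).
  have := (integrable_mkcond (EFin \o m) (measurable_oball (b + 1))).1 (im (b + 1)).
  by rewrite restrict_EFin -Mrestrict.
have mp1 : measurable_fun setT (fun p : 'rV[R]_N * measurableTypeR R => enorm p.1).
  by apply: (measurableT_comp (@measurable_enorm R N)); exact: measurable_fst.
have mp2 : measurable_fun setT (fun p : 'rV[R]_N * measurableTypeR R => (p.2 : R)).
  exact: measurable_snd.
pose L : set ('rV[R]_N * measurableTypeR R) := [set p | enorm p.1 < p.2].
have mL : measurable L.
  rewrite (_ : L = (fun p : 'rV[R]_N * measurableTypeR R => p.2 - enorm p.1) @^-1` `]0, +oo[%classic).
    by rewrite -[X in measurable X]setTI; exact: measurable_funB mp2 mp1 _ _ _.
  by apply/seteqP; split => p; rewrite /L /= in_itv/= andbT subr_gt0.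
pose F (p : 'rV[R]_N * measurableTypeR R) := (M p.1 * psi p.2 * \1_L p)%:E.
have mpsi : measurable_fun setT (psi : measurableTypeR R -> R).
  exact: continuous_measurable_fun.
have mF : measurable_fun setT F.
  apply/measurable_EFinP; apply: measurable_funM; last exact: measurable_indic.
  apply: measurable_funM.
    by apply: (measurableT_comp mM); exact: measurable_fst.
  by apply: (measurableT_comp mpsi); exact: measurable_snd.
have psiT (f : R -> R) : (\int[mu]_r (f r * psi r)%:E = \int[mu]_(r in pos) (f r * psi r)%:E)%E.
  rewrite [RHS]integral_mkcond; apply: eq_integral => r _.
  rewrite patchE; case: ifPn => //; rewrite notin_setE/= in_itv/= andbT => r0.
  rewrite psi0 ?mulr0// negb_and -!ltNge; apply/orP; left.
  by apply: le_lt_trans a0; rewrite leNgt; exact/negP.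
have psiE : psi = psi \_ `[a, b].
  apply/funext => r; rewrite patchE; case: ifPn => //; rewrite notin_setE/= in_itv/=.
  by move=> /negP; exact: psi0.
have mab : measurable (`[a, b]%classic : set (measurableTypeR R)) by exact: measurable_itv.
have ipsi : mu.-integrable setT (EFin \o psi).
  rewrite psiE -restrict_EFin; apply: (@integrable_mkcond _ _ _ mu _ (EFin \o psi) mab).1.
  by apply: cont_integrable => r _; exact: cpsi.
pose G (p : 'rV[R]_N * measurableTypeR R) := (M p.1 * psi p.2)%:E.
have mGr : measurable_fun setT (fun p : 'rV[R]_N * measurableTypeR R => M p.1 * psi p.2).
  apply: measurable_funM.
    by apply: (measurableT_comp mM); exact: measurable_fst.
  by apply: (measurableT_comp mpsi); exact: measurable_snd.
have iG : (muN \x mu)%E.-integrable setT G.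
  have mG : measurable_fun setT G by exact/measurable_EFinP.
  apply: (integrable12ltyP muN mu mG).2.
  rewrite (eq_integral (fun x => (\int[mu]_r `|(psi r)%:E|) * `|(M x)%:E|)%E); last first.
    move=> x _; rewrite muleC -ge0_integralZl//.
    - by apply: eq_integral => r _; rewrite /G /= normrM EFinM.
    - by apply: measurableT_comp => //; exact/measurable_EFinP.
  have /integrableP[_ iM'] := iM; have /integrableP[_ ip'] := ipsi.
  rewrite ge0_integralZl//.
  - by rewrite lte_mul_pinfty// ?ge0_fin_numE// integral_ge0.
  - by apply: measurableT_comp => //; exact/measurable_EFinP.
  - exact: integral_ge0.
have iF : (muN \x mu)%E.-integrable setT F.
  apply: le_integrable iG => // p _; rewrite /F /G /= lee_fin normrM ler_piMr//.
  by rewrite indicE; case: (_ \in _); rewrite ?normr1 ?normr0.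
have inner1 x : (\int[mu]_r F (x, r) = (- (m x * theta (enorm x)))%:E)%E.
  set s := enorm x; have [sb|bs] := ltP s (b + 1); last first.
    rewrite theta0; last by lra.
    rewrite mulr0 oppr0 integral0_eq// => r _.
    by rewrite /F /M /= indicE memNset ?mulr0 ?mul0r// /oball /=; apply/negP; rewrite -leNgt.
  have Mx : M x = m x by rewrite /M indicE mem_set ?mulr1.
  have s0 : 0 <= s by exact: enorm_ge0.
  transitivity (\int[mu]_(r in `]s, (b + 1)%R]) (m x * psi r)%:E)%E.
    rewrite [RHS]integral_mkcond; apply: eq_integral => r _.
    rewrite patchE /F /= Mx indicE; have [sr|rs] := ltP s r.
      rewrite mem_set// mulr1; case: ifPn => //; rewrite notin_setE/= in_itv/= sr/= => h.
      by rewrite psi0 ?mulr0// negb_and -!ltNge; apply/orP; right; move/negP: h; rewrite -ltNge; lra.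
    rewrite memNset ?mulr0; last by rewrite /L /=; apply/negP; rewrite -leNgt.
    case: ifPn => //; rewrite inE/= in_itv/= => /andP[sr _].
    by move: sr; rewrite ltNge rs.
  rewrite integral_itv_obnd_cbnd; last first.
    apply/measurable_funTS/measurable_EFinP; exact: measurable_funM.
  have ic : mu.-integrable `[s, b + 1] (EFin \o psi) by apply: cont_integrable => r _; exact: cpsi.
  rewrite EFin_Rint//.
    rewrite RintegralZl// (ftc2 (ltW sb) (fun r _ => dtheta r) (fun r _ => cpsi r)).
    by rewrite theta0; [congr EFin; ring|lra].
  rewrite (_ : _ \o _ = (fun r => (m x)%:E * (EFin \o psi) r)%E) //.
  exact: integrableZl.
have inner2 (r : R) : (\int[muN]_x F (x, r) = (mass m r * psi r)%:E)%E.
  have [p0|p0] := eqVneq (psi r) 0.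
    by rewrite p0 mulr0 integral0_eq// => x _; rewrite /F /= p0 mulr0 mul0r.
  have rb : r <= b.
    by rewrite leNgt; apply/negP => br; move/eqP: p0; apply; apply: psi0; rewrite negb_and -!ltNge br orbT.
  transitivity (\int[muN]_(x in oball r) (m x * psi r)%:E)%E.
    rewrite [RHS]integral_mkcond; apply: eq_integral => x _.
    rewrite patchE /F /M /= !indicE; have [xr|rx] := ltP (enorm x) r.
      rewrite !mem_set ?mulr1//; last by rewrite /oball /=; lra.
    rewrite [_ \in L]memNset ?mulr0 ?[_ \in oball r]memNset//.
      by rewrite /oball /=; apply/negP; rewrite -leNgt.
    by rewrite /L /=; apply/negP; rewrite -leNgt.
  rewrite EFin_Rint//; first by rewrite RintegralZr//; exact: measurable_oball.
    exact: measurable_oball.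
  rewrite (_ : _ \o _ = (fun x => (EFin \o m) x * (psi r)%:E)%E) //.
  by apply: integrableZr => //; exact: measurable_oball.
have i1 : muN.-integrable setT (EFin \o (fun x => - (m x * theta (enorm x)))).
  have := integrable_fubini_F iF; rewrite /fubini_F.
  by rewrite (_ : (fun x => _) = (EFin \o (fun x => - (m x * theta (enorm x)))))//; exact/funext.
have := Fubini iF.
under eq_integral do rewrite inner1.
under [X in _ = X -> _]eq_integral do rewrite inner2.
rewrite psiT => e.
transitivity (- 1 * \int[muN]_x (- (m x * theta (enorm x)))).
  by rewrite -RintegralZl//; apply: eq_Rintegral => x _; rewrite mulN1r opprK.
by rewrite mulN1r; congr (- _); rewrite /Rintegral e.
Qed.

End mass.

Section local_integrability.
Context {R : realType} (k : nat).
Local Notation N := k.+1.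
Local Notation muN := (@lebesgue_rV R N).
Local Notation mu := (@lebesgue_measure R).
Local Notation pos := (`]0, +oo[%classic : set R).
Implicit Types m : 'rV[R]_N -> R.

Lemma oball_measure (r : R) : 0 <= r -> muN (oball r) = (ball_volume k * r ^+ N)%:E.
Proof.
rewrite le_eqVlt => /predU1P[<-|]; last exact: ball_measure.
rewrite expr0n mulr0 (_ : oball 0 = set0) ?measure0//.
by apply/seteqP; split => // x; rewrite /oball /= ltNge enorm_ge0.
Qed.

Lemma oball_fin (r : R) : (muN (oball r) < +oo)%E.
Proof.
have [r0|r0] := leP 0 r; first by rewrite oball_measure// ltry.
rewrite (_ : oball r = set0) ?measure0//; apply/seteqP; split => // x.
by rewrite /oball /= => xr; have := enorm_ge0 x; rewrite leNgt (lt_trans xr r0).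
Qed.

Lemma cst_integrable (c r : R) : muN.-integrable (oball r) (EFin \o cst c).
Proof.
apply: measurable_bounded_integrable => //; [exact: measurable_oball|exact: oball_fin|].
by exists `|c|; split => // x xc y _; rewrite /= ltW.
Qed.

Lemma Lfun_measurable m (p : R) : m \in Lfun muN p%:E -> measurable_fun setT m.
Proof. by rewrite inE => /andP[/[!inE]]. Qed.

Lemma Lfun_locally_summable m (p : R) : 1 <= p -> m \in Lfun muN p%:E ->
  locally_summable m.
Proof.
move=> p1 mp; have mm := Lfun_measurable mp; split => // r.
have ip := Lfun_integrable p1 mp.
have ipr : muN.-integrable (oball r) (fun x => (`|m x| `^ p)%:E).
  by apply: integrableS ip => //; exact: measurable_oball.
have i1 : muN.-integrable (oball r) (fun x => (1 + `|m x| `^ p)%:E).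
  have := integrableD (measurable_oball r) (cst_integrable 1 r) ipr.
  by [].
apply: le_integrable i1 => //; first exact: measurable_oball.
  by apply/measurable_EFinP; exact: measurable_funTS.
move=> x _ /=; rewrite lee_fin [leRHS]ger0_norm ?addr_ge0 ?powR_ge0//.
have [m1|m1] := leP `|m x| 1; first by rewrite (le_trans m1)// lerDl powR_ge0.
by apply: le_trans (le1r_powR (ltW m1) p1) _; rewrite lerDr.
Qed.

Lemma L2_sqr_integrable m : m \in Lfun muN 2%:E -> muN.-integrable setT (fun x => (m x ^+ 2)%:E).
Proof.
move=> m2; have := Lfun_integrable (ler1n _ 2) m2; congr (_.-integrable _ _).
by apply/funext => x; rewrite -[2%:R]/(2%:R) powR_mulrn// real_normK// num_real.
Qed.

Lemma young (d x y : R) : 0 < d -> `|x * y| <= d * x ^+ 2 + y ^+ 2 / d.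
Proof.
move=> d0; rewrite normrM -(real_normK (num_real x)) -(real_normK (num_real y)).
move: (normr_ge0 x) (normr_ge0 y); move: (`|x|) (`|y|) => {}x {}y x0 y0.
have : 0 <= (d * x - y) ^+ 2 / d by rewrite divr_ge0 ?sqr_ge0// ltW.
have -> : (d * x - y) ^+ 2 / d = d * x ^+ 2 + y ^+ 2 / d - 2 * (x * y).
  by field; rewrite gt_eqF.
have := mulr_ge0 x0 y0; lra.
Qed.

(** Cauchy-Schwarz in the form of Young's inequality: d will be a power of the
    radius. *)
Lemma L2_pairing_bound (D : set 'rV[R]_N) m (T : 'rV[R]_N -> R) (d : R) : measurable D ->
  m \in Lfun muN 2%:E -> measurable_fun D T -> muN.-integrable D (fun x => (T x ^+ 2)%:E) -> 0 < d ->
  `|\int[muN]_(x in D) (m x * T x)| <=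
    d * \int[muN]_x (m x ^+ 2) + (\int[muN]_(x in D) (T x ^+ 2)) / d.
Proof.
move=> mD m2 mT iT d0; have im := L2_sqr_integrable m2.
have mm := Lfun_measurable m2.
have imD : muN.-integrable D (fun x => (m x ^+ 2)%:E) by apply: integrableS im.
have ib : muN.-integrable D (EFin \o (fun x => d * m x ^+ 2 + T x ^+ 2 / d)).
  have -> : EFin \o (fun x => d * m x ^+ 2 + T x ^+ 2 / d) =
      (fun x => d%:E * (m x ^+ 2)%:E + (T x ^+ 2)%:E * (d^-1)%:E)%E by [].
  by apply: integrableD => //; [exact: integrableZl|exact: integrableZr].
have imT : muN.-integrable D (EFin \o (fun x => m x * T x)).
  apply: le_integrable ib => //.
    by apply/measurable_EFinP; apply: measurable_funM => //; exact: measurable_funTS.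
  move=> x _ /=; rewrite lee_fin; apply: le_trans (young _ _ d0) _; exact: ler_norm.
apply: le_trans (le_normr_Rintegral mD imT) _.
apply: (@le_trans _ _ (\int[muN]_(x in D) (d * m x ^+ 2 + T x ^+ 2 / d))).
  apply: le_Rintegral => //; first exact: (integrable_abse imT).
  by move=> x _; exact: young.
have idm : muN.-integrable D (EFin \o (fun x => d * m x ^+ 2)).
  rewrite (_ : _ \o _ = (fun x => d%:E * (m x ^+ 2)%:E)%E) //.
  exact: integrableZl.
have idT : muN.-integrable D (EFin \o (fun x => T x ^+ 2 / d)).
  rewrite (_ : _ \o _ = (fun x => (T x ^+ 2)%:E * (d^-1)%:E)%E) //.
  exact: integrableZr.
rewrite RintegralD// RintegralZl// RintegralZr// lerD2r ler_wpM2l// ?(ltW d0)//.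
rewrite /Rintegral; apply: fine_le.
- exact: integrable_fin_num.
- exact: integrable_fin_num.
- apply: ge0_subset_integral => //.
    by apply/measurable_EFinP; apply: measurable_funX.
  by move=> x _; rewrite lee_fin sqr_ge0.
Qed.

Lemma mass_sub m (s r : R) : locally_summable m -> s <= r ->
  mass m r - mass m s = \int[muN]_(x in oball r `\` oball s) m x.
Proof.
move=> [mm im] sr; rewrite /mass.
have sub : @oball R k s `<=` oball r.
  by move=> x; rewrite /oball /= => xs; exact: lt_le_trans sr.
have e : oball r = oball s `|` (oball r `\` oball s) :> set 'rV[R]_N.
  by rewrite setDE setUIr setUv setIT; apply/esym/setUidPr.
have mD : measurable (oball r `\` oball s : set 'rV[R]_N).
  by apply: measurableD; exact: measurable_oball.
have ie : muN.-integrable (oball s `|` (oball r `\` oball s)) (EFin \o m) by rewrite -e.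
have dis : [disjoint oball s & oball r `\` oball s :> set 'rV[R]_N].
  by apply/disj_setPS => x [] xs [_].
have := @Rintegral_setU _ _ _ muN _ _ m (measurable_oball s) mD ie dis.
by rewrite -e => ->; rewrite addrC addKr.
Qed.

Lemma mass_L2_bound m (s r d : R) : m \in Lfun muN 2%:E -> 0 <= s -> s <= r -> 0 < d ->
  `|mass m r - mass m s| <=
    d * \int[muN]_x (m x ^+ 2) + ball_volume k * (r ^+ N - s ^+ N) / d.
Proof.
move=> m2 s0 sr d0; have lm := Lfun_locally_summable (ler1n _ 2) m2.
have mD : measurable (oball r `\` oball s : set 'rV[R]_N).
  by apply: measurableD; exact: measurable_oball.
have r0 : 0 <= r by exact: le_trans sr.
have sub : @oball R k s `<=` oball r.
  by move=> x; rewrite /oball /= => xs; exact: lt_le_trans sr.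
have muD : muN (oball r `\` oball s) = (ball_volume k * (r ^+ N - s ^+ N))%:E.
  rewrite measureD//; [|exact: measurable_oball|exact: measurable_oball|exact: oball_fin].
  transitivity ((ball_volume k * r ^+ N)%:E - (ball_volume k * s ^+ N)%:E)%E.
    by rewrite setIidr//; congr (_ - _)%E; exact: oball_measure.
  by rewrite -EFinB -mulrBr.
rewrite (mass_sub lm sr).
have i1 : muN.-integrable (oball r `\` oball s) (fun x => ((1 : R) ^+ 2)%:E).
  apply: integrableS (cst_integrable (1 ^+ 2) r) => //; exact: measurable_oball.
have := L2_pairing_bound mD m2 (measurable_cst (1 : R)) i1 d0.
rewrite (eq_Rintegral _ (g := m)); last by move=> x _; rewrite mulr1.
move=> /le_trans; apply; rewrite lerD2l ler_pM2r ?invr_gt0//.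
rewrite le_eqVlt; apply/orP; left; apply/eqP.
etransitivity; first exact: (Rintegral_cst muN mD (1 ^+ 2)).
rewrite expr1n mul1r; exact: (congr1 fine muD).
Qed.

Lemma compact_support_integrable m (T : 'rV[R]_N -> R) (b B : R) : locally_summable m ->
  measurable_fun setT T -> (forall x, `|T x| <= B) -> (forall x, b <= enorm x -> T x = 0) ->
  muN.-integrable setT (EFin \o (fun x => m x * T x)).
Proof.
move=> [mm im] mT TB Tb.
have -> : (fun x => m x * T x) = (fun x => m x * T x) \_ (oball b).
  apply/funext => x; rewrite patchE; case: ifPn => //; rewrite notin_setE /oball /= => h.
  by rewrite Tb ?mulr0// leNgt; exact/negP.
rewrite -restrict_EFin; apply: (integrable_mkcond _ (measurable_oball b)).1.
have iB : muN.-integrable (oball b) (fun x => (B%:E * (EFin \o m) x)%E).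
  by apply: integrableZl => //; exact: measurable_oball.
apply: le_integrable iB => //; first exact: measurable_oball.
  by apply/measurable_EFinP; apply: measurable_funM; exact: measurable_funTS.
move=> x _ /=; rewrite lee_fin !normrM mulrC ler_wpM2r//.
exact: le_trans (TB x) (ler_norm _).
Qed.

End local_integrability.

(** * The equation tested with radial functions *)

Section radial_identities.
Context {R : realType} (k : nat).
Local Notation N := k.+1.
Local Notation muN := (@lebesgue_rV R N).
Local Notation mu := (@lebesgue_measure R).
Local Notation pos := (`]0, +oo[%classic : set R).
Local Notation S := (@sphere_area R k).
Implicit Types m : 'rV[R]_N -> R.
Implicit Types h : R -> R.

Lemma ae_eq_Rint m1 m2 : measurable_fun setT m1 -> measurable_fun setT m2 ->
  {ae muN, forall x, m1 x = m2 x} -> \int[muN]_x m1 x = \int[muN]_x m2 x.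
Proof.
move=> mm1 mm2 e; rewrite /Rintegral; congr fine; apply: ae_eq_integral => //.
- exact/measurable_EFinP.
- exact/measurable_EFinP.
- by apply: ae_mono e => x /= e _; rewrite e.
Qed.

Lemma ae_eq_integrable m1 m2 : measurable_fun setT m1 -> measurable_fun setT m2 ->
  {ae muN, forall x, m1 x = m2 x} -> muN.-integrable setT (EFin \o m1) ->
  muN.-integrable setT (EFin \o m2).
Proof.
move=> mm1 mm2 e /integrableP[_ i1]; apply/integrableP; split; first exact/measurable_EFinP.
rewrite (@ae_eq_integral _ _ _ muN setT (fun x => `|(m1 x)%:E|%E)) //.
- by apply: measurableT_comp => //; exact/measurable_EFinP.
- by apply: measurableT_comp => //; exact/measurable_EFinP.
- by apply: ae_mono e => x /= e _; rewrite e.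
Qed.

Lemma radial_locint m h : locally_summable m -> measurable_fun setT h ->
  {ae muN, forall x, m x = h (enorm x)} -> locint h.
Proof.
move=> [mm im] mh mhe a b a0.
have mI : measurable (`]-oo, (b + 1)[ : set R) by exact: measurable_itv.
pose f := h \_ `]-oo, (b + 1)[.
have mf : measurable_fun setT f by apply/(measurable_restrictT _ mI); exact: measurable_funTS.
have : muN.-integrable setT (EFin \o (fun x => f (enorm x))).
  have := (integrable_mkcond _ (measurable_oball (b + 1)%R)).1 (im (b + 1)%R).
  rewrite restrict_EFin; apply: ae_eq_integrable.
  - by apply/(measurable_restrictT _ (measurable_oball _)); exact: measurable_funTS.
  - exact: measurable_radial.
  - apply: ae_mono mhe => x mx; rewrite /f !patchE mx; congr (if _ then _ else _).
move/(radial_integrable k mf) => i1.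
have mab : measurable (`[a, b]%classic : set (measurableTypeR R)) by exact: measurable_itv.
have i2 : mu.-integrable `[a, b] (EFin \o (fun r => f r * (S * r ^+ k))).
  apply: integrableS i1 => // x /=; rewrite !in_itv/= andbT => /andP[ax _].
  exact: lt_le_trans ax.
have Sa : 0 < S * a ^+ k by rewrite mulr_gt0 ?exprn_gt0// sphere_area_gt0.
apply: (@le_integrable _ _ _ mu `[a, b] _ _
  (fun r => ((S * a ^+ k)^-1)%:E * (f r * (S * r ^+ k))%:E)%E) => //.
- by apply/measurable_EFinP; exact: measurable_funTS.
- move=> r; rewrite /= in_itv/= => /andP[ar rb].
  have -> : f r = h r.
    by rewrite /f patchE ifT// inE/= in_itv/= (le_lt_trans rb)// ltrDl.
  rewrite lee_fin [leRHS]normrM [X in _ <= _ * X]normrM mulrCA ler_peMr//.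
  rewrite -normrM ger0_norm; last first.
    by rewrite mulr_ge0 ?invr_ge0 ?(ltW Sa)// weight_ge0// (le_trans (ltW a0)).
  rewrite mulrC ler_pdivlMr// mul1r ler_pM2l ?sphere_area_gt0//.
  by rewrite lerXn2r// nnegrE ?(ltW a0)// (le_trans (ltW a0)).
- exact: integrableZl.
Qed.

Lemma radial_pairing m h x : locally_summable m -> measurable_fun setT h ->
  {ae muN, forall x, m x = h (enorm x)} -> half_test x ->
  \int[muN]_y (m y * (x (enorm y) / enorm y ^+ k)) = S * pairing h x.
Proof.
move=> lm mh mhe hx; have lh := radial_locint lm mh mhe.
have mx : measurable_fun setT (fun r => x r / r ^+ k).
  by apply: continuous_measurable_fun; exact: (half_test_cont (half_test_divX k hx)).
pose f r := h r * (x r / r ^+ k).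
have mf : measurable_fun setT f by exact: measurable_funM.
transitivity (\int[muN]_y f (enorm y)).
  apply: ae_eq_Rint; last by apply: ae_mono mhe => y ->.
  - by apply: measurable_funM; [exact: lm.1|exact: (@measurable_radial R k _ mx)].
  - exact: (@measurable_radial R k _ mf).
rewrite radial_Rintegral// /pairing -RintegralZl//; last exact: half_test_integrable.
apply: eq_Rintegral => r; rewrite inE/= in_itv/= andbT => r0; rewrite /f.
by field; rewrite gt_eqF// exprn_gt0.
Qed.

(** The test functions obtained from radial ones by differentiation and products. *)
Definition radial_test (f : 'rV[R]_N -> R) : Prop :=
  radial_poly f /\ exists b : R, forall x, b <= enorm x -> f x = 0.

Lemma radial_test_partial f i : radial_test f -> radial_test (partial i f).
Proof.
move=> [rf [b fb]]; split; first exact: radial_poly_partial.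
by exists (b + 1); exact: partial_support.
Qed.

Lemma radial_test_test f : radial_test f -> test_function f.
Proof. by move=> [rf [b fb]]; exact: radial_poly_test rf fb. Qed.

Lemma radial_test_integrable m f : locally_summable m -> radial_test f ->
  muN.-integrable setT (EFin \o (fun x => m x * f x)).
Proof.
move=> lm [rf [b fb]]; have [B fB] := radial_poly_bounded rf fb.
exact: compact_support_integrable lm (radial_poly_measurable rf) fB fb.
Qed.

Lemma cst_locally_summable (c : R) : locally_summable (fun _ : 'rV[R]_N => c).
Proof. by split => // r; exact: cst_integrable. Qed.

Lemma radial_test_sqr_integrable f : radial_test f ->
  muN.-integrable setT (EFin \o (fun x => f x ^+ 2)).
Proof.
move=> [rf [b fb]]; have := @radial_test_integrable (fun=> 1) (fun x => f x * f x)
  (cst_locally_summable 1).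
have -> : (fun x => 1 * (f x * f x)) = (fun x => f x ^+ 2).
  by apply/funext => x; rewrite mul1r.
apply; split; first exact: rp_mul.
by exists b => x /fb ->; rewrite mulr0.
Qed.

(** The i-th partial derivative of f is again a test function, to which the
    definition of the weak gradient applies. *)
Lemma gradient_laplacian u (g : 'rV[R]_N -> 'rV[R]_N) f : locally_summable u ->
  (forall i, locally_summable (fun x => g x ord0 i)) ->
  weak_gradient u g -> radial_test f ->
  \int[muN]_x (u x * laplacian f x) =
    - \sum_i \int[muN]_x (g x ord0 i * partial i f x).
Proof.
move=> lu lg ug tf.
have tp i := radial_test_partial i tf.
have int i := radial_test_integrable lu (radial_test_partial i (tp i)).
have -> : \int[muN]_x (u x * laplacian f x) =
    \sum_i \int[muN]_x (u x * partial i (partial i f) x).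
  apply: EFin_inj; rewrite -sumEFin.
  under eq_bigr do rewrite -(EFin_Rint measurableT (int _)).
  rewrite -(integral_sum measurableT int) -EFin_Rint//.
    by apply: eq_integral => x _; rewrite /laplacian mulr_sumr sumEFin.
  have := integrable_sum measurableT (index_enum 'I_N) (P := xpredT) (fun i _ => int i).
  congr (_.-integrable _ _); apply/funext => x /=.
  by rewrite /laplacian mulr_sumr sumEFin.
by rewrite -sumrN; apply: eq_bigr => i _; rewrite (ug i _ (radial_test_test (tp i))).
Qed.

Lemma sum_integral (g : 'rV[R]_N -> 'rV[R]_N) f :
  (forall i, locally_summable (fun x => g x ord0 i)) -> radial_test f ->
  \int[muN]_x (\sum_i (g x ord0 i * partial i f x)) =
    \sum_i \int[muN]_x (g x ord0 i * partial i f x).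
Proof.
move=> lg tf; have int i := radial_test_integrable (lg i) (radial_test_partial i tf).
apply: EFin_inj; rewrite -sumEFin.
under eq_bigr do rewrite -(EFin_Rint measurableT (int _)).
rewrite -(integral_sum measurableT int) -EFin_Rint//.
  by apply: eq_integral => x _; rewrite sumEFin.
have := integrable_sum measurableT (index_enum 'I_N) (P := xpredT) (fun i _ => int i).
by congr (_.-integrable _ _); apply/funext => x /=; rewrite sumEFin.
Qed.

Lemma potential_mass m (theta chi : R -> R) (b : R) : locally_summable m -> half_test chi ->
  (forall r : R, is_derive r 1 theta (chi r / r ^+ k)) ->
  (forall r, b <= r -> theta r = 0) ->
  \int[muN]_x (m x * theta (enorm x)) = - pairing (mass m) (fun r => chi r / r ^+ k).
Proof.
move=> lm hx dt tb; have hq := half_test_divX k hx.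
have [a [c [a0 ac qac _]]] := half_test_itv hq hq.
apply: (@mass_fubini _ _ m theta _ a (Num.max b c)) => //.
- exact: half_test_cont.
- move=> r rn; apply: qac; apply: contra rn => /andP[-> rc]/=.
  by rewrite le_max rc orbT.
- by move=> r; rewrite ge_max => /andP[/tb].
Qed.

Section tested.
Variables (u : 'rV[R]_N -> R) (g : 'rV[R]_N -> 'rV[R]_N) (w : 'rV[R]_N -> R) (h : R -> R).
Hypotheses (lu : locally_summable u) (mh : measurable_fun setT h).
Hypothesis uh : {ae muN, forall x, u x = h (enorm x)}.
Hypotheses (ug : L2_gradient u g) (uw : L2_laplacian u w).

Let lg i : locally_summable (fun x => g x ord0 i).
Proof. have [_ /(_ i)] := ug; apply: Lfun_locally_summable; exact: ler1n. Qed.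

Let lw : locally_summable w.
Proof. have [_] := uw; apply: Lfun_locally_summable; exact: ler1n. Qed.

(** Testing the definition of the Laplacian with a radial potential: the weak
    form of the divergence theorem on balls. *)
Lemma divergence_identity chi (chi' : R -> R) : half_test chi ->
  (forall r : R, is_derive r 1 chi (chi' r)) ->
  S * pairing h chi' = - pairing (fun r => mass w r / r ^+ k) chi.
Proof.
move=> hx dx; have [theta [b [dt tb rt pt lt]]] := radial_potential k hx dx.
rewrite -(radial_pairing lu mh uh (half_test_derive dx hx)).
have tt : radial_test (fun x : 'rV[R]_N => theta (enorm x)) by split=> //; exists b => x /tb.
have := uw.1 _ (radial_test_test tt); rewrite lt => ->.
rewrite (potential_mass lw hx dt tb); congr (- _).
by apply: eq_Rintegral => r _; rewrite mulrAC mulrA.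
Qed.

(** The gradient being square summable, h is close to a constant away from the
    origin; chi is meant to approach the indicator of an interval. *)
Lemma energy_bound chi (chi' : R -> R) d : half_test chi ->
  (forall r : R, is_derive r 1 chi (chi' r)) -> 0 < d ->
  S * `|pairing h chi'| <= d * (\sum_i \int[muN]_x (g x ord0 i ^+ 2)) +
    N%:R * S * pairing (fun r => chi r / r ^+ k) chi / d.
Proof.
move=> hx dx d0; have [theta [b [dt tb rt pt lt]]] := radial_potential k hx dx.
have S0 := @sphere_area_gt0 R k.
rewrite -[X in X * _](ger0_norm (ltW S0)) -normrM.
rewrite -(radial_pairing lu mh uh (half_test_derive dx hx)).
have tt : radial_test (fun x : 'rV[R]_N => theta (enorm x)) by split=> //; exists b => x /tb.
have := gradient_laplacian lu lg ug.1 tt; rewrite lt => ->.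
rewrite normrN; apply: le_trans (ler_norm_sum _ _ _) _.
rewrite mulr_sumr -[N in N%:R * S]card_ord -[X in _ + X * _ * _ / _]sumr_const.
rewrite !mulr_suml -big_split/=; apply: ler_sum => i _.
have ti := radial_test_partial i tt; have mi := radial_poly_measurable ti.1.
have := @L2_pairing_bound _ _ setT _ _ d measurableT (ug.2 i) mi (radial_test_sqr_integrable ti) d0.
move=> /le_trans; apply; rewrite lerD2l ler_pM2r ?invr_gt0// mul1r.
have hq : half_test (fun r => chi r / r ^+ k * chi r).
  by apply: half_testMl => //; exact: (half_test_divX k hx).1.
have l1 := cst_locally_summable 1.
have -> : S * pairing (fun r => chi r / r ^+ k) chi =
    \int[muN]_y (1 * (chi (enorm y) / enorm y ^+ k * chi (enorm y) / enorm y ^+ k)).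
  rewrite (@radial_pairing _ (fun=> 1) _ l1 _ _ hq)//; last exact: aeW.
  by congr (_ * _); apply: eq_Rintegral => r _; rewrite mul1r.
have hqk := half_test_divX k hq.
have tqk : radial_test (fun y : 'rV[R]_N => chi (enorm y) / enorm y ^+ k * chi (enorm y) / enorm y ^+ k).
  split; first exact: (half_test_radial _ hqk).
  have [a [c [_ _ qc _]]] := half_test_itv hqk hqk.
  by exists (c + 1) => x cx; apply: qc; rewrite negb_and -!ltNge; apply/orP; right; move: cx; lra.
apply: le_Rintegral => //; first exact: radial_test_sqr_integrable.
  exact: (radial_test_integrable l1 tqk).
move=> x _; rewrite pt mul1r.
have [->|x0] := eqVneq (enorm x) 0; first by rewrite [0 ^+ N]exprS mul0r invr0 mulr0 mul0r expr0n/= -mulrA -expr2 sqr_ge0.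
have xi : x ord0 i ^+ 2 <= enorm x ^+ 2.
  by rewrite -(real_normK (num_real (x ord0 i))) lerXn2r ?nnegrE ?coord_le_enorm ?enorm_ge0.
have -> : chi (enorm x) / enorm x ^+ k * chi (enorm x) / enorm x ^+ k =
    (chi (enorm x) / enorm x ^+ N) ^+ 2 * enorm x ^+ 2.
  rewrite [enorm x ^+ N]exprS; have tk := expf_neq0 k x0.
  move: (enorm x) x0 tk => t t0 tk.
  move: (t ^+ k) (chi t) tk => A B A0; field; exact/andP.
by rewrite exprMn ler_wpM2l// sqr_ge0.
Qed.

(** The gradient term is turned into the mass of w by the definition of the weak
    Laplacian; the bilaplacian term stays a second derivative in r. *)
Lemma radial_equation (gamma : R) m chi (chi' : R -> R) : locally_summable m ->
  (forall phi, test_function phi ->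
    gamma * (\int[muN]_x (w x * laplacian phi x))
      + (\int[muN]_x (\sum_i (g x ord0 i * partial i phi x)))
    = \int[muN]_x (m x * phi x)) ->
  half_test chi -> (forall r : R, is_derive r 1 chi (chi' r)) ->
  forall xi, (forall r : R, is_derive r 1 (fun r => chi' r / r ^+ k) (xi r)) ->
  gamma * pairing (mass w) xi =
    pairing (mass w) (fun r => chi r / r ^+ k) + pairing (mass m) (fun r => chi r / r ^+ k).
Proof.
move=> lm eqn hx dx xi dxi; have [theta [b [dt tb rt pt lt]]] := radial_potential k hx dx.
have tt : radial_test (fun x : 'rV[R]_N => theta (enorm x)) by split=> //; exists b => x /tb.
have := eqn _ (radial_test_test tt).
rewrite (sum_integral lg tt) (potential_mass lm hx dt tb).
have -> : \sum_i \int[muN]_x (g x ord0 i * partial i (fun x => theta (enorm x)) x) =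
    pairing (mass w) (fun r => chi r / r ^+ k).
  rewrite -[LHS]opprK -(gradient_laplacian lu lg ug.1 tt).
  by rewrite (uw.1 _ (radial_test_test tt)) (potential_mass lw hx dt tb) opprK.
have hx' := half_test_derive dx hx.
have hxk := half_test_divX k hx'; have hxi := half_test_derive dxi hxk.
have -> : \int[muN]_x (w x * laplacian (fun x => theta (enorm x)) x) = - pairing (mass w) xi.
  rewrite lt; have [a [c [a0 ac qac xac]]] := half_test_itv hxi hxk.
  apply: (@mass_fubini _ _ w (fun r => chi' r / r ^+ k) xi a (c + 1)) => //.
  - exact: half_test_cont.
  - move=> r rn; apply: qac; apply: contra rn => /andP[-> rc]/=.
    by rewrite (le_trans rc)// lerDl.
  - by move=> r cr; apply: xac; rewrite negb_and -!ltNge; apply/orP; right; move: cr; lra.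
lra.
Qed.
End tested.

End radial_identities.

(** * Regularity of masses *)

Section mass_regularity.
Context {R : realType} (k : nat).
Local Notation N := k.+1.
Local Notation muN := (@lebesgue_rV R N).
Local Notation mu := (@lebesgue_measure R).
Local Notation pos := (`]0, +oo[%classic : set R).
Local Notation S := (@sphere_area R k).
Implicit Types m : 'rV[R]_N -> R.
Implicit Types f : R -> R.

Lemma mass0 m : mass m 0 = 0.
Proof.
rewrite /mass (_ : oball 0 = set0) ?Rintegral_set0//.
by apply/seteqP; split => // x; rewrite /oball /= ltNge enorm_ge0.
Qed.

Lemma sqr_integral_ge0 m : 0 <= \int[muN]_x (m x ^+ 2).
Proof. by apply: Rintegral_ge0 => x _; exact: sqr_ge0. Qed.

Lemma mass_continuous m (r : R) : m \in Lfun muN 2%:E -> 0 < r ->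
  {for r, continuous (mass m)}.
Proof.
move=> m2 r0; have V0 := @ball_volume_gt0 R k; set V := ball_volume k in V0.
set G := \int[muN]_x (m x ^+ 2); have G0 : 0 <= G by exact: sqr_integral_ge0.
apply/cvgrPdist_le => /= e e0.
pose d := e / 2 / (G + 1).
have G1 : 0 < G + 1 by lra.
have d0 : 0 < d by rewrite !divr_gt0.
have dG : d * G <= e / 2.
  by rewrite /d -mulrA ler_piMr ?divr_ge0 ?(ltW e0)// mulrC ler_pdivrMr// mul1r lerDl.
pose t := e / 2 * d / V; have t0 : 0 < t by rewrite /t divr_gt0// mulr_gt0// divr_gt0.
have cX : \forall s \near r, `|r ^+ N - s ^+ N| <= t.
  by have /cvgrPdist_le := @exprn_continuous R N r; exact.
have pos : \forall s \near r, 0 < s by exact: lt_nbhsr r0.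
apply: filterS2 cX pos => s st s0.
suff H a b : 0 < a -> a <= b -> `|b ^+ N - a ^+ N| <= t -> `|mass m b - mass m a| <= e.
  have [sr|rs] := leP s r; first exact: H.
  by rewrite distrC; apply: H; rewrite ?(ltW rs)// distrC.
move=> a0 ab ht; apply: le_trans (mass_L2_bound m2 (ltW a0) ab d0) _.
have h : V * (b ^+ N - a ^+ N) / d <= e / 2.
  rewrite ler_pdivrMr// mulrC -ler_pdivlMr//.
  exact: le_trans (ler_norm _) ht.
rewrite -/V -/G; lra.
Qed.

Lemma radial_mass m f (r : R) : locally_summable m -> measurable_fun setT f ->
  {ae muN, forall x, m x = f (enorm x)} ->
  mu.-integrable `]0, r[ (EFin \o (fun s => f s * (S * s ^+ k))) /\
  mass m r = \int[mu]_(s in `]0, r[) (f s * (S * s ^+ k)).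
Proof.
move=> [mm im] mf mfe.
have mI : measurable (`]-oo, r[%classic : set R) by exact: measurable_itv.
have mP : measurable (pos : set (measurableTypeR R)) by exact: measurable_itv.
have m0r : measurable (`]0, r[%classic : set (measurableTypeR R)) by exact: measurable_itv.
pose fr := f \_ `]-oo, r[.
have mfr : measurable_fun setT fr by apply/(measurable_restrictT _ mI); exact: measurable_funTS.
have mmr : measurable_fun setT (m \_ (oball r)).
  by apply/(measurable_restrictT _ (measurable_oball r)); exact: measurable_funTS.
have e : {ae muN, forall x, (m \_ (oball r)) x = fr (enorm x)}.
  by apply: ae_mono mfe => x mx; rewrite /fr !patchE mx; congr (if _ then _ else _).
have i1 : muN.-integrable setT (EFin \o (m \_ (oball r))).
  by rewrite -restrict_EFin; exact: (integrable_mkcond _ (measurable_oball r)).1 (im r).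
have i2 := (radial_integrable k mfr).1 (ae_eq_integrable mmr (measurable_radial mfr) e i1).
have rr : (fun s => fr s * (S * s ^+ k)) \_ pos = (fun s => f s * (S * s ^+ k)) \_ `]0, r[.
  apply/funext => s; rewrite !patchE !mem_setE !in_itv/= andbT /fr patchE mem_setE in_itv/=.
  by case: (0 < s) => //=; case: (s < r) => //; rewrite mul0r.
split.
  apply: (@integrable_mkcond _ _ _ mu _ _ m0r).2; rewrite restrict_EFin -rr -restrict_EFin.
  exact: (@integrable_mkcond _ _ _ mu _ _ mP).1 i2.
rewrite /mass Rintegral_mkcond (ae_eq_Rint mmr (measurable_radial mfr) e).
by rewrite radial_Rintegral// Rintegral_mkcond rr -Rintegral_mkcond.
Qed.

(** The singularity of f at the origin does not affect increments of the mass
    between two positive radii. *)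
Lemma radial_mass_derive m f : locally_summable m -> measurable_fun setT f ->
  {ae muN, forall x, m x = f (enorm x)} -> (forall r, 0 < r -> {for r, continuous f}) ->
  forall r : R, 0 < r -> is_derive r 1 (mass m) (f r * (S * r ^+ k)).
Proof.
move=> lm mf mfe cf r r0.
have cq s : 0 < s -> {for s, continuous (fun s => f s * (S * s ^+ k))}.
  move=> s0; apply: continuousM; first exact: cf.
  by apply: continuousM; [exact: cst_continuous|exact: exprn_continuous].
have [K dK] := pos_primitive cq.
have h a b : 0 < a -> a < b -> mass m b - mass m a = K b - K a.
  move=> a0 ab.
  have [ib ->] := radial_mass b lm mf mfe; have [ia ->] := radial_mass a lm mf mfe.
  have p0 s : a <= s <= b -> 0 < s by move=> /andP[asx _]; exact: lt_le_trans asx.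
  rewrite -(ftc2 (ltW ab) (fun s h => dK s (p0 s h)) (fun s h => cq s (p0 s h))).
  have m1 : measurable (`]0, a[%classic : set (measurableTypeR R)) by exact: measurable_itv.
  have m2 : measurable (`[a, b[%classic : set (measurableTypeR R)) by exact: measurable_itv.
  have e : `]0, b[%classic = `]0, a[ `|` `[a, b[ :> set R.
    by rewrite -itv_bndbnd_setU// bnd_simp ?ltW.
  have iu : mu.-integrable (`]0, a[ `|` `[a, b[) (EFin \o (fun s => f s * (S * s ^+ k))).
    by rewrite -e.
  have dis : [disjoint `]0, a[ & `[a, b[ :> set R].
    apply/disj_setPS => s; rewrite /= !in_itv/= => -[/andP[_ sa] /andP[as_ _]].
    by move: sa; rewrite ltNge as_.
  rewrite e (@Rintegral_setU _ _ _ mu _ _ _ m1 m2 iu dis) addrC addKr.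
  rewrite Rintegral_itv_bndo_bndc//; apply: integrableS ib => //.
  by rewrite e => s; right.
have r2 : 0 < r / 2 by lra.
apply: (@der_ext _ (fun s => mass m (r / 2) + (K s - K (r / 2)))); last first.
  by refine (der_eq (derD (der_cst _ r) (derB (dK r r0) (der_cst _ r))) _); rewrite add0r subr0.
have r2r : r / 2 < r by lra.
by apply: filterS (lt_nbhsr r2r) => s sr; rewrite -h// addrC subrK.
Qed.

Lemma radial_mass_origin m f (D : R) : locally_summable m -> measurable_fun setT f ->
  {ae muN, forall x, m x = f (enorm x)} ->
  (forall r, 0 < r <= 1 -> `|f r * r ^+ k| <= D) ->
  forall r, 0 < r <= 1 -> `|mass m r| <= S * D * r.
Proof.
move=> lm mf mfe fD r /andP[r0 r1]; have S0 := @sphere_area_gt0 R k.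
have [ir ->] := radial_mass r lm mf mfe.
have m0r : measurable (`]0, r[%classic : set (measurableTypeR R)) by exact: measurable_itv.
apply: le_trans (le_normr_Rintegral m0r ir) _.
have ic : mu.-integrable `]0, r[ (EFin \o (fun=> S * D)).
  have := @integrableS _ _ _ mu _ _ (EFin \o (fun=> S * D)) (measurable_itv `[0, r]) m0r.
  apply; last by apply: cont_integrable => x _; exact: cst_continuous.
  by apply: subset_itvScc; rewrite bnd_simp.
apply: (@le_trans _ _ (\int[mu]_(s in `]0, r[) (S * D))).
  apply: le_Rintegral => //; first exact: integrable_abse ir.
  move=> s; rewrite /= in_itv/= => /andP[s0 sr].
  rewrite mulrCA normrM (ger0_norm (ltW S0)) ler_pM2l//; apply: fD; rewrite s0/=; exact: le_trans (ltW sr) r1.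
rewrite le_eqVlt; apply/orP; left; apply/eqP; rewrite Rintegral_cst//; congr (_ * _).
by etransitivity; [exact: (congr1 fine (lebesgue_measure_itv `]0, r[))|rewrite /= lte_fin r0/= oppr0 addr0].
Qed.

Lemma origin_locally_summable m f (D : R) : measurable_fun setT m -> measurable_fun setT f ->
  {ae muN, forall x, m x = f (enorm x)} -> (forall r, 0 < r -> {for r, continuous f}) ->
  (forall r, 0 < r <= 1 -> `|f r * r ^+ k| <= D) -> locally_summable m.
Proof.
move=> mm mf mfe cf fD; split => // r; have S0 := @sphere_area_gt0 R k.
have mI : measurable (`]-oo, r[%classic : set R) by exact: measurable_itv.
have m0r : measurable (`]0, r[%classic : set (measurableTypeR R)) by exact: measurable_itv.
have mP : measurable (pos : set (measurableTypeR R)) by exact: measurable_itv.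
pose fr := f \_ `]-oo, r[.
have mfr : measurable_fun setT fr by apply/(measurable_restrictT _ mI); exact: measurable_funTS.
have mmr : measurable_fun setT (m \_ (oball r)).
  by apply/(measurable_restrictT _ (measurable_oball r)); exact: measurable_funTS.
have e : {ae muN, forall x, fr (enorm x) = (m \_ (oball r)) x}.
  by apply: ae_mono mfe => x mx; rewrite /fr !patchE mx; congr (if _ then _ else _).
apply: (integrable_mkcond _ (measurable_oball r)).2; rewrite restrict_EFin.
apply: ae_eq_integrable (measurable_radial mfr) mmr e _.
apply/(radial_integrable k mfr); apply: (@integrable_mkcond _ _ _ mu _ _ mP).2.
have rr : (fun s => fr s * (S * s ^+ k)) \_ pos = (fun s => f s * (S * s ^+ k)) \_ `]0, r[.
  apply/funext => s; rewrite !patchE !mem_setE !in_itv/= andbT /fr patchE mem_setE in_itv/=.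
  by case: (0 < s) => //=; case: (s < r) => //; rewrite mul0r.
rewrite restrict_EFin rr -restrict_EFin; apply: (@integrable_mkcond _ _ _ mu _ _ m0r).1.
have [B fB] : exists B, forall s, 1 <= s <= Num.max 1 r -> `|f s * s ^+ k| <= B.
  have [||c _ hc] := @EVT_max _ (fun s => `|f s * s ^+ k|) 1 (Num.max 1 r).
  - by rewrite le_max lexx.
  - apply: continuous_in_subspaceT => s; rewrite inE/= in_itv/= => /andP[s1 _].
    have s0 : 0 < s by lra.
    have cs : {for s, continuous (fun s => f s * s ^+ k)}.
      by apply: continuousM; [exact: cf|exact: exprn_continuous].
    exact: (@continuous_comp _ _ _ (fun s => f s * s ^+ k) (fun x : R => `|x|) s cs (@norm_continuous _ _ _)).
  by exists (`|f c * c ^+ k|) => s s1; apply: hc; rewrite in_itv.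
apply: measurable_bounded_integrable => //.
- have := lebesgue_measure_itv `]0, r[ => /= e; rewrite [ltLHS]e; case: ifPn => _; exact: ltry.
- apply: measurable_funTS; apply: measurable_funM => //; exact: measurable_weight.
exists (S * Num.max D B); split; [exact: num_real|move=> y yS s];  rewrite /= in_itv/= => /andP[s0 sr].
apply: le_trans (ltW yS); rewrite mulrCA normrM (ger0_norm (ltW S0)) ler_pM2l// le_max.
have [s1|s1] := leP s 1; first by rewrite fD ?s0.
by rewrite fB ?orbT// (ltW s1)/= le_max (ltW sr) orbT.
Qed.

End mass_regularity.

(** Cauchy-Schwarz gives O(r^(N/2)), and N / 2 >= n + 1 exactly when n <= 1; the
    parameter of mass_L2_bound is r^(n+1). *)
Lemma mass_origin (R : realType) (n : nat) (m : 'rV[R]_n.+3 -> R) : (n <= 1)%N ->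
  m \in Lfun (@lebesgue_rV R n.+3) 2%:E ->
  exists C, forall r, 0 < r <= 1 -> `|mass m r| <= C * r ^+ n.+1.
Proof.
move=> n1 m2; exists (\int[@lebesgue_rV R n.+3]_x (m x ^+ 2) + ball_volume n.+2) => r /andP[r0 r1].
have V0 := @ball_volume_gt0 R n.+2.
have d0 : 0 < r ^+ n.+1 by rewrite exprn_gt0.
have := mass_L2_bound m2 (lexx 0) (ltW r0) d0.
rewrite mass0 subr0 expr0n/= subr0 => /le_trans; apply.
rewrite mulrDl mulrC lerD2l -mulrA ler_pM2l// -[n.+3]/(2 + n.+1)%N exprD mulfK ?gt_eqF//.
case: n n1 {m m2 V0 d0} => [|[|//]] _ //.
by rewrite expr1 expr2 ler_piMr// ltW.
Qed.

(** * The radial system of a solution *)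

Section local_integrability_closure.
Context {R : realType}.
Implicit Types f g : R -> R.

Lemma locintB f g : locint f -> locint g -> locint (fun r => f r - g r).
Proof.
move=> lf lg a b a0.
rewrite (_ : _ \o _ = (fun x => (f x)%:E - (g x)%:E)%E) //.
by apply: integrableB => //; [exact: lf|exact: lg].
Qed.

Lemma locintZ (c : R) f : locint f -> locint (fun r => c * f r).
Proof.
move=> lf a b a0; rewrite (_ : _ \o _ = (fun x => c%:E * (f x)%:E)%E) //.
by apply: integrableZl => //; exact: lf.
Qed.

Lemma measurable_pos_extension f : (forall r, 0 < r -> {for r, continuous f}) ->
  measurable_fun setT (fun r : R => if 0 < r then f r else 0).
Proof.
move=> cf.
have mP : measurable (`]0, +oo[%classic : set R) by exact: measurable_itv.
rewrite (_ : (fun r => _) = f \_ `]0, +oo[).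
  apply/(measurable_restrictT _ mP); apply: open_continuous_measurable_fun.
    exact: interval_open.
  by move=> r; rewrite inE/= in_itv/= andbT; exact: cf.
by apply/funext => r; rewrite patchE mem_setE in_itv/= andbT.
Qed.

Lemma pnl_continuous (sigma : R) : 0 < sigma -> continuous (pnl sigma).
Proof.
move=> s0 x; have [->|x0] := eqVneq x 0.
  apply/cvgrPdist_le => /= e e0.
  have t0 : 0 < Num.min e 1 by rewrite lt_min e0 ltr01.
  have := @norm_continuous R R 0 => /cvgrPdist_le /(_ _ t0); apply: filterS => y.
  rewrite {1}/pnl mulr0 normr0 !sub0r !normrN normr_id le_min => /andP[ye y1].
  apply: le_trans ye; have := pnl_norm_le s0 y1.
  by rewrite powR1 mul1r.
have nx : 0 < `|x| by rewrite normr_gt0.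
have c1 : {for x, continuous (fun y : R => `|y| `^ (2 * sigma))}.
  have c2 := der_cont (der_powR (2 * sigma) nx).
  exact: (@continuous_comp _ _ _ (fun y : R => `|y|) (fun y : R => y `^ (2 * sigma)) x
    (@norm_continuous R R x) c2).
exact: (@continuousM R R (fun y : R => `|y| `^ (2 * sigma)) id x c1 (@cvg_id _ _)).
Qed.

End local_integrability_closure.

Section profile.
Context {R : realType} (k : nat).
Local Notation N := k.+1.
Local Notation muN := (@lebesgue_rV R N).
Local Notation mu := (@lebesgue_measure R).
Local Notation pos := (`]0, +oo[%classic : set R).
Local Notation S := (@sphere_area R k).
Variables (u : 'rV[R]_N -> R) (w : 'rV[R]_N -> R) (h : R -> R).
Hypotheses (lu : locally_summable u) (mh : measurable_fun setT h).
Hypothesis uh : {ae muN, forall x, u x = h (enorm x)}.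
Hypothesis (uw : L2_laplacian u w).

Lemma flux_continuous (r : R) : 0 < r -> {for r, continuous (fun r => mass w r / r ^+ k)}.
Proof.
move=> r0; have [_ w2] := uw; apply: continuousM; first exact: mass_continuous w2 r0.
apply: continuousV; last exact: exprn_continuous.
by rewrite gt_eqF// exprn_gt0.
Qed.

(** By divergence_identity, S h minus a primitive of mass w r / r^k annihilates
    the derivatives of test functions, so it is almost everywhere constant. *)
Lemma differentiable_profile : exists H : R -> R,
  [/\ measurable_fun setT H, {ae muN, forall x, u x = H (enorm x)} &
      forall r : R, 0 < r -> is_derive r 1 H (mass w r / S / r ^+ k)].
Proof.
have S0 := @sphere_area_gt0 R k.
have [Y dY] := pos_primitive flux_continuous.
have lh := radial_locint lu mh uh.
have cY r : 0 < r -> {for r, continuous Y} by move=> r0; exact: der_cont (dY r r0).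
have lY : locint Y by exact: cont_locint.
pose f r := S * h r - Y r.
have lf : locint f by apply: locintB => //; exact: locintZ.
have [|c fc] := du_bois_reymond lf.
  move=> x x' hx dx; have hx' := half_test_derive dx hx.
  rewrite pairingBl//; last exact: locintZ.
  rewrite pairingZl// (divergence_identity lu mh uh uw hx dx).
  by rewrite (pairing_parts dY flux_continuous hx dx) subrr.
have ae : {ae mu, forall r, 0 < r -> f r - c * 1 = 0}.
  apply: (@fundamental_lemma _ (fun r => f r - c * 1)) => [|g hg].
    by apply: locintB => //; exact: locint_cst.
  rewrite (@pairingBl _ f (fun=> c * 1))//; last exact: locint_cst.
  by rewrite (@pairingZl _ (fun=> 1))//; [rewrite fc// subrr|exact: locint_cst].
pose H r := if 0 < r then (Y r + c) / S else 0.
have mH : measurable_fun setT H.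
  apply: measurable_pos_extension => r r0; apply: continuousM; last exact: cst_continuous.
  by apply: continuousD; [exact: cY|exact: cst_continuous].
exists H; split => //.
  have hH : {ae mu, forall r, 0 < r -> h r = H r}.
    apply: ae_mono ae => r e r0; rewrite /H r0.
    have Sn : S != 0 by rewrite gt_eqF.
    apply: (mulfI Sn); rewrite [RHS]mulrC divfK//; have := e r0; rewrite /f mulr1; lra.
  have hH' := radial_ae k mh mH hH.
  by move: uh hH'; apply: filterS2 => x -> ->.
move=> r r0; apply: (@der_ext _ (fun r => (Y r + c) / S)).
  by apply: filterS (lt_nbhsr r0) => s s0; rewrite /H s0.
by refine (der_eq (derM (derD (dY r r0) (der_cst _ r)) (der_cst _ r)) _); ring.
Qed.

End profile.

Section system.
Context {R : realType} (n : nat).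
Local Notation k := n.+2.
Local Notation N := n.+3.
Local Notation muN := (@lebesgue_rV R N).
Local Notation mu := (@lebesgue_measure R).
Local Notation pos := (`]0, +oo[%classic : set R).
Local Notation S := (@sphere_area R k).
Variables (gamma sigma : R) (u : 'rV[R]_N -> R) (g : 'rV[R]_N -> 'rV[R]_N).
Variables (w : 'rV[R]_N -> R) (H : R -> R).
Hypotheses (gamma0 : 0 < gamma) (sigma0 : 0 < sigma) (n1 : (n <= 1)%N).
Hypotheses (lu : locally_summable u) (mH : measurable_fun setT H).
Hypothesis uH : {ae muN, forall x, u x = H (enorm x)}.
Hypotheses (ug : L2_gradient u g) (uw : L2_laplacian u w).
Hypothesis eqn : forall phi, test_function phi ->
  gamma * (\int[muN]_x (w x * laplacian phi x))
    + (\int[muN]_x (\sum_i (g x ord0 i * partial i phi x)))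
  = \int[muN]_x (`|u x| `^ (2 * sigma) * u x * phi x).
Hypothesis dH : forall r : R, 0 < r -> is_derive r 1 H (mass w r / S / r ^+ k).

(** In the radial variable the equation prescribes (r^(-k) y')' weakly for
    y = gamma mass w. The function Z is a classical solution of the same
    equation, so they differ by a + b r^N and the mass of w is differentiable.
    The function v of the system is the resulting expression of u - gamma lap u. *)
Lemma solution_system : exists v F C,
  [/\ radial_system n gamma sigma H (fun r => mass w r / S) v F,
      forall r, 0 < r <= 1 -> `|mass w r / S| <= C * r ^+ n.+1 &
      vanishes_at_origin F].
Proof.
have S0 := @sphere_area_gt0 R k; have Sn : S != 0 by rewrite gt_eqF.
have [C WC] := mass_origin n1 uw.2.
have PC r : 0 < r <= 1 -> `|mass w r / S| <= C / S * r ^+ n.+1.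
  move=> r01; rewrite normrM normfV (ger0_norm (ltW S0)) ler_pdivrMr// mulrAC divfK//.
  exact: WC.
have e0 : 0 < (2 * sigma + 1)^-1 by have := sigma0; rewrite invr_gt0; lra.
have [K K0 HK] := origin_growth e0 dH PC.
pose f r := pnl sigma (H r); pose m x := pnl sigma (u x); pose D := K `^ (2 * sigma + 1).
have fD r : 0 < r <= 1 -> `|f r * r ^+ k| <= D.
  move=> /andP[r0 r1]; have := pnl_le_pow sigma0 (HK r (introT andP (conj r0 r1))).
  rewrite powRM ?powR_ge0// -powRrM mulNr mulVf; last by have := sigma0; lra.
  rewrite powRN powRr1 ?(ltW r0)// => h; rewrite normrM (ger0_norm (exprn_ge0 _ (ltW r0))).
  apply: le_trans (ler_wpM2r (exprn_ge0 _ (ltW r0)) h) _.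
  rewrite -/D exprS -mulrA mulKf ?gt_eqF// ler_piMr ?powR_ge0//.
  by rewrite exprn_ile1// ltW.
have cH r : 0 < r -> {for r, continuous H} by move=> r0; exact: der_cont (dH r0).
have cf r : 0 < r -> {for r, continuous f}.
  by move=> r0; apply: continuous_comp; [exact: cH|exact: pnl_continuous].
have mpnl : measurable_fun setT (pnl sigma).
  by apply: continuous_measurable_fun; exact: pnl_continuous.
have mf : measurable_fun setT f by exact: measurableT_comp.
have mm : measurable_fun setT m by apply: measurableT_comp => //; exact: lu.1.
have mfe : {ae muN, forall x, m x = f (enorm x)}.
  by apply: ae_mono uH => x e; rewrite /m e.
have lm := origin_locally_summable mm mf mfe cf fD.
have dM := radial_mass_derive lm mf mfe cf.
have om := radial_mass_origin lm mf mfe fD.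
have cW r : 0 < r -> {for r, continuous (mass w)} by move=> r0; exact: mass_continuous uw.2 r0.
have cX j r : {for r, continuous (fun r : R => r ^+ j)} by exact: exprn_continuous.
have cM r : 0 < r -> {for r, continuous (mass m)} by move=> r0; exact: der_cont (dM r r0).
have cq r : 0 < r -> {for r, continuous (fun r => (mass w r + mass m r) / r ^+ k)}.
  move=> r0; apply: continuousM; first by apply: continuousD; [exact: cW|exact: cM].
  by apply: continuousV => //; rewrite gt_eqF// exprn_gt0.
have [Q dQ] := pos_primitive cq.
have cQ r : 0 < r -> {for r, continuous Q} by move=> r0; exact: der_cont (dQ r r0).
have cQk r : 0 < r -> {for r, continuous (fun r => Q r * r ^+ k)}.
  by move=> r0; apply: continuousM; [exact: cQ|exact: cX].
have [Z dZ] := pos_primitive cQk.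
have cZ r : 0 < r -> {for r, continuous Z} by move=> r0; exact: der_cont (dZ r r0).
pose Y r := gamma * mass w r - Z r.
have lW : locint (mass w) by exact: cont_locint.
have lM : locint (mass m) by exact: cont_locint.
have lZ : locint Z by exact: cont_locint.
have lY : locint Y by apply: locintB => //; exact: locintZ.
have [|a [b Yab]] := @du_bois_reymond2 _ k Y lY.
  move=> x x' xi hx dx dxi.
  have hxk := half_test_divX k (half_test_derive dx hx).
  have hxi := half_test_derive dxi hxk.
  rewrite pairingBl//; last exact: locintZ.
  rewrite pairingZl// (radial_equation lu ug uw lm eqn hx dx dxi).
  rewrite (pairing_parts dZ cQk hxk dxi).
  have -> : pairing (fun r => Q r * r ^+ k) (fun r => x' r / r ^+ k) = pairing Q x'.
    apply: eq_Rintegral => r; rewrite inE/= in_itv/= andbT => r0.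
    by rewrite mulrACA divff ?mulr1// gt_eqF// exprn_gt0.
  rewrite (pairing_parts dQ cq hx dx) opprK.
  have h1 := half_test_divX k hx.
  apply/eqP; rewrite subr_eq0; apply/eqP; rewrite /pairing -RintegralD//;
    try exact: half_test_integrable.
  apply: eq_Rintegral => r _; ring.
have cP (r : R) : {for r, continuous (fun s : R => a + b * s ^+ N)}.
  apply: continuousD; first exact: cst_continuous.
  by apply: continuousM; [exact: cst_continuous|exact: cX].
have cY r : 0 < r -> {for r, continuous (fun r => Y r - (a + b * r ^+ N))}.
  move=> r0; apply: continuousB => //; apply: continuousB; last exact: cZ.
  by apply: continuousM; [exact: cst_continuous|exact: cW].
have Y0 x : half_test x -> pairing (fun r => Y r - (a + b * r ^+ N)) x = 0.
  by move=> hx; rewrite pairingBl// ?Yab ?subrr//; apply: cont_locint.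
have Yeq r : 0 < r -> mass w r = (Z r + (a + b * r ^+ N)) / gamma.
  move=> r0; have := @continuous_pairing0 _ _ cY Y0 r r0.
  rewrite /Y => e; apply: (mulfI (lt0r_neq0 gamma0)); rewrite [RHS]mulrC divfK ?gt_eqF//.
  move: e; lra.
have dW (r : R) : 0 < r -> is_derive r 1 (mass w) (r ^+ k * ((Q r + b * N%:R) / gamma)).
  move=> r0; apply: (@der_ext _ (fun r => (Z r + (a + b * r ^+ N)) / gamma)).
    by apply: filterS (lt_nbhsr r0) => s s0; rewrite Yeq.
  refine (der_eq (derM (derD (dZ r r0) (derD (der_cst a r) (derZ b (der_pow k r)))) (der_cst _ r)) _).
  ring.
exists (fun r => H r - (Q r + b * N%:R) / S), (fun r => mass m r / S), (C / S); split => //.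
  split=> r r0.
  - exact: dH.
  - refine (der_eq (derM (dW r r0) (der_cst S^-1 r)) _).
    rewrite mulr0 addr0; field; rewrite Sn gt_eqF//.
  - refine (der_eq (derB (dH r0) (derM (derD (dQ r r0) (der_cst _ r)) (der_cst S^-1 r))) _).
    have := lt0r_neq0 (exprn_gt0 k r0); move: (r ^+ k) => t t0.
    by field; rewrite Sn t0.
  - refine (der_eq (derM (dM r r0) (der_cst S^-1 r)) _).
    by rewrite /f; field.
move=> e epos; exists (Num.min 1 (e / (D + 1))).
  by rewrite lt_min ltr01 divr_gt0// ltr_wpDl ?powR_ge0.
move=> r /andP[r0]; rewrite lt_min => /andP[r1 re].
rewrite normrM normfV (ger0_norm (ltW S0)) ler_pdivrMr//.
have r01 : 0 < r <= 1 by rewrite r0 ltW.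
apply: le_trans (om r r01) _; rewrite -mulrA mulrC ler_pM2r//.
have D0 : 0 <= D by exact: powR_ge0.
have D1 : 0 < D + 1 by lra.
move: re; rewrite ltr_pdivlMr// => re; nra.
Qed.

End system.

(** * Decay from finite energy *)

Section decay.
Context {R : realType} (n : nat).
Local Notation k := n.+2.
Local Notation N := n.+3.
Local Notation muN := (@lebesgue_rV R N).
Local Notation mu := (@lebesgue_measure R).
Local Notation pos := (`]0, +oo[%classic : set R).
Local Notation S := (@sphere_area R k).
Variables (u : 'rV[R]_N -> R) (g : 'rV[R]_N -> 'rV[R]_N) (H q : R -> R).
Hypotheses (lu : locally_summable u) (mH : measurable_fun setT H).
Hypothesis uH : {ae muN, forall x, u x = H (enorm x)}.
Hypothesis ug : L2_gradient u g.
Hypothesis dH : forall r : R, 0 < r -> is_derive r 1 H (q r).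
Hypothesis cq : forall r, 0 < r -> {for r, continuous q}.

Local Notation G := (\sum_i \int[muN]_x (g x ord0 i ^+ 2)).

Lemma power_integral (a b : R) : 0 < a -> a < b ->
  \int[mu]_(r in `[a, b]) (r ^+ k)^-1 <= (a ^+ n.+1)^-1.
Proof.
move=> a0 ab; have b0 : 0 < b by exact: lt_trans ab.
pose K r : R := - n.+1%:R^-1 * (r ^+ n.+1)^-1.
have p0 r : a <= r <= b -> 0 < r by move=> /andP[ar _]; exact: lt_le_trans ar.
have dK (r : R) : a <= r <= b -> is_derive r 1 K ((r ^+ k)^-1).
  move=> /p0 r0; have h : r ^+ n.+1 != 0 by rewrite gt_eqF// exprn_gt0.
  have dV := @derV R (fun r => r ^+ n.+1) r _ h (der_pow n r).
  refine (der_eq (derZ _ dV) _); move: h; rewrite [r ^+ k]exprS [r ^+ n.+1]exprS.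
  move: (r ^+ n) (lt0r_neq0 r0) => t tn; rewrite mulf_eq0 negb_or => /andP[_ t0].
  by field; rewrite t0 (lt0r_neq0 r0) addrC natr1 pnatr_eq0.
have cK (r : R) : a <= r <= b -> {for r, continuous (fun r : R => (r ^+ k)^-1)}.
  move=> /p0 r0; apply: continuousV; last exact: exprn_continuous.
  by rewrite gt_eqF// exprn_gt0.
rewrite (ftc2 (ltW ab) dK cK) /K.
have a1 : 0 < (a ^+ n.+1)^-1 by rewrite invr_gt0 exprn_gt0.
have b1 : 0 < (b ^+ n.+1)^-1 by rewrite invr_gt0 exprn_gt0.
have n1 : n.+1%:R^-1 <= 1 :> R by rewrite invf_le1// ler1n.
have n0 : 0 < n.+1%:R^-1 :> R by rewrite invr_gt0.
move: (n.+1%:R^-1) n1 n0 (a ^+ n.+1)^-1 (b ^+ n.+1)^-1 a1 b1 => c c1 c0 x y x0 y0.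
nra.
Qed.

(** The energy bound for test functions that increase to the indicator of
    [a, b]; the last term is an upper bound for the integral of r^(-k). *)
Lemma profile_oscillation (a b d : R) : 0 < a -> a < b -> 0 < d ->
  S * `|H b - H a| <= d * G + N%:R * S * (a ^+ n.+1)^-1 / d.
Proof.
move=> a0 ab d0; have S0 := @sphere_area_gt0 R k.
set M := leRHS; pose x j := plateau a b j.
have hx j : half_test (x j) by exact: plateau_test.
have lq : locint q by exact: cont_locint.
have xM j : S * `|pairing q (x j)| <= M.
  have dx (r : R) := half_test_der r (hx j).
  have := energy_bound lu mH uH ug (hx j) dx d0.
  rewrite (pairing_parts dH cq (hx j) dx) normrN => /le_trans; apply.
  have NS0 : 0 < N%:R * S by rewrite mulr_gt0// ltr0n.
  rewrite lerD2l ler_pM2r ?invr_gt0// (ler_pM2l NS0).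
  apply: le_trans (power_integral a0 ab).
  rewrite /pairing (Rint_supp (a := a) (b := b))//; last first.
    move=> r rab; rewrite /x plateau_out ?mulr0//.
    by apply: contra rab => /andP[ar rb]; rewrite !ltW.
  have pr (r : R) : a <= r <= b -> 0 < r by move=> /andP[ar _]; exact: lt_le_trans ar.
  have cx r : {for r, continuous (x j)} by exact: half_test_cont.
  have cV (r : R) : a <= r <= b -> {for r, continuous (fun r : R => (r ^+ k)^-1)}.
    move=> /pr r0; apply: continuousV; last exact: exprn_continuous.
    by rewrite gt_eqF// exprn_gt0.
  apply: le_Rintegral => //.
  - apply: cont_integrable => r rab; apply: continuousM => //; apply: continuousM => //.
    exact: cV.
  - exact: cont_integrable.
  move=> r; rewrite /= in_itv/= => /pr r0; rewrite mulrAC ler_piMl//.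
    by rewrite invr_ge0 exprn_ge0// ltW.
  by rewrite mulr_ile1// ?plateau_ge0 ?plateau_le1.
have cvg : `|pairing q (x j)| @[j --> \oo] --> `|H b - H a|.
  have pr (r : R) : a <= r <= b -> 0 < r by move=> /andP[ar _]; exact: lt_le_trans ar.
  rewrite -(ftc2 (ltW ab) (fun r h => dH (pr r h)) (fun r h => cq (pr r h))).
  by apply: cvg_norm; exact: pairing_plateau_cvg.
rewrite mulrC -ler_pdivlMr//.
rewrite -(cvg_lim (@Rhausdorff R) cvg); apply: limr_le; first by apply/cvg_ex; exists `|H b - H a|.
by apply: nearW => j; rewrite ler_pdivlMr// mulrC.
Qed.

(** With d = a^(-(n+1)/2) the oscillation beyond the radius a is
    O(a^(-(n+1)/2)); if |H a| were larger than that, |H| would be bounded below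
    at infinity, against the integrability of |u|^p. *)
Lemma profile_decay (p : R) : 0 < p -> u \in Lfun muN p%:E -> 1 <= p -> decays H (n.+1%:R / 2).
Proof.
move=> p0 up p1; have S0 := @sphere_area_gt0 R k.
exists ((G + N%:R * S) / S) => a a1; have a0 : 0 < a by lra.
set C := _ / S; set t := a `^ _; have t0 : 0 < t by exact: powR_gt0.
have tt : (a ^+ n.+1)^-1 = t * t.
  rewrite /t -powRD; last by rewrite (gt_eqF a0) implybT.
  rewrite -opprD -splitr powRN powR_mulrn// ltW//.
have osc b : a < b -> `|H b - H a| <= C * t.
  move=> ab; have := profile_oscillation a0 ab t0.
  rewrite tt /C; move: (G) (S) S0 `|H b - H a| => g0 s s0 y.
  rewrite mulrC -ler_pdivlMr// => /le_trans; apply.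
  by rewrite le_eqVlt; apply/orP; left; apply/eqP; field; rewrite !gt_eqF.
have [//|Ha] := leP `|H a| (C * t); exfalso.
pose dl := `|H a| - C * t; have dl0 : 0 < dl by rewrite subr_gt0.
have Hb b : a <= b -> dl <= `|H b|.
  rewrite le_eqVlt => /predU1P[<-|/osc ab].
    by rewrite /dl gerBl; apply: le_trans (normr_ge0 _) (osc (a + 1) _); rewrite ltrDl.
  by have := lerB_dist (H a) (H b); rewrite distrC /dl; lra.
pose f r := `|H r| `^ p; pose phi r := f r * (S * r ^+ k).
have mf : measurable_fun setT f.
  apply: (@measurableT_comp _ _ _ _ _ _ (fun y : R => y `^ p)) => //; exact: measurableT_comp.
have iphi : mu.-integrable pos (EFin \o phi).
  apply/(radial_integrable k mf); have := Lfun_integrable p1 up.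
  apply: (@ae_eq_integrable _ _ (fun x => `|u x| `^ p)).
  - apply: (@measurableT_comp _ _ _ _ _ _ (fun y : R => y `^ p)) => //.
    by apply: measurableT_comp => //; exact: lu.1.
  - exact: measurable_radial.
  - by apply: ae_mono uH => x ->.
pose I := \int[mu]_(r in pos) phi r.
have phi0 r : 0 < r -> 0 <= phi r.
  by move=> r0; rewrite mulr_ge0 ?powR_ge0// weight_ge0// ltW.
have I0 : 0 <= I.
  by apply: Rintegral_ge0 => r; rewrite /= in_itv/= andbT; exact: phi0.
pose e := dl `^ p * S; have e0 : 0 < e by rewrite mulr_gt0// powR_gt0.
pose b := a + (I + 1) / e.
have ab : a < b by rewrite ltrDl divr_gt0//; lra.
have mab : measurable (`[a, b]%classic : set (measurableTypeR R)) by exact: measurable_itv.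
have sub : `[a, b]%classic `<=` pos.
  by move=> r; rewrite /= !in_itv/= andbT => /andP[ar _]; exact: lt_le_trans ar.
have iab : mu.-integrable `[a, b] (EFin \o phi) by apply: integrableS iphi.
have h1 : \int[mu]_(r in `[a, b]) phi r <= I.
  rewrite /I /Rintegral; apply: fine_le; [exact: integrable_fin_num|exact: integrable_fin_num|].
  apply: ge0_subset_integral => //.
    exact: (measurable_int mu iphi).
  by move=> r; rewrite /= in_itv/= andbT => r0; rewrite lee_fin phi0.
have h2 : e * (b - a) <= \int[mu]_(r in `[a, b]) phi r.
  have -> : e * (b - a) = \int[mu]_(r in `[a, b]) e.
    apply/esym; etransitivity; first exact: (Rintegral_cst mu mab e).
    by congr (_ * _); etransitivity; [exact: (congr1 fine (lebesgue_measure_itv `[a, b]))|rewrite /= lte_fin ab].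
  apply: le_Rintegral => //; first by apply: cont_integrable => r _; exact: cst_continuous.
  move=> r; rewrite /= in_itv/= => /andP[ar _].
  rewrite /e /phi /f ler_pM ?powR_ge0 ?(ltW S0)//.
    by apply: ge0_ler_powR; rewrite ?nnegrE ?(ltW p0) ?(ltW dl0)// Hb.
  by rewrite ler_peMr ?(ltW S0)// exprn_ege1// (le_trans a1).
have : e * (b - a) = I + 1 by rewrite /b addrAC subrr add0r mulrC divfK// gt_eqF.
by move: h1 h2; lra.
Qed.

End decay.

(** * The asymptotics of radial solutions *)

Section solution.
Context {R : realType} (n : nat).
Local Notation k := n.+2.
Local Notation N := n.+3.
Local Notation muN := (@lebesgue_rV R N).
Local Notation mu := (@lebesgue_measure R).
Local Notation S := (@sphere_area R k).

Lemma radial_extension (H : R -> R) (l K : R) : (forall r, 0 < r -> {for r, continuous H}) ->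
  (forall r, 0 < r <= 1 -> `|H r - l| <= K * r) ->
  continuous (fun r : R => if 0 < r then H r else l).
Proof.
move=> cH Hl r; set g := fun r => _.
have [r0|r0|->] := ltgtP r 0.
- apply: (@der_cont _ _ _ 0); apply: der_ext (der_cst l r).
  by apply: filterS (lt_nbhsl r0) => s s0; rewrite /g ltNge ltW.
- have gH : {near r, H =1 g} by apply: filterS (lt_nbhsr r0) => s s0; rewrite /g s0.
  have gr : g r = H r by rewrite /g r0.
  rewrite /continuous_at gr; apply: cvg_trans (cH r r0).
  by apply: near_eq_cvg; apply: filterS gH => s ->.
have K0 : 0 <= K.
  have h1 : 0 < (1 : R) <= 1 by rewrite ltr01 lexx.
  by have := le_trans (normr_ge0 _) (Hl 1 h1); rewrite mulr1.
apply/cvgrPdist_le => /= e e0.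
have g0 : g 0 = l by rewrite /g ltxx.
have t0 : 0 < Num.min 1 (e / (K + 1)) by rewrite lt_min ltr01 divr_gt0// ltr_wpDl.
have := @norm_continuous R R 0 => /cvgrPdist_le /(_ _ t0); apply: filterS => y.
rewrite g0 normr0 !sub0r !normrN normr_id le_min => /andP[y1 ye].
rewrite /g; case: ifPn => y0; last by rewrite subrr normr0 ltW.
move: y1 ye; rewrite (gtr0_norm y0) => y1 ye.
rewrite distrC; apply: (le_trans (Hl y _)); first by rewrite y0.
move: ye; rewrite ler_pdivlMr ?ltr_wpDl// => ye; nra.
Qed.

Lemma power_limit (H : R -> R) (A a K m : R) : 1 <= a ->
  (forall r, a <= r -> `|H r - A * r `^ (- m)| <= K * r `^ (- (m + 1))) ->
  forall e, 0 < e -> exists M, forall r, M < r -> `|A - H r / r `^ (- m)| <= e.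
Proof.
move=> a1 HA e e0; exists (Num.max a (`|K| / e)) => r; rewrite gt_max => /andP[ar Kr].
have r0 : 0 < r by lra.
have p0 : 0 < r `^ (- m) by exact: powR_gt0.
have -> : A - H r / r `^ (- m) = - ((H r - A * r `^ (- m)) / r `^ (- m)).
  by field; rewrite gt_eqF.
rewrite normrN normrM normfV (gtr0_norm p0) ler_pdivrMr//.
apply: le_trans (HA r (ltW ar)) _.
rewrite opprD powRD; last by rewrite (gt_eqF r0) implybT.
rewrite powR_inv1 ?(ltW r0)// [e * _]mulrC mulrCA ler_pM2l// ler_pdivrMr//.
by apply: le_trans (ler_norm K) _; move: Kr; rewrite ltr_pdivrMr// mulrC => /ltW.
Qed.

Lemma radial_solution_asymptotics (gamma sigma : R) (u : 'rV[R]_N -> R) :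
  0 < gamma -> (n <= 1)%N -> 2 < sigma * n.+1%:R -> X_space u ->
  ~ {ae muN, forall x, u x = 0} -> radial u -> weak_solution gamma sigma u ->
  exists v : 'rV[R]_N -> R,
    [/\ continuous v,
        {ae muN, forall x, u x = v x} &
        exists2 C : R, C != 0 &
          v x / enorm x `^ (2 - N%:R) @[x --> at_infinity] --> C].
Proof.
move=> gamma0 n1 sm [[up _] _] u0 [h mh uh] [g [w [ug uw eqn]]].
have m0 : 0 < n.+1%:R :> R by rewrite ltr0n.
have eN : N%:R = n.+1%:R + 2 :> R by rewrite -natrD addn2.
have sigma0 : 0 < sigma by rewrite -(pmulr_lgt0 _ m0); lra.
have p1 : 1 <= 2 * N%:R / (N%:R - 2) :> R.
  by rewrite eN addrK ler_pdivlMr//; lra.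
have p0 := lt_le_trans ltr01 p1.
have lu := Lfun_locally_summable p1 up.
have [H [mH uH dH]] := differentiable_profile lu mh uh uw.
have cq r : 0 < r -> {for r, continuous (fun r => mass w r / S / r ^+ k)}.
  move=> r0; apply: continuousM.
    by apply: continuousM; [exact: mass_continuous uw.2 r0|exact: cst_continuous].
  by apply: continuousV; [rewrite gt_eqF// exprn_gt0|exact: exprn_continuous].
have cH r : 0 < r -> {for r, continuous H} by move=> r0; exact: der_cont (dH r r0).
have [v [F [C [sys PC vF]]]] := solution_system gamma0 sigma0 n1 lu mH uH ug uw eqn dH.
have decH := profile_decay lu mH uH ug dH cq p0 up p1.
have nz : exists2 r, 0 < r & H r != 0.
  apply: contrapT => no; apply: u0.
  have h0 : {ae mu, forall r, 0 < r -> H r = (cst 0 : R -> R) r}.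
    by apply: aeW => r r0; apply/eqP; apply: contra_notT no => Hr; exists r.
  have := radial_ae k mH (measurable_cst _) h0.
  by move: uH; apply: filterS2 => x ->.
have [A [a [K [A0 a1 HA]]]] := radial_decay gamma0 n1 sm sys PC decH nz.
have [l [K' Hl]] := radial_origin_limit gamma0 sigma0 sys PC vF.
pose V r := if 0 < r then H r else l.
have cV : continuous V by exact: radial_extension Hl.
exists (fun x => V (enorm x)); split.
- move=> x; apply: continuous_comp; [exact: enorm_continuous|exact: cV].
- have HV : {ae mu, forall r, 0 < r -> H r = V r} by apply: aeW => r r0; rewrite /V r0.
  have := radial_ae k mH (continuous_measurable_fun cV) HV.
  by move: uH; apply: filterS2 => x ->.
exists A => //; have -> : 2 - N%:R = - n.+1%:R :> R by rewrite eN; lra.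
apply/cvgrPdist_le => e e0; have [M MH] := power_limit a1 HA e0.
exists (Num.max 0 M) => x; rewrite gt_max => /andP[x0 Mx].
by rewrite /V x0; exact: MH.
Qed.

End solution.

Theorem proposition1p6 (R : realType) (N : nat) (gamma sigma : R)
    (u : 'rV[R]_N -> R) :
  0 < gamma ->
  (N = 3%N /\ 2 < sigma) \/ (N = 4%N /\ 1 < sigma) ->
  X_space u ->
  ~ {ae lebesgue_rV N, forall x, u x = 0} ->
  radial u ->
  weak_solution gamma sigma u ->
  exists v : 'rV[R]_N -> R,
    [/\ continuous v,
        {ae lebesgue_rV N, forall x, u x = v x} &
        exists2 C : R, C != 0 &
          v x / enorm x `^ (2 - N%:R) @[x --> at_infinity] --> C].
Proof.
move=> gamma0 [[NE s2]|[NE s1]]; move: u; rewrite NE => u.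
- by apply: (@radial_solution_asymptotics R 0) => //; rewrite mulr1.
- by apply: (@radial_solution_asymptotics R 1) => //; lra.
Qed.
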